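(* For each pair $(\alpha,p_\alpha)$ in the following list, every prime $p>p_\alpha$ satisfies $g(p)<p^\alpha$: $(0.62,\,1.91\times10^{23})$, $(0.615,\,1.97\times10^{24})$, $(0.61,\,2.47\times10^{25})$, $(0.605,\,4.00\times10^{26})$, $(0.6,\,8.52\times10^{27})$, $(0.595,\,2.53\times10^{29})$, $(0.59,\,1.09\times10^{31})$, $(0.585,\,7.24\times10^{32})$, $(0.58,\,8.21\times10^{34})$, $(0.575,\,1.77\times10^{37})$, $(0.57,\,7.98\times10^{39})$, $(0.565,\,9.42\times10^{42})$, $(0.56,\,3.57\times10^{46})$, $(0.555,\,6.08\times10^{50})$, $(0.55,\,7.27\times10^{55})$.
   Context: For a prime $p$, $g(p)$ denotes the least positive integer that is a primitive root modulo $p$, i.e. whose residue class generates the cyclic group $(\mathbb{Z}/p\mathbb{Z})^\times$. *)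

(* Defs.v *)
From Stdlib Require Import Reals List.
From mathcomp Require Import all_boot all_algebra all_fingroup.
Set Implicit Arguments. Unset Strict Implicit. Unset Printing Implicit Defensive.

Definition is_primroot (p a : nat) : bool :=
  match insub (a%:R : 'F_p)%R : option {unit 'F_p} with
  | Some u => (<[u]>%g == [set: {unit 'F_p}])
  | None => false
  end.

(* g p = least positive integer that is a primitive root mod p.
   For prime p such an integer exists and lies in [1, p-1], so the least one
   is the first element of the filtered list [1, ..., p]. *)
Definition g (p : nat) : nat := head 0%N [seq a <- iota 1 p | is_primroot p a].

Local Open Scope R_scope.

Definition table5 : list (R * R) :=
  (62/100, 191/100 * 10^23) ::
  (615/1000, 197/100 * 10^24) ::
  (61/100, 247/100 * 10^25) ::
  (605/1000, 400/100 * 10^26) ::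
  (6/10, 852/100 * 10^27) ::
  (595/1000, 253/100 * 10^29) ::
  (59/100, 109/100 * 10^31) ::
  (585/1000, 724/100 * 10^32) ::
  (58/100, 821/100 * 10^34) ::
  (575/1000, 177/100 * 10^37) ::
  (57/100, 798/100 * 10^39) ::
  (565/1000, 942/100 * 10^42) ::
  (56/100, 357/100 * 10^46) ::
  (555/1000, 608/100 * 10^50) ::
  (55/100, 727/100 * 10^55) :: nil.

(* Main.v *)
(* Let s be the set of primes dividing p - 1; for q in s write 1_q(t) for the
   indicator of t being a q-th power residue mod p. Split s into a core (the
   smallest primes) and a rest with delta = 1 - sum_(q in rest) 1/q > 0. The sieve
     f(t) = prod_(r in core) (r/(r-1)) (1 - 1_r(t)) * (1 - sum_(q in rest) 1_q(t))
   is nonpositive unless t is a primitive root, and is delta plus a combination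
   sum_i c_i chi_i(t) of nonprincipal characters; the combination with |c_i| in
   place of c_i is again an explicit combination C of the indicators 1_k.

   Let H be about sqrt(385000 p) and suppose no n <= H is a primitive root. For
   coprime (q, n) with n + q h <= H the window x, x+1, ..., x+h-1 with x = n/q is
   proportional to nonprimitive residues, and so is the window ending at -n/q.
   Hence delta h <= sum_i |c_i| |S_i(x)| with S_i(x) = sum_(b<h) chi_i(x+b), at about
   H^2/(2h) distinct points x. Cauchy-Schwarz and summation over all x bound
   sum_i |c_i| |S_i|^2, resp. |S_i|^4, from below; expanding in C bounds them from
   above. If p - 1 has at most 19 prime factors the second moment with bounded h is
   contradictory, and it is computed exactly. Otherwise the fourth moment is used
   with h about p^(1/4); the terms to be bounded count the x for which
   ((x+a)(x+b)) / ((x+c)(x+e)) is an m-th root of unity. For each value t of that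
   ratio, the number of x is governed by whether a discriminant, quadratic in t, is
   a square, so one needs the number of t with t^m = 1 and D(t)^((p-1)/2) = +-1,
   which is m/2 + O(sqrt p) by Stepanov's method.

   This gives g(p)^2 <= 385000 p for all primes p >= 10^23, and
   385000 <= palpha^(2 alpha - 1) on each line of the table. *)

Require Import Defs.
From Stdlib Require Import Reals List ZArith Lra.
From mathcomp Require Import all_boot all_order all_algebra all_fingroup.
From mathcomp Require Import all_solvable all_field.
From mathcomp Require Import zify ring lra.
Set Implicit Arguments. Unset Strict Implicit. Unset Printing Implicit Defensive.
Import Order.TTheory GRing.Theory Num.Theory.
Local Open Scope ring_scope.

(** On every line of the table [palpha^(2 alpha - 1)] lies between 385000 and 388000, so a single
    inequality [g(p)^2 <= K p] with [K = 385000] serves them all. Put [A = sum_i |c_i|]. Up to lower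
    order terms the second moment is contradictory when [(A/delta)^2 < K/2]. The window length h has
    dropped out, and the available bound for [A/delta] grows with the number of prime factors of p -
    1. The fourth moment needs only [(A/delta)^4 < (K/20) h]. Its sum over all x is bounded by about
    [(3 h^2 p + 7 h^4 sqrt p) A]; the two terms are comparable for h about p^(1/4), and 20 is 2 (3 +
    7). Since p exceeds the primorial of the number of its prime factors, p^(1/16) then outgrows
    [A/delta]. At this h an error of order [sqrt p] in the point counts is affordable, and their
    main terms cancel against the mean of C. The coefficients of C as a combination of indicators
    have an l1-norm of the same size as A, so replacing character sums by point counts costs nothing
    essential. *)

(** * Stepanov's method for [t ^+ m = 1] with a prescribed value of [D.[t] ^+ (p.-1)./2] *)

(** The induction hypothesis applied to [R] and to [L * R^]()[makes]('X - t%:P) ^+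
    M[divide both]R[and its derivative. Writing]R = Q * ('X - t%:P) ^+ M[gives]M * Q.[t] =
    0[, and]M[is invertible below the characteristic. The factor]L[is there because the derivation
    used later is]Q |-> 'X * D * Q^[()]. *)
Lemma dvdp_XsubC_iter_deriv (F : fieldType) (p : nat) (L : {poly F}) (t : F) (M : nat)
    (R : {poly F}) :
  p \in [pchar F] -> L.[t] != 0 -> (M <= p)%N ->
  (forall k, (k < M)%N -> (iter k (fun Q => L * Q^`()) R).[t] = 0) ->
  ('X - t%:P) ^+ M %| R.
Proof.
move=> chp Lt; elim: M R => [|M IH] R leM vanish; first by rewrite expr0 dvd1p.
have /dvdpP[Q eqR]: ('X - t%:P) ^+ M %| R.
  by apply: IH => [|k ltk]; [exact: ltnW | apply: vanish; exact: ltnW].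
have cop : coprimep (('X - t%:P) ^+ M) L.
  by apply: coprimep_expl; rewrite coprimep_sym coprimep_XsubC.
have dvdR' : ('X - t%:P) ^+ M %| R^`().
  rewrite -(Gauss_dvdpr _ cop); apply: IH => [|k ltk]; first exact: ltnW.
  by rewrite -[LHS]/((iter k _ ((fun Q => L * Q^`()) R)).[t]) -iterSr; apply: vanish.
rewrite eqR exprS dvdp_mul2r ?expf_neq0 ?polyXsubC_eq0 // dvdp_XsubCl.
case: (posnP M) => [M0|Mgt0].
  by have := vanish 0%N isT; rewrite eqR M0 /= mulr1 => /eqP.
have : ('X - t%:P) ^+ M %| Q * (('X - t%:P) ^+ M)^`().
  by rewrite -(dvdp_addr _ (dvdp_mull Q^`() (dvdpp _))) -derivM -eqR.
rewrite deriv_exp derivXsubC mul1r.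
have -> : ('X - t%:P) ^+ M = ('X - t%:P) * ('X - t%:P) ^+ M.-1.
  by rewrite -exprS prednK.
rewrite -mulr_natl mulrA dvdp_mul2r ?expf_neq0 ?polyXsubC_eq0 //.
rewrite dvdp_XsubCl rootM => /orP[//|].
rewrite /root -polyC_natr hornerC => /eqP M0.
have : (p %| M)%N by rewrite (dvdn_pcharf chp) M0.
by move/(dvdn_leq Mgt0); rewrite leqNgt leM.
Qed.

Lemma dvdp_prod_XsubC_exp (F : fieldType) (M : nat) (ts : seq F) (R : {poly F}) :
  uniq ts -> (forall t, t \in ts -> ('X - t%:P) ^+ M %| R) ->
  \prod_(t <- ts) ('X - t%:P) ^+ M %| R.
Proof.
elim: ts => [|t ts IH] /=; first by rewrite big_nil dvd1p.
case/andP=> tN uts H; rewrite big_cons Gauss_dvdp.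
  by rewrite H ?mem_head // IH // => u uts'; rewrite H // inE uts' orbT.
rewrite big_seq; apply: (big_ind (coprimep (('X - t%:P) ^+ M))).
- exact: coprimep1.
- by move=> a b ha hb; rewrite coprimepMr ha.
move=> u uin; apply: coprimep_expl; apply: coprimep_expr; apply: coprimep_XsubC2.
by rewrite subr_eq0; apply: contraNneq tN => <-.
Qed.

Lemma size_prod_XsubC_exp (F : fieldType) (M : nat) (ts : seq F) :
  size (\prod_(t <- ts) ('X - t%:P) ^+ M) = (size ts * M).+1.
Proof.
rewrite prodrXl.
have mon: \prod_(t <- ts) ('X - t%:P) \is monic by exact: monic_prod_XsubC.
have sz := size_prod_XsubC ts id.
have := size_exp (\prod_(t <- ts) ('X - t%:P)) M.
rewrite sz /= => <-; rewrite prednK // lt0n size_poly_eq0.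
by rewrite expf_neq0 // monic_neq0.
Qed.

Section Stepanov.
Variables (p : nat) (p_pr : prime p).
Local Notation F := 'F_p.
Variables (m d : nat) (D : {poly F}) (eps : F).
Hypotheses (md : (m * d)%N = p.-1) (sD : (size D <= 3)%N) (D0 : D`_0 != 0)
  (Dsq : forall (c : F) (e : {poly F}), D <> c *: (e ^+ 2)).
Let M0 := (p.-1)./2.

(** Stepanov's auxiliary polynomial. At the counted points the high powers ['X^m] and [D ^+ M0] take
    the values 1 and [eps], so vanishing there costs few linear conditions although the degree is
    large. *)
Definition stepanov_poly (J : nat) (f : nat -> {poly F} * {poly F}) : {poly F} :=
  \sum_(j < J) 'X^(m * j) * ((f j).1 + D ^+ M0 * (f j).2).

(* The action of the derivation [Q |-> 'X * D * Q^`()] on the coefficient families of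
   [stepanov_poly]. *)
Definition stepanov_step (f : nat -> {poly F} * {poly F}) (j : nat) : {poly F} * {poly F} :=
  (D * ((m * j)%:R *: (f j).1 + 'X * ((f j).1)^`()),
   D * ((m * j)%:R *: (f j).2 + 'X * ((f j).2)^`()) + M0%:R *: ('X * D^`() * (f j).2)).

(** The factor ['X * D] turns the derivatives of ['X^(m * j)] and of [D ^+ M0] back into multiples
    of these powers, so the shape of the polynomial is preserved. *)
Lemma stepanov_poly_step J f : stepanov_poly J (stepanov_step f) = 'X * D * (stepanov_poly J f)^`().
Proof.
rewrite /stepanov_poly raddf_sum /= mulr_sumr; apply: eq_bigr => j _.
rewrite /stepanov_step /=; case: (f j) => r s /=.
rewrite derivM derivXn derivD derivM deriv_exp.
have eM : D * (D^`() * D ^+ M0.-1 *+ M0) = M0%:R%:P * D^`() * D ^+ M0.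
  case: M0 => [|k] /=; first by rewrite mulr0n !mulr0 !mul0r.
  by rewrite -mulr_natr exprS polyC_natr; ring.
rewrite [RHS]mulrDr.
have -> : 'X * D * ('X^((m * j).-1) *+ (m * j) * (r + D ^+ M0 * s)) =
   D * (m * j)%:R%:P * 'X^(m * j) * (r + D ^+ M0 * s).
  case: (m * j)%N => [|k] /=; first by rewrite mulr0n mul0r !mulr0 !mul0r.
  by rewrite -mulr_natr exprS polyC_natr; ring.
have -> : 'X * D * ('X^(m * j) * (r^`() + (D^`() * D ^+ M0.-1 *+ M0 * s + D ^+ M0 * s^`())))
  = 'X^(m * j) * 'X * (D * r^`() + (D * (D^`() * D ^+ M0.-1 *+ M0)) * s + D * D ^+ M0 * s^`()) by ring.
by rewrite eM -!mul_polyC; ring.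
Qed.

Lemma size_stepanov_step (f : nat -> {poly F} * {poly F}) B : (forall j, (size (f j).1 <= B)%N /\ (size (f j).2 <= B)%N) ->
  forall j, (size (stepanov_step f j).1 <= B.+2)%N /\ (size (stepanov_step f j).2 <= B.+2)%N.
Proof.
move=> Hf j; rewrite /stepanov_step /=; case: (f j) (Hf j) => r s /= [hr hs].
have dX (q : {poly F}) : (size q <= B)%N -> (size ('X * q^`())%R <= B)%N.
  move=> sq; have [->|q0] := eqVneq q 0; first by rewrite deriv0 mulr0 size_poly0.
  have [->|dq0] := eqVneq q^`() 0; first by rewrite mulr0 size_poly0.
  rewrite mulrC size_mulX //; apply: leq_trans sq; exact: lt_size_deriv.
have key (q : {poly F}) : (size q <= B)%N ->
    (size (D * ((m * j)%:R *: q + 'X * q^`()))%R <= B.+2)%N.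
  move=> sq; apply: leq_trans (size_polyMleq _ _) _.
  have h : (size ((m * j)%:R *: q + 'X * q^`())%R <= B)%N.
    apply: leq_trans (size_polyD _ _) _; rewrite geq_max dX // andbT.
    exact: leq_trans (size_scale_leq _ _) sq.
  by move: sD h; set a := size _; set b := size _; lia.
split; first exact: key.
apply: leq_trans (size_polyD _ _) _; rewrite geq_max key //=.
apply: leq_trans (size_scale_leq _ _) _.
apply: leq_trans (size_polyMleq _ _) _.
have : (size ('X * D^`())%R <= 3)%N.
  have [->|dq0] := eqVneq D^`() 0; first by rewrite mulr0 size_poly0.
  rewrite mulrC size_mulX //; apply: leq_trans sD; apply: lt_size_deriv.
  by apply: contraNneq D0 => ->; rewrite coef0.
by move: hs; set a := size _; set b := size _; lia.
Qed.

Lemma size_iter_stepanov_step k (f : nat -> {poly F} * {poly F}) B : (forall j, (size (f j).1 <= B)%N /\ (size (f j).2 <= B)%N) ->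
  forall j, (size (iter k stepanov_step f j).1 <= B + k.*2)%N /\ (size (iter k stepanov_step f j).2 <= B + k.*2)%N.
Proof.
move=> Hf; elim: k => [|k IH]; first by move=> j; rewrite addn0.
by rewrite doubleS !addnS => j; apply: size_stepanov_step.
Qed.

Lemma lowest_term (J j0 : nat) (r : nat -> {poly F}) : (j0 < J)%N ->
  (forall j, (j < j0)%N -> r j = 0) ->
  exists P, \sum_(j < J) 'X^(m * j) * r j = 'X^(m * j0) * (r j0 + 'X^m * P).
Proof.
move=> ltJ low; exists (\sum_(j0.+1 <= j < J) 'X^(m * (j - j0.+1)) * r j).
have -> : \sum_(j < J) 'X^(m * j) * r j = \sum_(0 <= j < J) 'X^(m * j) * r j.
  by rewrite big_mkord.
rewrite (big_cat_nat (n := j0)) //=; last exact: ltnW.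
rewrite big_nat_cond big1 ?add0r; last by move=> j /andP[/andP[_ /low ->] _]; rewrite mulr0.
rewrite big_ltn // mulrDr; congr (_ + _).
rewrite [RHS]mulrA -exprD addnC -mulnS mulr_sumr !big_nat; apply: eq_bigr => j /andP[lej _].
by rewrite mulrA -exprD -mulnDr subnKC.
Qed.

(* Cancel the lowest power of ['X^m] and square: as [D ^+ p] is constant modulo ['X^m],
   the lowest pair satisfies [D * r ^+ 2 = D`_0 *: s ^+ 2], so [D] would be a square
   up to a scalar. *)
Lemma stepanov_poly_eq0 (J B : nat) (f : nat -> {poly F} * {poly F}) :
  odd p -> (B.*2 < m)%N -> (m <= p)%N ->
  (forall j, (size (f j).1 <= B)%N /\ (size (f j).2 <= B)%N) ->
  stepanov_poly J f = 0 -> forall j, (j < J)%N -> f j = (0, 0).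
Proof.
move=> oddp Bm mp sf aux0 j ltj; apply/eqP; case: eqP => // fj; exfalso.
have ex : exists i, (i < J)%N && (f i != (0, 0)) by exists j; rewrite ltj; apply/eqP.
case: (ex_minnP ex) => j0 /andP[ltj0 fj0] minj0.
have low i : (i < j0)%N -> f i = (0, 0).
  move=> lti; apply/eqP; apply: contraTT (lti) => fi; rewrite -leqNgt minj0 // fi andbT.
  exact: ltn_trans lti ltj0.
have [P1 eP] := @lowest_term J j0 (fun j => (f j).1) ltj0 (fun i h => congr1 fst (low i h)).
have [S1 eS] := @lowest_term J j0 (fun j => (f j).2) ltj0 (fun i h => congr1 snd (low i h)).
case: (f j0) (sf j0) fj0 eP eS => r s /= [hr hs] rs0 eP eS.
have e0 : r + 'X^m * P1 = - (D ^+ M0 * (s + 'X^m * S1)).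
  apply/eqP; rewrite -addr_eq0; apply/eqP.
  apply: (@mulfI _ ('X^(m * j0))); first by rewrite expf_neq0 ?polyX_eq0.
  rewrite mulr0 mulrDr -eP mulrCA -eS mulr_sumr -big_split -[RHS]aux0 /=.
  by apply: eq_bigr => i _; rewrite /= mulrDr mulrCA.
(* Write [D = D]_0 + E * 'X[. Frobenius gives]D ^+ p = D[_0 + E ^+ p * 'X^p], and [m <= p]. *)
have [Q eQ] : exists Q, D ^+ p = (D`_0)%:P + 'X^m * Q.
  have [E eD] : exists E, D = (D`_0)%:P + E * 'X.
    exists (drop_poly 1 D); rewrite -[LHS](poly_take_drop 1) expr1; congr (_ + _).
    by apply/polyP => i; rewrite coef_take_poly coefC; case: i.
  exists ('X^(p - m) * E ^+ p).
  have pn : [pchar {poly F}].-nat p.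
    by apply/pnatP => [|q qp]; [exact: prime_gt0 | rewrite dvdn_prime2 // => /eqP ->; rewrite pchar_poly pchar_Fp].
  have fermat : D`_0 ^+ p = D`_0 by rewrite -[RHS]expf_card card_Fp.
  rewrite {1}eD exprDn_pchar // -polyC_exp fermat; congr (_ + _).
  by rewrite mulrA -exprD subnKC // exprMn mulrC.
have Mp : (M0.*2.+1 = p)%N by rewrite /M0; have := prime_gt0 p_pr; move: oddp; lia.
have eD : D * (r + 'X^m * P1) ^+ 2 = D ^+ p * (s + 'X^m * S1) ^+ 2.
  have -> : D ^+ p = D * (D ^+ M0) ^+ 2 by rewrite -exprM -exprS muln2 Mp.
  by rewrite e0; ring.
have [W eW] : exists W, D * r ^+ 2 - D`_0 *: s ^+ 2 = W * 'X^m.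
  exists (Q * (s + 'X^m * S1) ^+ 2 + (D`_0)%:P * (2%:R * s * S1 + 'X^m * S1 ^+ 2)
          - D * (2%:R * r * P1 + 'X^m * P1 ^+ 2)).
  rewrite -mul_polyC.
  have -> : D * r ^+ 2 = D * (r + 'X^m * P1) ^+ 2 - D * 'X^m * (2%:R * r * P1 + 'X^m * P1 ^+ 2) by ring.
  by rewrite eD eQ; ring.
have sz2 (q : {poly F}) : (size q <= B)%N -> (size (q ^+ 2) <= B.*2.-1)%N.
  move=> hq; apply: leq_trans (size_polyMleq _ _) _.
  by move: hq; set a := size _; lia.
have B0 : (0 < B)%N.
  rewrite lt0n; apply: contraNneq rs0 => B0; move: hr hs; rewrite B0 !leqn0 !size_poly_eq0.
  by move=> /eqP -> /eqP ->.
(* The left side of [eW] has size at most [2 B + 1 <= m], too small for a nonzero multiple of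
   ['X^m]. *)
have W0 : W * 'X^m = 0.
  apply/eqP; apply: contraTT Bm => WX0; rewrite -leqNgt.
  have Wn0 : W != 0 by apply: contraNneq WX0 => ->; rewrite mul0r.
  have : (size (W * 'X^m)%R <= B.*2.+1)%N.
    rewrite -eW; apply: leq_trans (size_polyD _ _) _; rewrite size_polyN geq_max.
    apply/andP; split.
      apply: leq_trans (size_polyMleq _ _) _; have := sz2 r hr; move: sD B0.
      by set a := size _; set b := size _; lia.
    apply: leq_trans (size_scale_leq _ _) _; apply: leq_trans (sz2 s hs) _; lia.
  rewrite size_mulXn //; move: Wn0; rewrite -size_poly_eq0.
  move: (size W) => a; lia.
have eDr : D * r ^+ 2 = D`_0 *: s ^+ 2 by apply/eqP; rewrite -subr_eq0 eW W0.
have [r0|rn0] := eqVneq r 0.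
  move: rs0; rewrite r0; move: eDr; rewrite r0 expr0n mulr0 => /esym/eqP.
  by rewrite scaler_eq0 (negPf D0) expf_eq0 /= => /eqP ->; rewrite eqxx.
have : r %| s by rewrite -(@dvdp_pexp2r _ _ _ 2) // -(dvdpZr _ _ D0) -eDr dvdp_mull.
case/dvdpP => e es; apply: (Dsq (c := D`_0) (e := e)).
apply: (@mulIf _ (r ^+ 2)); first by rewrite expf_neq0.
by rewrite eDr es exprMn scalerAl.
Qed.

Definition stepanov_sub (f g : nat -> {poly F} * {poly F}) j := ((f j).1 - (g j).1, (f j).2 - (g j).2).

Lemma iter_stepanov_sub k (f g : nat -> {poly F} * {poly F}) j :
  iter k stepanov_step (stepanov_sub f g) j = stepanov_sub (iter k stepanov_step f) (iter k stepanov_step g) j.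
Proof.
elim: k j => // k IH j; rewrite !iterS /stepanov_sub /stepanov_step IH /stepanov_sub /=.
set a := iter k _ f j; set b := iter k _ g j.
by congr pair; rewrite !derivB -!mul_polyC; ring.
Qed.

Lemma iter_stepanov_poly k J (f : nat -> {poly F} * {poly F}) :
  iter k (fun Q => 'X * D * Q^`()) (stepanov_poly J f) = stepanov_poly J (iter k stepanov_step f).
Proof. by elim: k => // k IH; rewrite !iterS IH stepanov_poly_step. Qed.

(* [stepanov_poly] and all its iterated derivatives agree with this low-degree polynomial
   wherever [t ^+ m = 1] and [D.[t] ^+ (p.-1)./2 = eps]. *)
Definition reduced_poly J (f : nat -> {poly F} * {poly F}) : {poly F} :=
  \sum_(j < J) ((f j).1 + eps *: (f j).2).

Lemma horner_stepanov_poly J (f : nat -> {poly F} * {poly F}) (t : F) : t ^+ m = 1 -> D.[t] ^+ M0 = eps ->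
  (stepanov_poly J f).[t] = (reduced_poly J f).[t].
Proof.
move=> tm Dt; rewrite /stepanov_poly /reduced_poly !horner_sum; apply: eq_bigr => j _.
by rewrite hornerM hornerXn exprM tm expr1n mul1r !hornerD hornerM hornerZ horner_exp Dt.
Qed.

Lemma size_stepanov_poly J B (f : nat -> {poly F} * {poly F}) : odd p ->
  (forall j, (size (f j).1 <= B)%N /\ (size (f j).2 <= B)%N) ->
  (size (stepanov_poly J f) <= m * J.-1 + p.-1 + B)%N.
Proof.
move=> oddp sf; apply: leq_trans (size_sum _ _ _) _; apply/bigmax_leqP => j _.
case: (f j) (sf j) => r s /= [hr hs].
apply: leq_trans (size_polyMleq _ _) _; rewrite size_polyXn.
have : (size (r + D ^+ M0 * s)%R <= p.-1 + B)%N.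
  apply: leq_trans (size_polyD _ _) _; rewrite geq_max; apply/andP; split; first by apply: leq_trans hr _; lia.
  apply: leq_trans (size_polyMleq _ _) _.
  have le1 : ((size D).-1 * M0 <= p.-1)%N.
    have -> : p.-1 = (2 * M0)%N by rewrite /M0; have := prime_gt0 p_pr; move: oddp; lia.
    by rewrite leq_mul2r; apply/orP; right; move: sD; lia.
  have hE : (size (D ^+ M0) <= p.-1.+1)%N by apply: leq_trans (size_poly_exp_leq D M0) _.
  by have := leq_add hE hs; rewrite addSn; case: (_ + _)%N.
have : (m * j <= m * J.-1)%N by rewrite leq_mul2l; apply/orP; right; have := ltn_ord j; lia.
by move=> h1 h2; rewrite addSn /= -addnA leq_add.
Qed.

(* Pigeonhole: more coefficient families than values of the first [M] reduced polynomials,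
   so some nonzero [stepanov_poly] vanishes to order [M] at every counted [t]. *)
Lemma stepanov (J B M : nat) : odd p -> eps != 0 -> (B.*2 < m)%N -> (M <= p)%N ->
  (M * B + M * M.-1 < J * B.*2)%N ->
  (#|[set t : F | (t ^+ m == 1%R) && (D.[t] ^+ M0 == eps)]| * M < m * J + p)%N.
Proof.
move=> oddp eps0 Bm Mp dim.
have pgt0 := prime_gt0 p_pr.
have mp : (m < p)%N.
  have d0 : (0 < d)%N by move: md (prime_gt1 p_pr); case: (d) => //; rewrite muln0; lia.
  by have := leq_pmulr m d0; rewrite md; lia.
pose V : finType := ('rV[F]_B * 'rV[F]_B)%type.
pose T (k : 'I_M) : finType := 'rV[F]_(B + k.*2).
pose fU (u : {ffun 'I_J -> V}) (j : nat) : {poly F} * {poly F} :=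
  if insub j is Some i then (rVpoly (u i).1, rVpoly (u i).2) else (0, 0).
have sU u j : (size (fU u j).1 <= B)%N /\ (size (fU u j).2 <= B)%N.
  by rewrite /fU; case: insubP => [i _ _|_] /=; rewrite ?size_poly0 ?size_poly.
pose Phi u : {dffun forall k : 'I_M, T k} :=
  [ffun k : 'I_M => poly_rV (reduced_poly J (iter k stepanov_step (fU u)))].
have : ~ injective Phi.
  move=> inj; have := leq_card Phi inj.
  have cV : #|V| = (p ^ B.*2)%N.
    by rewrite /V card_prod !card_mx !mul1n card_Fp // -expnD addnn.
  have cT k : #|T k| = (p ^ (B + k.*2))%N by rewrite /T card_mx mul1n card_Fp.
  rewrite card_ffun card_ord cV card_dep_ffun -expnM.
  (* The k-th reduced polynomial has at most [B + 2 k] coefficients; in all [M B + M (M - 1)]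
     conditions on [2 B J] unknowns. *)
  have -> : foldr muln 1%N [seq #|T k| | k : 'I_M] = (p ^ (M * B + M * M.-1))%N.
    rewrite foldrE big_image /= (eq_bigr _ (fun k _ => cT k)).
    rewrite -expn_sum big_split /= sum_nat_const card_ord; congr (p ^ (_ + _))%N.
    elim: (M) => [|n IHn]; first by rewrite big_ord0.
    by rewrite big_ord_recr /= IHn; case: n {IHn} => //= n; lia.
  rewrite leq_exp2l ?prime_gt1 //; move: dim; lia.
move=> ninj; have /injectivePn[u [v uv Puv]] : ~~ injectiveb Phi by apply/injectiveP.
pose f := stepanov_sub (fU u) (fU v).
have sf j : (size (f j).1 <= B)%N /\ (size (f j).2 <= B)%N.
  have [a b] := sU u j; have [c e] := sU v j.
  by split; apply: leq_trans (size_polyD _ _) _; rewrite size_polyN geq_max ?a ?b ?c ?e.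
have scond k w : (size (reduced_poly J (iter k stepanov_step (fU w))) <= B + k.*2)%N.
  apply: leq_trans (size_sum _ _ _) _; apply/bigmax_leqP => j _.
  have [a b] := size_iter_stepanov_step k (sU w) j.
  apply: leq_trans (size_polyD _ _) _; rewrite geq_max a.
  exact: leq_trans (size_scale_leq _ _) b.
have condE k : (k < M)%N -> reduced_poly J (iter k stepanov_step f) = 0.
  move=> ltk; have := congr1 (fun g : {dffun _} => g (Ordinal ltk)) Puv; rewrite !ffunE /=.
  move/(congr1 rVpoly); rewrite !poly_rV_K // => e.
  apply/eqP; rewrite /f.
  have -> : reduced_poly J (iter k stepanov_step (stepanov_sub (fU u) (fU v))) =
     reduced_poly J (iter k stepanov_step (fU u)) - reduced_poly J (iter k stepanov_step (fU v)).
    rewrite /reduced_poly -sumrB; apply: eq_bigr => j _.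
    by rewrite iter_stepanov_sub /stepanov_sub /= scalerBr; ring.
  by rewrite e subrr.
have aux0 : stepanov_poly J f != 0.
  apply: contraNneq uv => /(stepanov_poly_eq0 oddp Bm (ltnW mp) sf) H.
  apply/eqP/ffunP => i; have := H i (ltn_ord i); rewrite /f /stepanov_sub /fU.
  rewrite valK; case=> /eqP; rewrite subr_eq0 => /eqP e1 /eqP; rewrite subr_eq0 => /eqP e2.
  by rewrite [LHS]surjective_pairing [RHS]surjective_pairing -[(u i).1]rVpolyK e1
     -[(u i).2]rVpolyK e2 !rVpolyK.
set G := [set t | _].
have dv : \prod_(t <- enum G) ('X - t%:P) ^+ M %| stepanov_poly J f.
  apply: dvdp_prod_XsubC_exp (enum_uniq _) _ => t; rewrite mem_enum inE => /andP[/eqP tm /eqP Dt].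
  apply: (dvdp_XsubC_iter_deriv (p := p) (L := 'X * D)) => //; first exact: pchar_Fp.
    rewrite hornerM hornerX mulf_neq0 //.
      apply/eqP => t0; move: tm; rewrite t0 expr0n eqn0Ngt (leq_ltn_trans _ Bm) //.
    have M0gt0 : (0 < M0)%N by rewrite /M0; move: oddp (prime_gt1 p_pr); lia.
    apply/eqP => Dt0; move: Dt; rewrite Dt0 expr0n eqn0Ngt M0gt0 /= => e0.
    by move: eps0; rewrite -e0 eqxx.
  by move=> k ltk; rewrite iter_stepanov_poly horner_stepanov_poly // condE // horner0.
have := dvdp_leq aux0 dv; rewrite size_prod_XsubC_exp -cardE => le.
have := leq_trans le (size_stepanov_poly J oddp sf).
case: (J) dim => [|J'] /=; first by rewrite mul0n.
move=> _ h; apply: leq_trans h _; rewrite mulnS; move: Bm pgt0; clear; lia.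
Qed.
End Stepanov.

Lemma card_root_unity_le (F : finFieldType) (m : nat) : (0 < m)%N ->
  (#|[set t : F | t ^+ m == 1%R]| <= m)%N.
Proof.
move=> m0; rewrite cardE -ltnS -(size_XnsubC (1 : F) m0).
apply: max_poly_roots; last exact: enum_uniq.
  by rewrite -size_poly_eq0 size_XnsubC.
apply/allP => t; rewrite mem_enum inE => /eqP tm.
by rewrite rootE hornerD hornerN hornerXn hornerC tm subrr.
Qed.

(* The choice is [J] about [u / 2], [B] about [m / 2], [M] about [2 J - 4 J ^ 2 / B]. *)
Lemma stepanov_parameters (m u N p : nat) : (100 <= u)%N -> (7 * u < m)%N -> (m.*2 <= p)%N ->
  (p <= u * u)%N ->
  (forall J B M, (B.*2 < m)%N -> (M <= p)%N -> (M * B + M * M.-1 < J * B.*2)%N ->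
     (N * M < m * J + p)%N) ->
  (N.*2 <= m + 7 * u)%N.
Proof.
move=> u100 um mp pu H.
set J := (u./2).+1; set B := (m.-1)./2; set q := ((J.*2 * J.*2) %/ B)%N.
have B0 : (0 < B)%N by rewrite /B; lia.
have qB1 : (q * B <= J.*2 * J.*2)%N := leq_trunc_div _ _.
have qB2 : (J.*2 * J.*2 < q.+1 * B)%N by rewrite ltn_ceil.
have mq : (50 * (m * q) <= 102 * (J.*2 * J.*2))%N.
  have h : (50 * m <= 102 * B)%N by rewrite /B; lia.
  have := leq_mul h (leqnn q); lia.
have a1 : (u < J.*2)%N by rewrite /J; lia.
have a2 : (J.*2 <= u.+2)%N by rewrite /J; lia.
have qu : (100 * q <= 31 * u)%N.
  have h1 : (J.*2 * J.*2 <= u.+2 * u.+2)%N := leq_mul a2 a2.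
  have h2 : (7 * u * q <= m * q)%N by rewrite leq_mul2r (ltnW um) orbT.
  have h3 : (350 * (u * q) <= 102 * (u.+2 * u.+2))%N by lia.
  rewrite leqNgt; apply/negP => h4.
  have : (u * (31 * u).+1 <= u * (100 * q))%N by rewrite leq_mul2l h4 orbT.
  nia.
have Mp : (J.*2 - q.+1 <= p)%N by lia.
have qlt : (q.+1 < J.*2)%N by lia.
have := H J B (J.*2 - q.+1)%N _ Mp _; set M := (J.*2 - q.+1)%N.
have eM : (M + q.+1 = J.*2)%N by rewrite /M; lia.
have Bm : (B.*2 < m)%N by rewrite /B; lia.
(* [M] falls short of [2 J] by [q + 1], and [(q + 1) B > (2 J)^2 >= M (M - 1)]. *)
have dim : (M * B + M * M.-1 < J * B.*2)%N.
  have h1 : (M * M.-1 <= J.*2 * J.*2)%N by apply: leq_mul; lia.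
  have h2 : (M * B + q.+1 * B = J * B.*2)%N by rewrite -mulnDl eM; lia.
  lia.
move/(_ Bm dim) => NM; rewrite leqNgt; apply/negP => big.
have h : ((m + 7 * u) * M <= N.*2 * M)%N by rewrite leq_mul2r (ltnW big) orbT.
have h1 : (m * M + m * q.+1 = m * J.*2)%N by rewrite -mulnDr eM.
have h2 : (7 * u * M < m * q.+1 + p.*2)%N by lia.
have h3 : (69 * u <= 100 * M)%N by lia.
have h4 : (u * (69 * u) <= u * (100 * M))%N by rewrite leq_mul2l h3 orbT.
have h5 : (J.*2 * J.*2 <= u.+2 * u.+2)%N := leq_mul a2 a2.
have h6 : (100 * u <= u * u)%N by rewrite leq_mul2r u100 orbT.
lia.
Qed.

(** For [m <= 7 u] the trivial bound by [m] already suffices; otherwise Stepanov's method applies,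
    [1 < d] giving [2 m <= p]. The integer [u] stands for an upper bound of [sqrt p]. *)
Lemma stepanov_bound (p m d u : nat) (D : {poly 'F_p}) (eps : 'F_p) :
  prime p -> odd p -> (m * d)%N = p.-1 -> (1 < d)%N -> (100 <= u)%N -> (p <= u * u)%N ->
  (size D <= 3)%N -> D`_0 != 0 -> (forall c e, D <> c *: (e ^+ 2)) -> eps != 0 ->
  (#|[set t : 'F_p | (t ^+ m == 1%R) && (D.[t] ^+ (p.-1)./2 == eps)]|.*2 <= m + 7 * u)%N.
Proof.
move=> p_pr oddp md d1 u100 pu sD D0 Dsq eps0.
have m0 : (0 < m)%N by move: md (prime_gt1 p_pr); case: (m); lia.
set N := #|_|; have [le7|gt7] := leqP m (7 * u).
  have : (N <= m)%N.
    apply: leq_trans (card_root_unity_le 'F_p m0); apply: subset_leq_card.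
    by apply/subsetP => t; rewrite !inE => /andP[].
  lia.
apply: (stepanov_parameters (p := p)) => //.
  have : (m * 2 <= m * d)%N by rewrite leq_mul2l d1 orbT.
  lia.
by move=> J B M Bm Mp dim; exact: (stepanov p_pr md sD D0 Dsq oddp eps0 Bm Mp dim).
Qed.

(** * Primitive elements, roots of unity and square roots modulo p *)

Lemma Fp_expp (p : nat) (x : 'F_p) : prime p -> x ^+ p = x.
Proof. by move=> p_pr; have := expf_card x; rewrite card_Fp. Qed.

Lemma fermat_Fp (p : nat) (x : 'F_p) : prime p -> x != 0 -> x ^+ p.-1 = 1.
Proof.
by move=> p_pr x0; apply: (mulfI x0); rewrite -exprS prednK ?prime_gt0 // mulr1 Fp_expp.
Qed.

Lemma Fp_prim_root (p : nat) : prime p -> exists g : 'F_p, p.-1.-primitive_root g.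
Proof.
move=> p_pr; have p1 := prime_gt1 p_pr.
have : has (p.-1).-primitive_root (enum [set x : 'F_p | x != 0]).
  apply: has_prim_root; rewrite ?enum_uniq //; first by lia.
    apply/allP => x; rewrite mem_enum inE => x0; apply/unity_rootP; exact: fermat_Fp.
  rewrite -cardE; have := cardsC1 (0 : 'F_p); rewrite card_Fp // => <-.
  by apply: subset_leq_card; apply/subsetP => x; rewrite !inE.
by case/hasP => g _ hg; exists g.
Qed.

Lemma prim_root_exists_exp (p : nat) (g x : 'F_p) : prime p -> p.-1.-primitive_root g ->
  x != 0 -> exists i, x = g ^+ i.
Proof.
move=> p_pr hg x0.
have xn := fermat_Fp p_pr x0.
by have [i ->] := prim_rootP hg xn; exists i.
Qed.

Lemma card_root_unity (p m d : nat) : prime p -> (m * d)%N = p.-1 ->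
  #|[set t : 'F_p | t ^+ m == 1%R]| = m.
Proof.
move=> p_pr md; have p1 := prime_gt1 p_pr.
have m0 : (0 < m)%N by move: md; case: (m) => //; lia.
have d0 : (0 < d)%N by move: md; case: (d) => //; lia.
apply/eqP; rewrite eqn_leq card_root_unity_le //=.
have [g hg] := Fp_prim_root p_pr.
have inj : injective (fun i : 'I_m => g ^+ (d * i)).
  move=> i j /eqP; rewrite (eq_prim_root_expr hg) => /eqP e; apply: val_inj => /=.
  have lt (h : 'I_m) : (d * h < p.-1)%N by rewrite -md mulnC ltn_mul2r d0 ltn_ord.
  by move: e; rewrite !modn_small // => /eqP; rewrite eqn_mul2l eqn0Ngt d0 => /eqP.
rewrite -[X in (X <= _)%N]card_ord -(card_imset _ inj); apply: subset_leq_card.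
apply/subsetP => t /imsetP[i _ ->]; rewrite inE -exprM mulnAC.
by rewrite [(d * m)%N]mulnC md exprM (prim_expr_order hg) expr1n.
Qed.

Lemma poly_neq_scale_sqr (F : fieldType) (D : {poly F}) : (size D <= 3)%N ->
  D`_1 ^+ 2 != 4%:R * D`_0 * D`_2 -> forall (c : F) (e : {poly F}), D <> c *: e ^+ 2.
Proof.
move=> sD disc c e eD; move/negP: disc; apply.
have [c0|c0] := eqVneq c 0.
  by rewrite eD c0 scale0r !coef0 expr0n !mulr0.
have se : (size e <= 2)%N.
  move: sD; rewrite eD size_scale //; have [->|e0] := eqVneq e 0; first by rewrite size_poly0.
  by rewrite expr2 size_mul //; move: (size e); lia.
have e2 : e`_2 = 0 by apply: nth_default.
apply/eqP; rewrite eD !coefZ expr2 !coefM !big_ord_recl !big_ord0 /= /bump /= e2.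
ring.
Qed.

Section QuadraticResidues.
Variables (p : nat) (p_pr : prime p) (oddp : odd p).
Local Notation F := 'F_p.
Let h := (p.-1)./2.

Lemma half_mul2 : (h * 2)%N = p.-1.
Proof. by rewrite /h; move: oddp (prime_gt1 p_pr); lia. Qed.

Lemma two_neq0 : (2%:R : F) != 0.
Proof.
rewrite -(dvdn_pcharf (pchar_Fp p_pr)); apply/negP => /dvdn_leq; move: oddp (prime_gt1 p_pr).
by case: (p) => [|[|[|?]]] // _ _ /(_ isT).
Qed.

Lemma euler_pm1 (x : F) : x != 0 -> x ^+ h = 1 \/ x ^+ h = -1.
Proof.
move=> x0; have : (x ^+ h) ^+ 2 == 1 by rewrite -exprM half_mul2 fermat_Fp.
by rewrite sqrf_eq1 => /orP[] /eqP; [left|right].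
Qed.

Lemma one_neqN1 : (1 : F) != -1.
Proof. by rewrite -subr_eq0 opprK; exact: two_neq0. Qed.

Lemma euler_sqrt (x : F) : x ^+ h = 1 -> exists y, x = y ^+ 2.
Proof.
move=> xh; have h0 : (0 < h)%N by rewrite /h; move: oddp (prime_gt1 p_pr); lia.
have x0 : x != 0.
  by apply/eqP => x0; move: xh; rewrite x0 expr0n eqn0Ngt h0 => /eqP; rewrite eq_sym oner_eq0.
have [g hg] := Fp_prim_root p_pr; have [i xi] := prim_root_exists_exp p_pr hg x0.
have : (p.-1 %| i * h)%N by rewrite (prim_order_dvd hg) exprM -xi xh.
rewrite -half_mul2 mulnC dvdn_pmul2r // => /dvdnP[j ij].
by exists (g ^+ j); rewrite xi ij exprM.
Qed.

Definition sqrts (x : F) := #|[set y : F | y ^+ 2 == x]|.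

Lemma sqrts_le2 x : (sqrts x <= 2)%N.
Proof.
rewrite /sqrts; case: (set_0Vmem [set y : F | y ^+ 2 == x]) => [->|[y]]; first by rewrite cards0.
rewrite inE => /eqP <-; apply: leq_trans (_ : #|[set y; - y]| <= 2)%N; last by rewrite cards2; case: (_ != _).
by apply: subset_leq_card; apply/subsetP => z; rewrite !inE eqf_sqr.
Qed.

Lemma sqrts_N1 x : x ^+ h = -1 -> sqrts x = 0%N.
Proof.
move=> xh; apply/eqP; rewrite cards_eq0; apply/eqP/setP => y; rewrite !inE.
apply/negP => /eqP yx; move: xh; rewrite -yx -exprM mulnC half_mul2.
have [->|y0] := eqVneq y 0; last by rewrite fermat_Fp // => /eqP; rewrite (negPf one_neqN1).
have h0 : (0 < h)%N by rewrite /h; move: oddp (prime_gt1 p_pr); lia.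
rewrite expr0n -half_mul2 muln_eq0 eqn0Ngt h0 /= => /eqP.
by rewrite eq_sym oppr_eq0 oner_eq0.
Qed.

Lemma sqrts_1 x : x ^+ h = 1 -> sqrts x = 2%N.
Proof.
move=> xh; have [y xy] := euler_sqrt xh; apply/eqP; rewrite eqn_leq sqrts_le2 /=.
have h0 : (0 < h)%N by rewrite /h; move: oddp (prime_gt1 p_pr); lia.
have yN : y != - y.
  rewrite -subr_eq0 opprK -mulr2n -mulr_natl mulf_neq0 ?two_neq0 //.
  apply/eqP => y0; move: xh; have -> : x = 0 by rewrite xy y0 expr0n.
  rewrite expr0n eqn0Ngt h0 => /eqP.
  by rewrite eq_sym oner_eq0.
have -> : 2%N = #|[set y; - y]| by rewrite cards2 yN.
by apply: subset_leq_card; apply/subsetP => z; rewrite !inE xy eqf_sqr.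
Qed.

End QuadraticResidues.

(** * Points at which a ratio of two quadratics is an m-th root of unity *)

Section QuadCount.
Variables (p m k u : nat) (p_pr : prime p) (oddp : odd p).
Local Notation F := 'F_p.
Hypotheses (mk : (m * k)%N = p.-1) (even_k : ~~ odd k) (u100 : (100 <= u)%N) (pu : (p <= u * u)%N).
Let h := (p.-1)./2.
Variables (a b c e : F).
Hypotheses (ac : a != c) (ae : a != e) (bc : b != c) (be : b != e) (abce : ~~ ((a == b) && (c == e))).

(* Discriminant in [x] of [(x + a) (x + b) - t (x + c) (x + e)]. *)
Definition disc (t : F) : F :=
  (a + b - t * (c + e)) ^+ 2 - 4%:R * (1 - t) * (a * b - t * (c * e)).

(** Coefficients of [disc] in powers of [t]. The discriminant of this quadratic is
    [16 (a - c) (a - e) (b - c) (b - e)], nonzero because the two quadratics in [x] share no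
    root. *)
Let d0 := (a - b) ^+ 2.
Let d1 := 4%:R * (a * b + c * e) - 2%:R * (a + b) * (c + e).
Let d2 := (c - e) ^+ 2.

Lemma disc_Poly t : disc t = (Poly [:: d0; d1; d2]).[t].
Proof. by rewrite horner_Poly /= /disc /d0 /d1 /d2; ring. Qed.

Lemma four_neq0 : (4%:R : F) != 0.
Proof. by rewrite (_ : 4%N = (2 * 2)%N) // natrM mulf_neq0 ?two_neq0. Qed.

Lemma disc_neq0 : Poly [:: d0; d1; d2] != 0.
Proof.
apply/eqP => D0; have d00 : d0 = 0 by have := congr1 (fun q : {poly F} => q`_0) D0; rewrite coef_Poly coef0.
have d20 : d2 = 0 by have := congr1 (fun q : {poly F} => q`_2) D0; rewrite coef_Poly coef0.
move/eqP: d00; move/eqP: d20; rewrite /d0 /d2 !expf_eq0 /= !subr_eq0 => ce ab.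
by move: abce; rewrite ab ce.
Qed.

Lemma disc_zeros : (#|[set t : F | disc t == 0%R]| <= 2)%N.
Proof.
rewrite cardE -ltnS; apply: (@leq_trans (size (Poly [:: d0; d1; d2]))); last exact: size_Poly.
apply: max_poly_roots; [exact: disc_neq0 | | exact: enum_uniq].
by apply/allP => t; rewrite mem_enum inE rootE disc_Poly.
Qed.

Lemma k_gt1 : (1 < k)%N.
Proof. have p1 : (0 < p.-1)%N by rewrite -subn1 subn_gt0 prime_gt1.
by case: (k) mk even_k => [|[|]] // kp _; move: p1; rewrite -kp muln0.
Qed.

Lemma card_disc (eps : F) : eps != 0 ->
  (#|[set t : F | (t ^+ m == 1%R) && (disc t ^+ h == eps)]|.*2 <= m + 7 * u)%N.
Proof.
move=> eps0; have [ab|ab] := eqVneq a b.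
  have ce : c != e by move: abce; rewrite ab eqxx.
  pose E := Poly [:: d1; d2].
  have d1E : d1 = 4%:R * (a - c) * (a - e) by rewrite /d1 -ab; ring.
  have := @stepanov_bound p m k u E eps p_pr oddp mk k_gt1 u100 pu.
  set X := #|_|; set Y := #|_|; have -> : X = Y.
    rewrite /X /Y; congr #|pred_of_set _|; apply/setP => t; rewrite !inE.
    case: eqVneq => //= tm; congr (_ == _).
    rewrite disc_Poly !horner_Poly /= /d0 ab subrr expr0n /= mul0r add0r addr0.
    have -> : (((d2 * t + d1) * t) ^+ h = (d2 * t + d1) ^+ h)%R.
      rewrite exprMn (_ : h = (m * (k./2))%N); first by rewrite [t ^+ _]exprM tm expr1n mulr1.
      by rewrite /h -mk -[in LHS](odd_double_half k) (negPf even_k) add0n -doubleMr doubleK.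
    by rewrite ?mul0r ?add0r.
  apply => //.
  - by apply: leq_trans (size_Poly _) _.
  - by rewrite coef_Poly /= d1E !mulf_neq0 ?four_neq0 ?subr_eq0.
  apply: poly_neq_scale_sqr; first by apply: leq_trans (size_Poly _) _.
  by rewrite !coef_Poly /= mulr0 expf_neq0 // expf_neq0 // subr_eq0.
have eqG : [set t : F | (t ^+ m == 1) && (disc t ^+ h == eps)] =
    [set t : F | (t ^+ m == 1) && ((Poly [:: d0; d1; d2]).[t] ^+ h == eps)].
  by apply/setP => t; rewrite !inE disc_Poly.
rewrite eqG; apply: (stepanov_bound p_pr oddp mk k_gt1 u100 pu) => //.
- exact: size_Poly.
- by rewrite coef_Poly /= expf_neq0 // subr_eq0.
apply: poly_neq_scale_sqr; first exact: size_Poly.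
rewrite !coef_Poly /= -subr_eq0.
have -> : d1 ^+ 2 - 4%:R * d0 * d2 = 4%:R * 4%:R * (a - c) * (a - e) * (b - c) * (b - e).
  by rewrite /d0 /d1 /d2; ring.
by rewrite !mulf_neq0 ?four_neq0 ?subr_eq0.
Qed.

Definition fiber (t : F) := [set x : F | (x + a) * (x + b) == t * ((x + c) * (x + e))].

(** Completing the square: the affine map [f] carries the fiber bijectively onto the square roots of
    [disc t]. *)
Lemma card_fiber t : t != 1 -> #|fiber t| = sqrts (disc t).
Proof.
move=> t1; have lead : 2%:R * (1 - t) != 0.
  by rewrite mulf_neq0 ?two_neq0 // subr_eq0 eq_sym.
pose f x := 2%:R * (1 - t) * x + (a + b - t * (c + e)).
have inj : injective f by move=> x y /addIr /(mulfI lead).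
rewrite /sqrts -(card_imset _ inj); congr #|pred_of_set _|; apply/setP => y; rewrite inE.
have sqE x : f x ^+ 2 - disc t = 2%:R * (2%:R * (1 - t)) * ((x + a) * (x + b) - t * ((x + c) * (x + e))).
  by rewrite /f /disc; ring.
have key x : (x \in fiber t) = (f x ^+ 2 == disc t).
  by rewrite inE -[RHS]subr_eq0 sqE mulf_eq0 mulf_eq0 (negPf lead) (negPf (two_neq0 p_pr oddp)) subr_eq0.
apply/imsetP/idP => [[x xf ->]|yd]; first by rewrite -key.
exists ((y - (a + b - t * (c + e))) / (2%:R * (1 - t))); last first.
  by rewrite /f mulrC divfK // subrK.
by rewrite key /f mulrC divfK // subrK.
Qed.

(** At [t = 1] the equation is linear; when its slope vanishes, its constant term is
    [(a - c) (a - e)] up to sign, so there is no solution. *)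
Lemma card_fiber1 : (#|fiber 1%R| <= 1)%N.
Proof.
have eqf x : (x \in fiber 1) = ((a + b - (c + e)) * x == c * e - a * b).
  rewrite inE mul1r -subr_eq0 -[RHS]subr_eq0; congr (_ == _); ring.
have [s0|s0] := eqVneq (a + b - (c + e)) 0.
  suff -> : fiber 1 = set0 by rewrite cards0.
  apply/setP => x; rewrite eqf s0 mul0r inE eq_sym subr_eq0; apply/negbTE.
  have eb : b = c + e - a by rewrite -[LHS]subr0 -s0; ring.
  rewrite -subr_eq0; have -> : c * e - a * b = (a - c) * (a - e) by rewrite eb; ring.
  by rewrite mulf_neq0 ?subr_eq0.
rewrite -[X in (_ <= X)%N](cards1 ((c * e - a * b) / (a + b - (c + e)))).
apply: subset_leq_card; apply/subsetP => x; rewrite eqf inE => /eqP <-.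
by rewrite mulrAC divff // mul1r.
Qed.

Definition ratio_power (x : F) := [&& (x + a) * (x + b) != 0, (x + c) * (x + e) != 0 &
  ((x + a) * (x + b) / ((x + c) * (x + e))) ^+ m == 1].

Lemma card_ratio_power_sum : #|[set x | ratio_power x]| = (\sum_(t : F | t ^+ m == 1%R) #|fiber t|)%N.
Proof.
have m0 : (0 < m)%N.
  have p1 : (0 < p.-1)%N by rewrite -subn1 subn_gt0 prime_gt1.
  by case: (m) mk => // e1; move: p1; rewrite -e1.
rewrite -sum1_card.
rewrite (partition_big (fun x => (x + a) * (x + b) / ((x + c) * (x + e))) (fun t => t ^+ m == 1)); last first.
  by move=> x; rewrite inE => /and3P[].
apply: eq_bigr => t /eqP tm; rewrite sum1_card; apply: eq_card => x; rewrite !inE unfold_in /= inE.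
have t0 : t != 0.
  by apply/eqP => t0; move: tm; rewrite t0 expr0n eqn0Ngt m0 => /eqP; rewrite eq_sym oner_eq0.
apply/andP/eqP => [[/and3P[_ d0' _] /eqP <-]|e1]; first by rewrite divfK.
have d0' : (x + c) * (x + e) != 0.
  apply/eqP => z; move: e1; rewrite z mulr0 => /eqP; rewrite mulf_eq0 !addr_eq0.
  move/eqP: z; rewrite mulf_eq0 !addr_eq0 => /orP[]/eqP -> ; rewrite !eqr_opp => /orP[] /eqP E;
   move: ac ae bc be; by rewrite E eqxx.
have ratio : (x + a) * (x + b) / ((x + c) * (x + e)) = t by rewrite e1 mulfK.
by rewrite /ratio_power ratio tm e1 !eqxx d0' mulf_neq0.
Qed.

(** Stepanov's method gives only upper bounds. The number of square roots is therefore bounded above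
    through Euler's value 1 and below through -1, so that upper bounds for both values yield a
    two-sided count. *)
Lemma disc_cases t : (sqrts (disc t) <= (disc t ^+ h == 1%R).*2 + (disc t == 0%R))%N /\
  (2 <= sqrts (disc t) + (disc t ^+ h == -1)%R.*2 + (disc t == 0%R).*2)%N.
Proof.
have [d0'|dn0] := eqVneq (disc t) 0.
  split; last by rewrite leq_addl.
  apply: leq_trans (leq_addl _ _); rewrite /sqrts d0' -[X in (_ <= X)%N](cards1 (0 : F)).
  by apply: subset_leq_card; apply/subsetP => y; rewrite !inE expf_eq0.
have [d1'|dN1] := euler_pm1 p_pr oddp dn0.
  by rewrite sqrts_1 // d1' eqxx.
by rewrite sqrts_N1 // dN1 eqxx.
Qed.

Lemma sum_bool_card (P Q : pred F) : (\sum_(t : F | P t) Q t = #|[set t | P t && Q t]|)%N.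
Proof. by rewrite -sum1dep_card big_mkcondr; apply: eq_bigr => t _; case: (Q t). Qed.

Lemma card_exceptions :
  (#|[set t : F | (t ^+ m == 1%R) && (t == 1%R)]| <= 1)%N /\
  (#|[set t : F | (t ^+ m == 1%R) && (disc t == 0%R)]| <= 2)%N.
Proof.
split.
  rewrite -[X in (_ <= X)%N](cards1 (1%R : F)); apply: subset_leq_card; apply/subsetP => t.
  by rewrite !inE => /andP[].
apply: leq_trans disc_zeros; apply: subset_leq_card; apply/subsetP => t.
by rewrite !inE => /andP[].
Qed.

Lemma card_ratio_power_le : (#|[set x | ratio_power x]| <= m + 7 * u + 6)%N.
Proof.
rewrite card_ratio_power_sum.
have le1 t : (#|fiber t| <= (t == 1%R) + ((disc t ^+ h == 1%R) + (disc t ^+ h == 1%R)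
    + (disc t == 0%R)))%N.
  have [->|t1] := eqVneq t 1; first by apply: leq_trans card_fiber1 _.
  by rewrite card_fiber // addnn; have [] := disc_cases t.
apply: leq_trans (leq_sum _ (fun t _ => le1 t)) _.
rewrite !big_split /= !sum_bool_card.
have [c1 c2] := card_exceptions; have c3 := card_disc (oner_neq0 F); clear -c1 c2 c3.
by move: c1 c2 c3; set x := #|_|; set y := #|_|; set z := #|_|; lia.
Qed.

(** Each of the [m] roots of unity should have two preimages; the defect is at most [m + 7 u] from
    the nonsquare discriminants, 2 from [t = 1], and 4 from the zeros of [disc]. *)
Lemma card_ratio_power_ge : (m <= #|[set x | ratio_power x]| + 7 * u + 6)%N.
Proof.
rewrite card_ratio_power_sum.
have le1 t : (2 <= #|fiber t| + ((t == 1%R) + (t == 1%R) + ((disc t ^+ h == -1)%R + (disc t ^+ h == -1)%R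
    + ((disc t == 0%R) + (disc t == 0%R)))))%N.
  have [->|t1] := eqVneq t 1; first by apply: leq_trans (leq_addl _ _); exact: leq_addr.
  by rewrite card_fiber // !addnn add0n addnA; have [] := disc_cases t.
have := leq_sum (index_enum F) (fun t (_ : t ^+ m == 1) => le1 t).
rewrite sum_nat_const; have -> : #|[pred t : F | t ^+ m == 1]| = m.
  by rewrite -cardsE (card_root_unity p_pr mk).
rewrite !big_split /= !sum_bool_card.
have N10 : (-1 : F) != 0 by rewrite oppr_eq0 oner_neq0.
have [c1 c2] := card_exceptions; have c3 := card_disc N10; clear -c1 c2 c3.
by move: c1 c2 c3; set x := #|_|; set y := #|_|; set z := #|_|; set w := (\sum_(_ | _) _)%N; lia.
Qed.

End QuadCount.

(** * Multiplicative characters and functions majorized by positive combinations of them *)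

(** Lagrange's identity: twice the defect is [sum_(i,j) a_i a_j (y_i - y_j)^2]. *)
Lemma weighted_cauchy (I : finType) (a y : I -> algC) :
  (forall i, 0 <= a i) -> (forall i, 0 <= y i) ->
  (\sum_i a i * y i) ^+ 2 <= (\sum_i a i) * \sum_i a i * y i ^+ 2.
Proof.
move=> a0 y0; rewrite -subr_ge0.
have : 0 <= \sum_i \sum_j a i * a j * (y i - y j) ^+ 2.
  apply: sumr_ge0 => i _; apply: sumr_ge0 => j _; apply: mulr_ge0; first exact: mulr_ge0.
  by rewrite real_exprn_even_ge0 // realB // ger0_real.
have -> : \sum_i \sum_j a i * a j * (y i - y j) ^+ 2 =
    ((\sum_i a i) * (\sum_i a i * y i ^+ 2) - (\sum_i a i * y i) ^+ 2) *+ 2.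
  have e1 : (\sum_i a i) * (\sum_i a i * y i ^+ 2) = \sum_i \sum_j a i * a j * y j ^+ 2.
    rewrite mulr_suml; apply: eq_bigr => i _; rewrite mulr_sumr; apply: eq_bigr => j _; ring.
  have e2 : (\sum_i a i) * (\sum_i a i * y i ^+ 2) = \sum_i \sum_j a i * a j * y i ^+ 2.
    rewrite mulrC mulr_suml; apply: eq_bigr => i _; rewrite mulr_sumr; apply: eq_bigr => j _; ring.
  have e3 : (\sum_i a i * y i) ^+ 2 = \sum_i \sum_j a i * a j * (y i * y j).
    rewrite expr2 mulr_suml; apply: eq_bigr => i _; rewrite mulr_sumr; apply: eq_bigr => j _; ring.
  rewrite mulr2n {1}e1 e2 e3 -!sumrB -big_split; apply: eq_bigr => i _ /=.
  rewrite -!sumrB -big_split; apply: eq_bigr => j _ /=; ring.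
by rewrite pmulrn_lge0.
Qed.

Section Characters.
Variables (p : nat) (p_pr : prime p).
Local Notation F := 'F_p.

Definition mult_char (X : F -> algC) :=
  [/\ X 0 = 0, {morph X : x y / x * y} & forall x, x != 0 -> `|X x| = 1].

Lemma mult_char1 X : mult_char X -> X 1 = 1.
Proof.
case=> _ XM X1; have n1 : `|X 1| = 1 by rewrite X1 ?oner_neq0.
have X10 : X 1 != 0 by rewrite -normr_gt0 n1 ltr01.
by apply: (mulfI X10); rewrite mulr1 -XM mulr1.
Qed.

Lemma mult_charV X y : mult_char X -> y != 0 -> X y^-1 = (X y)^*.
Proof.
move=> hX y0; have [_ XM Xn] := hX.
have Xy0 : X y != 0 by rewrite -normr_gt0 Xn // ltr01.
by apply: (mulfI Xy0); rewrite -XM divff // mult_char1 // -normCK Xn // expr1n.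
Qed.

Definition power_residue (k : nat) (t : F) : bool := t ^+ (p.-1 %/ k) == 1.

(** The character sends [g ^+ i] to [w ^+ i] for a primitive root [g] and a primitive r-th root of
    unity [w]; both conditions on [t] say that [r] divides its discrete logarithm. *)
Lemma exists_char (r : nat) : (r %| p.-1)%N ->
  exists2 X, mult_char X & forall t, t != 0 -> X t ^+ r = 1 /\ (X t == 1) = power_residue r t.
Proof.
move=> rp; have p1 : (0 < p.-1)%N by rewrite -subn1 subn_gt0 prime_gt1.
have r0 : (0 < r)%N := dvdn_gt0 p1 rp.
have [g hg] := Fp_prim_root p_pr; have [w hw] := C_prim_root_exists r0.
(* Discrete logarithm to base [g]; the default 0 is reached only at [t = 0]. *)
pose dl (t : F) : nat := if [pick i : 'I_p.-1 | t == g ^+ i] is Some i then nat_of_ord i else 0%N.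
have dlE t : t != 0 -> t = g ^+ dl t.
  move=> t0; rewrite /dl; case: pickP => [i /eqP //|no].
  have [i ti] := prim_rootP hg (fermat_Fp p_pr t0).
  by have := no i; rewrite {1}ti eqxx.
have g0 : g != 0.
  apply/eqP => g0; have := prim_expr_order hg; rewrite g0 expr0n eqn0Ngt p1 => /eqP.
  by rewrite eq_sym oner_eq0.
have wE i j : (g ^+ i == g ^+ j) -> w ^+ i = w ^+ j.
  rewrite (eq_prim_root_expr hg) => /eqP e; apply/eqP; rewrite (eq_prim_root_expr hw).
  by rewrite -(modn_dvdm i rp) -(modn_dvdm j rp) e.
pose X (t : F) := if t == 0 then 0 else w ^+ dl t.
have w1 : `|w| = 1.
  have : `|w| ^+ r = 1 by rewrite -normrX prim_expr_order // normr1.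
  by move/eqP; rewrite pexpr_eq1 ?normr_ge0 ?r0 // => /eqP.
exists X.
  split; first by rewrite /X eqxx.
    move=> x y; rewrite /X mulf_eq0; case: eqVneq => [|x0]; first by rewrite mul0r.
    case: eqVneq => [|y0] /=; first by rewrite mulr0.
    rewrite -exprD; apply: wE; rewrite exprD -!dlE ?mulf_neq0 //.
  by move=> x x0; rewrite /X (negPf x0) normrX w1 expr1n.
move=> t t0; rewrite /X (negPf t0) -exprM mulnC exprM (prim_expr_order hw) expr1n; split=> //.
rewrite /power_residue {2}(dlE _ t0) -exprM -(prim_order_dvd hw) -(prim_order_dvd hg).
rewrite -{1}(divnK rp) [(dl t * _)%N]mulnC dvdn_pmul2l ?divn_gt0 //.
exact: dvdn_leq.
Qed.

Lemma sum_char_powers (r : nat) (z : algC) : (0 < r)%N -> z ^+ r = 1 ->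
  \sum_(i < r.-1) z ^+ i.+1 = (if z == 1 then r%:R else 0) - 1.
Proof.
case: r => // r _ zr /=; have -> : \sum_(i < r) z ^+ i.+1 = \sum_(i < r.+1) z ^+ i - 1.
  by rewrite big_ord_recl expr0 addrC addKr.
congr (_ - 1); case: eqVneq => [->|z1].
  by under eq_bigr => i _ do rewrite expr1n; rewrite sumr_const card_ord.
have z10 : z - 1 != 0 by rewrite subr_eq0.
by apply: (mulfI z10); rewrite -subrX1 zr subrr mulr0.
Qed.

End Characters.

Section Majorants.
Variables (p : nat) (p_pr : prime p).
Local Notation F := 'F_p.
Local Notation QtoC := (ratr : rat -> algC).

(* [f = c1 + sum_i c_i chi_i] and [C = c1 + sum_i |c_i| chi_i] away from 0. *)
Definition majorized (c1 : rat) (f C : F -> rat) :=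
  0 <= c1 /\ exists (I : finType) (c : I -> rat) (X : I -> F -> algC),
    [/\ forall i, mult_char (X i),
        forall t, t != 0 -> QtoC (f t) = QtoC c1 + \sum_i QtoC (c i) * X i t &
        forall t, t != 0 -> QtoC (C t) = QtoC c1 + \sum_i QtoC `|c i| * X i t].

Lemma majorized_const (c : rat) : 0 <= c -> majorized c (fun=> c) (fun=> c).
Proof.
move=> c0; split=> //; exists void, (fun=> 0), (fun _ _ => 0).
by split=> [[]|t _|t _]; rewrite big_pred0 ?addr0 // => -[].
Qed.

Lemma majorized_add c1 f C c1' f' C' : majorized c1 f C -> majorized c1' f' C' ->
  majorized (c1 + c1') (fun t => f t + f' t) (fun t => C t + C' t).
Proof.
case=> c10 [I [c [X [hX hf hC]]]] [c10' [I' [c' [X' [hX' hf' hC']]]]].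
split; first exact: addr_ge0.
exists (I + I')%type, (fun s => match s with inl i => c i | inr i => c' i end),
  (fun s => match s with inl i => X i | inr i => X' i end).
split=> [[]//|t t0|t t0]; rewrite big_sumType /= !rmorphD /= ?hf ?hf' ?hC ?hC' //; ring.
Qed.

Lemma mult_charM (X Y : F -> algC) : mult_char X -> mult_char Y -> mult_char (fun t => X t * Y t).
Proof.
case=> X0 XM X1 [Y0 YM Y1]; split=> [|x y|x x0]; first by rewrite X0 mul0r.
  by rewrite XM YM; ring.
by rewrite normrM X1 ?Y1 ?mulr1.
Qed.

(** Multiply out; absolute values are multiplicative and [c1], [c1'] are nonnegative, so the same
    products of characters serve [f] and [C]. The resulting family may repeat characters or contain
    the principal one: the lower bounds for moments use only the triangle inequality, and the mean
    of [C] is controlled separately. *)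
Lemma majorized_mul c1 f C c1' f' C' : majorized c1 f C -> majorized c1' f' C' ->
  majorized (c1 * c1') (fun t => f t * f' t) (fun t => C t * C' t).
Proof.
case=> c10 [I [c [X [hX hf hC]]]] [c10' [I' [c' [X' [hX' hf' hC']]]]].
split; first exact: mulr_ge0.
exists (I + I' + (I * I'))%type,
  (fun s => match s with inl (inl i) => c1' * c i | inl (inr i) => c1 * c' i
            | inr q => c q.1 * c' q.2 end),
  (fun s => match s with inl (inl i) => X i | inl (inr i) => X' i
            | inr q => (fun t => X q.1 t * X' q.2 t) end).
split=> [[[i|i]|q]|t t0|t t0] //; first exact: mult_charM.
  rewrite !big_sumType /= !rmorphM /= hf // hf' //.
  under [X in _ = _ + (X + _ + _)]eq_bigr => i _ do rewrite rmorphM /= -mulrA.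
  under [X in _ = _ + (_ + X + _)]eq_bigr => i _ do rewrite rmorphM /= -mulrA.
  have -> : \sum_q QtoC (c q.1 * c' q.2) * (X q.1 t * X' q.2 t) =
      (\sum_i QtoC (c i) * X i t) * (\sum_i QtoC (c' i) * X' i t).
    rewrite mulr_suml (eq_bigr (fun i => \sum_j QtoC (c i * c' j) * (X i t * X' j t))).
      by rewrite pair_bigA.
    by move=> i _; rewrite mulr_sumr; apply: eq_bigr => j _; rewrite rmorphM /=; ring.
  by rewrite -!mulr_sumr; ring.
rewrite !big_sumType /= !rmorphM /= hC // hC' //.
under [X in _ = _ + (X + _ + _)]eq_bigr => i _ do rewrite normrM (ger0_norm c10') rmorphM /= -mulrA.
under [X in _ = _ + (_ + X + _)]eq_bigr => i _ do rewrite normrM (ger0_norm c10) rmorphM /= -mulrA.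
have -> : \sum_q QtoC `|c q.1 * c' q.2| * (X q.1 t * X' q.2 t) =
    (\sum_i QtoC `|c i| * X i t) * (\sum_i QtoC `|c' i| * X' i t).
  rewrite mulr_suml (eq_bigr (fun i => \sum_j QtoC `|c i * c' j| * (X i t * X' j t))).
    by rewrite pair_bigA.
  by move=> i _; rewrite mulr_sumr; apply: eq_bigr => j _; rewrite normrM rmorphM /=; ring.
by rewrite -!mulr_sumr; ring.
Qed.

Lemma mult_charX (X : F -> algC) n : mult_char X -> mult_char (fun t => X t ^+ n.+1).
Proof.
case=> X0 XM X1; split=> [|x y|x x0]; first by rewrite X0 expr0n.
  by rewrite XM exprMn.
by rewrite normrX X1 // expr1n.
Qed.

(** [r] times the indicator of r-th powers, minus 1, is the sum of the nontrivial powers of a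
    character of order [r]. All coefficients of [f] are [- a], so taking absolute values merely
    flips the sign. *)
Lemma majorized_power_residue (r : nat) (a : rat) : (r %| p.-1)%N -> 0 <= a ->
  majorized 0 (fun t => a * (1 - r%:R * (power_residue r t)%:R))
              (fun t => a * (r%:R * (power_residue r t)%:R - 1)).
Proof.
move=> rp a0; split=> //; have [X hX Xr] := exists_char p_pr rp.
have r0 : (0 < r)%N by apply: dvdn_gt0 rp; rewrite -subn1 subn_gt0 prime_gt1.
exists 'I_r.-1, (fun=> - a), (fun (i : 'I_r.-1) t => X t ^+ i.+1).
have sumX t : t != 0 -> \sum_(i < r.-1) X t ^+ i.+1 = QtoC (r%:R * (power_residue r t)%:R - 1).
  move=> t0; have [Xt Xt1] := Xr _ t0; rewrite sum_char_powers // Xt1.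
  by rewrite rmorphB rmorphM rmorph1 !rmorph_nat; case: power_residue; rewrite ?mulr1 ?mulr0.
split=> [i|t t0|t t0]; first exact: mult_charX.
  by rewrite rmorph0 add0r -mulr_sumr sumX // -[RHS]rmorphM; apply: (congr1 QtoC); ring.
by rewrite rmorph0 add0r -mulr_sumr sumX // -[RHS]rmorphM; apply: (congr1 QtoC); rewrite normrN ger0_norm.
Qed.

End Majorants.

(** * Second and fourth moments of the window sums, bounded below *)

Section Moments.
Variables (p : nat) (p_pr : prime p).
Local Notation F := 'F_p.
Local Notation QtoC := (ratr : rat -> algC).
Variables (c1 : rat) (f C : F -> rat).

(** This is [sum_i |c_i| chi_i(y) conj(chi_i(z))] with the characters eliminated, hence rational;
    the value 0 reflects [chi_i(0) = 0]. *)
Definition kernel (y z : F) : rat := if (y != 0) && (z != 0) then C (y / z) - c1 else 0.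

Lemma gram (J : finType) (y : J -> F) (I : finType) (c : I -> rat) (X : I -> F -> algC) :
  (forall i, mult_char (X i)) ->
  (forall t, t != 0 -> QtoC (C t) = QtoC c1 + \sum_i QtoC `|c i| * X i t) ->
  \sum_i QtoC `|c i| * `|\sum_j X i (y j)| ^+ 2 = QtoC (\sum_j \sum_k kernel (y j) (y k)).
Proof.
move=> hX hC; rewrite rmorph_sum /=.
have e1 i : QtoC `|c i| * `|\sum_j X i (y j)| ^+ 2 =
    \sum_j \sum_k QtoC `|c i| * (X i (y j) * (X i (y k))^*).
  rewrite normCK rmorph_sum /= mulr_suml mulr_sumr; apply: eq_bigr => j _.
  by rewrite !mulr_sumr.
rewrite (eq_bigr _ (fun i _ => e1 i)) exchange_big /=; apply: eq_bigr => j _.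
rewrite exchange_big /= rmorph_sum /=; apply: eq_bigr => k _.
rewrite /kernel; have [yj0|yj0] /= := eqVneq (y j) 0.
  by rewrite rmorph0 big1 // => i _; have [X0 _ _] := hX i; rewrite yj0 X0 mul0r mulr0.
have [yk0|yk0] /= := eqVneq (y k) 0.
  by rewrite rmorph0 big1 // => i _; have [X0 _ _] := hX i; rewrite yk0 X0 conjC0 !mulr0.
rewrite rmorphB /= hC ?mulf_neq0 ?invr_eq0 // addrAC subrr add0r; apply: eq_bigr => i _.
by have [_ XM _] := hX i; rewrite XM (mult_charV (hX i)).
Qed.

Variable h : nat.

(* By [gram], [moment2 x = sum_i |c_i| |S_i(x)|^2] and [moment4 x = sum_i |c_i| |S_i(x)|^4]
   where [S_i(x) = sum_(b < h) chi_i (x + b)]. *)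
Definition moment2 (x : F) : rat :=
  \sum_(b < h) \sum_(b' < h) kernel (x + b%:R) (x + b'%:R).

Definition moment4 (x : F) : rat :=
  \sum_(q : 'I_h * 'I_h) \sum_(q' : 'I_h * 'I_h)
    kernel ((x + q.1%:R) * (x + q.2%:R)) ((x + q'.1%:R) * (x + q'.2%:R)).

(** Summing [f] over the window gives [c1 h <= sum_i |c_i| |S_i|], the multiplier [a] disappearing
    since [|chi_i(a)| = 1]. Cauchy-Schwarz with weights [|c_i|], of total [C 1 - c1], is then
    applied once for the square and once more for the fourth power. *)
Lemma moment_lower_bounds : majorized c1 f C -> forall x,
  [/\ 0 <= moment2 x, 0 <= moment4 x &
  forall a, a != 0 -> (forall b : 'I_h, x + b%:R != 0 /\ f (a * (x + b%:R)) <= 0) ->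
  (c1 * h%:R) ^+ 2 <= (C 1 - c1) * moment2 x /\
  (c1 * h%:R) ^+ 4 <= (C 1 - c1) ^+ 3 * moment4 x].
Proof.
case=> c10 [I [c [X [hX hf hC]]]] x.
pose S i := \sum_(b < h) X i (x + b%:R).
have m2E : QtoC (moment2 x) = \sum_i QtoC `|c i| * `|S i| ^+ 2.
  by rewrite (gram (fun b : 'I_h => x + b%:R) hX hC).
have m4E : QtoC (moment4 x) = \sum_i QtoC `|c i| * (`|S i| ^+ 2) ^+ 2.
  rewrite -(gram (fun q : 'I_h * 'I_h => (x + q.1%:R) * (x + q.2%:R)) hX hC).
  apply: eq_bigr => i _; congr (_ * _ ^+ 2); rewrite -normrX expr2 /S mulr_suml.
  have [_ XM _] := hX i; congr `|_|.
  rewrite [RHS](eq_bigr (fun b : 'I_h => \sum_(b' < h) X i ((x + b%:R) * (x + b'%:R)))).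
    by rewrite pair_bigA.
  by move=> b _; rewrite mulr_sumr; apply: eq_bigr => b' _; rewrite XM.
have A0E : QtoC (C 1 - c1) = \sum_i QtoC `|c i|.
  rewrite rmorphB /= hC ?oner_neq0 // addrAC subrr add0r; apply: eq_bigr => i _.
  by rewrite (mult_char1 (hX i)) mulr1.
have cge0 i : 0 <= QtoC `|c i| by rewrite ler0q normr_ge0.
have m2ge0 : 0 <= moment2 x.
  by rewrite -(ler0q algC) m2E; apply: sumr_ge0 => i _; rewrite mulr_ge0 // exprn_ge0.
have m4ge0 : 0 <= moment4 x.
  by rewrite -(ler0q algC) m4E; apply: sumr_ge0 => i _; rewrite mulr_ge0 // !exprn_ge0.
split=> // a a0 neg.
have A0ge0 : 0 <= C 1 - c1 by rewrite -(ler0q algC) A0E; apply: sumr_ge0.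
have key : QtoC (c1 * h%:R) <= \sum_i QtoC `|c i| * `|S i|.
  have sumf : \sum_(b < h) QtoC (f (a * (x + b%:R))) =
      QtoC (c1 * h%:R) + \sum_i QtoC (c i) * (X i a * S i).
    rewrite (eq_bigr (fun b : 'I_h => QtoC c1 + \sum_i QtoC (c i) * (X i a * X i (x + b%:R)))).
      rewrite big_split /= sumr_const card_ord rmorphM /= ratr_nat mulr_natr; congr (_ + _).
      rewrite exchange_big /=; apply: eq_bigr => i _; rewrite -mulr_sumr; congr (_ * _).
      by rewrite -mulr_sumr.
    move=> b _; have [xb _] := neg b; rewrite hf ?mulf_neq0 //; congr (_ + _).
    by apply: eq_bigr => i _; have [_ XM _] := hX i; rewrite XM.
  have s0 : \sum_(b < h) QtoC (f (a * (x + b%:R))) <= 0.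
    by apply: sumr_le0 => b _; have [_] := neg b; rewrite -(lerq0 algC).
  move: s0; rewrite sumf addrC -lerBrDr sub0r => le.
  have : QtoC (c1 * h%:R) <= - \sum_i QtoC (c i) * (X i a * S i).
    by rewrite lerNr.
  have c1h0 : 0 <= QtoC (c1 * h%:R) by rewrite ler0q mulr_ge0.
  move=> le2; apply: le_trans le2 _; rewrite -[X in X <= _]ger0_norm; last first.
    by apply: le_trans c1h0 _; rewrite lerNr.
  rewrite normrN; apply: le_trans (ler_norm_sum _ _ _) _; apply: ler_sum => i _.
  by have [_ _ X1] := hX i; rewrite normrM -ratr_norm normrM X1 // mul1r.
have n1 : 0 <= c1 * h%:R by rewrite mulr_ge0.
have k2 : (c1 * h%:R) ^+ 2 <= (C 1 - c1) * moment2 x.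
  rewrite -(ler_rat algC) [X in X <= _]rmorphXn [X in _ <= X]rmorphM /= A0E m2E.
  apply: le_trans (weighted_cauchy cge0 (fun i => normr_ge0 (S i))).
  by rewrite lerXn2r // ?nnegrE ?ler0q // sumr_ge0 // => i _; rewrite mulr_ge0.
have k4 : moment2 x ^+ 2 <= (C 1 - c1) * moment4 x.
  rewrite -(ler_rat algC) [X in X <= _]rmorphXn [X in _ <= X]rmorphM /= A0E m2E m4E.
  by apply: weighted_cauchy => // i; rewrite exprn_ge0.
split=> //; rewrite (_ : 4%N = (2 * 2)%N) // exprM.
apply: (@le_trans _ _ (((C 1 - c1) * moment2 x) ^+ 2)).
  by rewrite lerXn2r // ?nnegrE ?exprn_ge0 // mulr_ge0.
by rewrite exprMn [_ ^+ 3]exprSr -mulrA ler_wpM2l ?exprn_ge0.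
Qed.

End Moments.

(** * Combinations of indicators of power residues *)

Section Expansions.
Variables (p : nat) (p_pr : prime p).
Local Notation F := 'F_p.

Lemma p1_gt0 : (0 < p.-1)%N.
Proof. by rewrite -subn1 subn_gt0 prime_gt1. Qed.

Lemma power_residueM (k l : nat) (t : F) : coprime k l -> (k * l %| p.-1)%N ->
  power_residue (k * l) t = power_residue k t && power_residue l t.
Proof.
move=> cop klp; have kl0 : (0 < k * l)%N := dvdn_gt0 p1_gt0 klp.
have [k0 l0] : (0 < k)%N /\ (0 < l)%N by move: kl0; rewrite muln_gt0 => /andP.
case/dvdnP: klp => N pN; rewrite /power_residue.
have -> : (p.-1 %/ (k * l) = N)%N by rewrite pN mulnK.
have -> : (p.-1 %/ k = N * l)%N by rewrite pN mulnCA [(k * _)%N]mulnC mulnK.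
have -> : (p.-1 %/ l = N * k)%N by rewrite pN mulnA mulnK.
apply/eqP/andP => [tN|[/eqP tl /eqP tk]]; first by rewrite !exprM tN !expr1n.
case: (egcdnP l k0) => u v uv _; move: cop uv; rewrite /coprime => /eqP -> uv.
have : (t ^+ (N * k)) ^+ u = 1 by rewrite tk expr1n.
by rewrite -exprM -mulnA [(k * u)%N]mulnC uv mulnDr muln1 exprD mulnCA mulnC exprM tl expr1n mul1r.
Qed.

Lemma sum_power_residue k : (k %| p.-1)%N ->
  \sum_(t : F | t != 0) (power_residue k t)%:R = p.-1%:R / k%:R :> rat.
Proof.
move=> kp; have k0 : (0 < k)%N := dvdn_gt0 p1_gt0 kp.
have mk : (p.-1 %/ k * k)%N = p.-1 by rewrite divnK.
have -> : p.-1%:R / k%:R = (p.-1 %/ k)%:R :> rat.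
  by rewrite -{1}mk natrM mulfK // pnatr_eq0 -lt0n.
rewrite -natr_sum -[in RHS](card_root_unity p_pr mk); congr (_%:R).
rewrite -sum1dep_card [RHS]big_mkcond /= [LHS]big_mkcond /=.
apply: eq_bigr => t _; rewrite /power_residue; case: eqVneq => [->|_] /=; last by case: eqP.
by rewrite expr0n eqn0Ngt divn_gt0 // dvdn_leq ?p1_gt0 //= eq_sym oner_eq0.
Qed.

(* [C] is a combination, of mean [c1] and l1-norm at most [L], of indicators of
   [k]-th power residues with [k %| D]. *)
Definition residue_expansion (D : nat) (c1 L : rat) (C : F -> rat) :=
  exists A : seq (rat * nat),
    [/\ all (fun e => e.2 %| D)%N A, \sum_(e <- A) e.1 / e.2%:R = c1,
        \sum_(e <- A) `|e.1| <= L &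
        forall t, t != 0 -> C t = \sum_(e <- A) e.1 * (power_residue e.2 t)%:R].

Lemma residue_expansion_const D c : residue_expansion D c `|c| (fun=> c).
Proof.
exists [:: (c, 1%N)]; split=> [|||t t0]; rewrite /= ?dvd1n // big_seq1 ?divr1 //=.
by rewrite /power_residue divn1 fermat_Fp // eqxx mulr1.
Qed.

Lemma residue_expansion_residue r a : residue_expansion r (a / r%:R) `|a|
  (fun t => a * (power_residue r t)%:R).
Proof.
by exists [:: (a, r)]; split=> [|||t t0]; rewrite /= ?dvdnn // big_seq1.
Qed.

Lemma residue_expansion_add D c1 L C c1' L' C' : residue_expansion D c1 L C ->
  residue_expansion D c1' L' C' ->
  residue_expansion D (c1 + c1') (L + L') (fun t => C t + C' t).
Proof.
case=> A [hA cA lA eA] [A' [hA' cA' lA' eA']]; exists (A ++ A'); split=> [|||t t0].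
- by rewrite all_cat hA.
- by rewrite big_cat /= cA cA'.
- by rewrite big_cat /= lerD.
by rewrite big_cat /= eA // eA'.
Qed.

Lemma residue_expansion_dvd D D' c1 L C : (D %| D')%N ->
  residue_expansion D c1 L C -> residue_expansion D' c1 L C.
Proof.
move=> DD' [A [hA cA lA eA]]; exists A; split=> //.
by apply: sub_all hA => e /= h; apply: dvdn_trans h DD'.
Qed.

Lemma residue_expansion_le D c1 L L' C : L <= L' ->
  residue_expansion D c1 L C -> residue_expansion D c1 L' C.
Proof. by move=> LL' [A [hA cA lA eA]]; exists A; split=> //; apply: le_trans LL'. Qed.

Lemma residue_expansion_eq D c1 L C C' : (forall t, t != 0 -> C t = C' t) ->
  residue_expansion D c1 L C -> residue_expansion D c1 L C'.
Proof. by move=> CC' [A [hA cA lA eA]]; exists A; split=> // t t0; rewrite -CC' // eA. Qed.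

(** For coprime [k], [l] the product of the indicators of k-th and l-th powers is that of kl-th
    powers, so means and l1-norms multiply. *)
Lemma residue_expansion_mul D c1 L C D' c1' L' C' : coprime D D' -> (D * D' %| p.-1)%N ->
  residue_expansion D c1 L C -> residue_expansion D' c1' L' C' ->
  residue_expansion (D * D') (c1 * c1') (L * L') (fun t => C t * C' t).
Proof.
move=> cop DDp [A [hA cA lA eA]] [A' [hA' cA' lA' eA']].
exists [seq (e.1 * e'.1, (e.2 * e'.2)%N) | e <- A, e' <- A']; split=> [|||t t0].
- apply/allP => _ /allpairsP[[e e'] /= [eA0 eA1 ->]] /=.
  by apply: dvdn_mul; [apply: (allP hA) | apply: (allP hA')].
- rewrite big_allpairs_dep /= -cA -cA' mulr_suml; apply: eq_bigr => e _.
  by rewrite mulr_sumr; apply: eq_bigr => e' _; rewrite natrM invfM; ring.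
- rewrite big_allpairs_dep /=.
  have -> : \sum_(e <- A) \sum_(e' <- A') `|e.1 * e'.1| =
      (\sum_(e <- A) `|e.1|) * \sum_(e' <- A') `|e'.1|.
    rewrite mulr_suml; apply: eq_bigr => e _; rewrite mulr_sumr.
    by apply: eq_bigr => e' _; rewrite normrM.
  by rewrite ler_pM // sumr_ge0.
rewrite big_allpairs_dep /= eA // eA' // mulr_suml big_seq [RHS]big_seq.
apply: eq_bigr => e inA; rewrite mulr_sumr big_seq [RHS]big_seq.
apply: eq_bigr => e' inA'.
have d1 : (e.2 %| D)%N by apply: (allP hA).
have d2 : (e'.2 %| D')%N by apply: (allP hA').
rewrite power_residueM; first by case: power_residue; case: power_residue; rewrite ?mulr0 ?mul0r ?mulr1.
  exact: coprime_dvdl d1 (coprime_dvdr d2 cop).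
by apply: dvdn_trans DDp; apply: dvdn_mul.
Qed.

(** The k-th powers have density [1 / k], so [c1] is the true mean of [C] on nonzero residues. *)
Lemma sum_residue_expansion D c1 L C : (D %| p.-1)%N -> residue_expansion D c1 L C ->
  \sum_(t : F | t != 0) (C t - c1) = 0.
Proof.
move=> Dp [A [hA cA lA eA]]; rewrite sumrB (eq_bigr _ eA) exchange_big /= sumr_const.
have -> : #|[pred t : F | t != 0]| = p.-1 by rewrite -[p in RHS](card_Fp p_pr) (cardC1 (0 : F)).
rewrite -mulr_natl -cA mulr_sumr; apply/eqP; rewrite subr_eq0; apply/eqP.
rewrite big_seq [RHS]big_seq; apply: eq_bigr => e inA.
by rewrite -mulr_sumr sum_power_residue ?(dvdn_trans _ Dp) ?(allP hA) //; ring.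
Qed.

End Expansions.

(** * The moments summed over all residues, bounded above *)

Section Totals.
Variables (p : nat) (p_pr : prime p) (oddp : odd p).
Local Notation F := 'F_p.
Local Notation QtoC := (ratr : rat -> algC).
Variables (c1 L : rat) (f C : F -> rat) (h u : nat).
Hypotheses (hmaj : majorized c1 f C) (hp : (h <= p)%N).
Hypotheses (u100 : (100 <= u)%N) (pu : (p <= u * u)%N).
Hypothesis sumC : \sum_(t : F | t != 0) (C t - c1) = 0.
Hypothesis expC : exists A : seq (rat * nat),
  [/\ all (fun e => (e.2 %| p.-1) && ~~ odd e.2)%N A, \sum_(e <- A) e.1 / e.2%:R = c1,
      \sum_(e <- A) `|e.1| <= L &
      forall t, t != 0 -> C t = \sum_(e <- A) e.1 * (power_residue e.2 t)%:R].

Let A0 := C 1 - c1.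
Local Notation ker := (kernel c1 C).

(** The coefficients of [C] are nonnegative and every character equals 1 at 1, where the sum is
    therefore largest. *)
Lemma majorized_abs t : t != 0 -> `|C t - c1| <= A0.
Proof.
move=> t0; case: hmaj => _ [I [c [X [hX _ hC]]]].
have E s : s != 0 -> QtoC (C s - c1) = \sum_i QtoC `|c i| * X i s.
  by move=> s0; rewrite rmorphB /= hC // addrAC subrr add0r.
rewrite -(ler_rat algC) /A0 E ?oner_neq0 // ratr_norm E //.
apply: le_trans (ler_norm_sum _ _ _) _; apply: ler_sum => i _.
have [_ _ X1] := hX i.
by rewrite normrM X1 // mulr1 (mult_char1 (hX i)) mulr1 ger0_norm // ler0q normr_ge0.
Qed.

Lemma A0_ge0 : 0 <= A0.
Proof. exact: le_trans (normr_ge0 _) (majorized_abs (oner_neq0 _)). Qed.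

Lemma ker_abs y z : `|ker y z| <= A0.
Proof.
rewrite /kernel; case: ifP => [/andP[y0 z0]|_]; last by rewrite normr0 A0_ge0.
by apply: majorized_abs; rewrite mulf_neq0 // invr_eq0.
Qed.

Lemma ker_le y z : ker y z <= A0.
Proof. exact: le_trans (ler_norm _) (ker_abs y z). Qed.

Lemma sum_ker_le (T : finType) (y z : T -> F) : \sum_x ker (y x) (z x) <= #|T|%:R * A0.
Proof.
apply: le_trans (ler_sum _ (fun x _ => ker_le (y x) (z x))) _.
by rewrite sumr_const mulr_natl.
Qed.

(** Away from [- a] and [- b], the map [x |-> (x + a) / (x + b)] runs once through all values except
    0 and 1. Over all nonzero values the sum is 0, and the missing value 1 contributes [A0]. *)
Lemma sum_ker_shift (a b : F) : a != b -> \sum_x ker (x + a) (x + b) = - A0.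
Proof.
move=> ab; have d0 : a - b != 0 by rewrite subr_eq0.
have sumC1 : \sum_(t : F | (t != 0) && (t != 1)) (C t - c1) = - A0.
  by have := sumC; rewrite (bigD1 (1 : F)) ?oner_neq0 //= => /eqP; rewrite addrC addr_eq0 => /eqP.
rewrite -sumC1 (reindex_onto (fun y => y - b) (fun y => y + b)) /=; last by move=> y _; rewrite addrK.
rewrite (eq_bigl xpredT); last by move=> y; rewrite subrK eqxx.
rewrite (bigID (fun y => (y != 0) && (y - b + a != 0))) /= [X in _ + X]big1 ?addr0; last first.
  by move=> y; rewrite negb_and !negbK subrK /kernel => /orP[] /eqP ->; rewrite eqxx ?andbF.
rewrite [RHS](reindex_onto (fun y => 1 + (a - b) / y) (fun t => (a - b) / (t - 1))) /=; last first.
  move=> t /andP[t0 t1]; rewrite invf_div mulrCA divff // mulr1 addrC subrK //.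
apply: eq_big => [y|y /andP[y0 y1]].
  have [->|y0] /= := eqVneq y 0.
    by rewrite invr0 mulr0 addr0 eqxx andbF.
  have s1 : 1 + (a - b) / y - 1 = (a - b) / y by ring.
  have s2 : (1 + (a - b) / y == 1) = false.
    by rewrite -subr_eq0 s1 mulf_eq0 invr_eq0 (negPf y0) (negPf d0).
  have s3 : y - b + a = (1 + (a - b) / y) * y by rewrite mulrDl divfK // mul1r; ring.
  by rewrite s1 s2 invf_div mulrCA divff // mulr1 eqxx !andbT s3 mulf_eq0 (negPf y0) orbF.
rewrite /kernel subrK y0 y1 /=; congr (C _ - _).
have -> : y - b + a = y + (a - b) by ring.
by rewrite mulrDl divff.
Qed.

Lemma natF_eq (i j : nat) : (i < p)%N -> (j < p)%N -> (i%:R == j%:R :> F) = (i == j).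
Proof.
move=> ip jp; apply/eqP/eqP => [e|->//].
by have := congr1 (fun x : F => nat_of_ord x) e; rewrite !val_Fp_nat // !modn_small.
Qed.

(** Only the diagonal matters, every off-diagonal pair summing to [- A0]. *)
Lemma sum_moment2 : \sum_x moment2 c1 C h x <= h%:R * p%:R * A0.
Proof.
rewrite /moment2 exchange_big /=.
have -> : h%:R * p%:R * A0 = \sum_(b < h) p%:R * A0.
  by rewrite sumr_const card_ord -[RHS]mulr_natl mulrA.
apply: ler_sum => b _; rewrite exchange_big /= (bigD1 b) //=.
rewrite -[X in _ <= X]addr0; apply: lerD.
  by have := @sum_ker_le F (fun x => x + b%:R) (fun x => x + b%:R); rewrite card_Fp.
apply: sumr_le0 => b' b'b; rewrite sum_ker_shift ?oppr_le0 ?A0_ge0 //.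
by rewrite natF_eq ?(leq_trans (ltn_ord _) hp) // eq_sym.
Qed.

(** The common factor cancels except at [x = - a], and the loss there, at most [A0], is paid by the
    total [- A0] of [sum_ker_shift]. *)
Lemma sum_ker_cancel (a b c : F) : b != c ->
  \sum_x ker ((x + a) * (x + b)) ((x + a) * (x + c)) <= 0.
Proof.
move=> bc.
have E x : ker ((x + a) * (x + b)) ((x + a) * (x + c)) =
   ker (x + b) (x + c) - (x == - a)%:R * ker (x + b) (x + c).
  have [->|xa] := eqVneq x (- a); first by rewrite addNr !mul0r mul1r subrr /kernel eqxx.
  have xa0 : x + a != 0 by rewrite addr_eq0.
  rewrite mul0r subr0 /kernel !mulf_eq0 (negPf xa0) /=.
  by case: ifP => // _; congr (C _ - _); rewrite invfM mulrACA divff // mul1r.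
rewrite (eq_bigr _ (fun x _ => E x)) sumrB sum_ker_shift // (bigD1 (- a)) //= eqxx mul1r.
rewrite big1 ?addr0; last by move=> x /negPf ->; rewrite mul0r.
rewrite -opprD oppr_le0 addrC -lerBlDr sub0r.
by have := ker_abs (- a + b) (- a + c); rewrite ler_norml => /andP[].
Qed.

Lemma card_generic_nonzero (a b c e : F) :
  (p <= #|[set x : F | ((x + a) * (x + b) != 0)%R && ((x + c) * (x + e) != 0)%R]| + 4)%N.
Proof.
set S := [set x | _]; have : (#|~: S| <= 4)%N.
  apply: leq_trans (card_size [:: - a; - b; - c; - e]).
    apply: subset_leq_card; apply/subsetP => x; rewrite !inE negb_and !negbK !mulf_eq0 !addr_eq0.
    by case/orP => /orP[] ->; rewrite ?orbT.
have := cardsC S; rewrite card_Fp //.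
by move: #|S| #|~: S| => s s' E le4; lia.
Qed.

(** Each indicator contributes its coefficient times [(p - 1) / k] with error [7 u + 6]. The main
    terms add up to [(p - 1) c1], against which [c1] is subtracted at no fewer than [p - 4] points:
    hence [3 c1]. *)
Lemma sum_ker_generic (a b c e : F) :
  a != c -> a != e -> b != c -> b != e -> ~~ ((a == b) && (c == e)) ->
  \sum_x ker ((x + a) * (x + b)) ((x + c) * (x + e)) <= 3%:R * c1 + L * (7 * u + 6)%:R.
Proof.
move=> ac ae bc be abce; have [A [hA cA lA eA]] := expC.
pose nz x := ((x + a) * (x + b) != 0) && ((x + c) * (x + e) != 0).
pose R x := (x + a) * (x + b) / ((x + c) * (x + e)).
have -> : \sum_x ker ((x + a) * (x + b)) ((x + c) * (x + e)) =
   \sum_(e' <- A) e'.1 * #|[set x | nz x && power_residue e'.2 (R x)]|%:R - c1 * #|[set x | nz x]|%:R.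
  rewrite (bigID nz) /= [X in _ + X]big1 ?addr0; last by move=> x /negPf nx; rewrite /kernel -/(nz x) nx.
  rewrite (eq_bigr (fun x => \sum_(e' <- A) e'.1 * (power_residue e'.2 (R x))%:R - c1)); last first.
    move=> x nx; rewrite /kernel -/(nz x) nx -eA //.
    by case/andP: nx => n1 n2; rewrite mulf_neq0 ?invr_eq0.
  rewrite sumrB exchange_big /= sumr_const; congr (_ - _); last first.
    by rewrite -cardsE mulr_natr.
  apply: eq_bigr => e' _; rewrite -mulr_sumr; congr (_ * _).
  by rewrite -natr_sum (sum_bool_card nz (fun x => power_residue e'.2 (R x))).
have bound e' : e' \in A -> e'.1 * #|[set x | nz x && power_residue e'.2 (R x)]|%:R <=
    p.-1%:R * (e'.1 / e'.2%:R) + `|e'.1| * (7 * u + 6)%:R.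
  move=> inA; have /andP[kp ek] := allP hA _ inA.
  have mk : (p.-1 %/ e'.2 * e'.2)%N = p.-1 by rewrite divnK.
  have k0 : (e'.2 != 0)%N by rewrite -lt0n; apply: dvdn_gt0 kp; exact: p1_gt0.
  have -> : p.-1%:R * (e'.1 / e'.2%:R) = e'.1 * (p.-1 %/ e'.2)%:R :> rat.
    by rewrite -{1}mk natrM; field; rewrite pnatr_eq0.
  rewrite -lerBlDl -mulrBr; apply: le_trans (ler_norm _) _; rewrite normrM ler_wpM2l //.
  have gE : [set x | nz x && power_residue e'.2 (R x)] = [set x | ratio_power (p.-1 %/ e'.2) a b c e x].
    by apply/setP => x; rewrite !inE /ratio_power /nz -andbA.
  have le1 := card_ratio_power_le p_pr oddp mk ek u100 pu ac ae bc be abce.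
  have le2 := card_ratio_power_ge p_pr oddp mk ek u100 pu ac ae bc be abce.
  rewrite gE; move: le1 le2; set N := #|_|; set m := (_ %/ _)%N => le1 le2.
  rewrite ler_norml lerBlDl -natrD ler_nat addnA le1 andbT lerNl opprB lerBlDl -natrD ler_nat.
  by rewrite addnA.
have nzc := card_generic_nonzero a b c e; rewrite -/nz in nzc.
apply: (@le_trans _ _ (\sum_(e' <- A) (p.-1%:R * (e'.1 / e'.2%:R) + `|e'.1| * (7 * u + 6)%:R)
     - c1 * #|[set x | nz x]|%:R)).
  by rewrite lerD2r big_seq [X in _ <= X]big_seq; apply: ler_sum.
rewrite big_split /= -mulr_sumr -mulr_suml cA.
have c10 : 0 <= c1 by case: hmaj.
rewrite addrAC; apply: lerD; last by rewrite ler_wpM2r.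
rewrite mulrC -mulrBr mulrC ler_wpM2r // lerBlDr -natrD ler_nat.
by rewrite -subn1 leq_subLR addnA addnC.
Qed.

(* The pairs for which the two quadratics agree, or are both squares. *)
Definition degenerate (q q' : 'I_h * 'I_h) : bool :=
  [|| q == q', q == (q'.2, q'.1) | (q.1 == q.2) && (q'.1 == q'.2)].

Lemma sum_degenerate : (\sum_q \sum_q' degenerate q q' <= 3 * h ^ 2)%N.
Proof.
have le q q' : (degenerate q q' <= (q' == q) + ((q' == (q.2, q.1)) + (q.1 == q.2) * (q'.1 == q'.2)))%N.
  rewrite /degenerate [q' == q]eq_sym; case: (q == q') => //=.
  have -> : (q' == (q.2, q.1)) = (q == (q'.2, q'.1)).
    by case: q q' => [a b] [c e]; rewrite !xpair_eqE /= andbC; congr (_ && _); rewrite eq_sym.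
  by do 3!case: (_ == _).
have diag : (\sum_(q : 'I_h * 'I_h) (q.1 == q.2) = h)%N.
  rewrite -(pair_bigA _ (fun i j : 'I_h => nat_of_bool (i == j))) /=.
  rewrite (eq_bigr (fun=> 1%N)) ?sum1_card ?card_ord // => i _.
  by rewrite (bigD1 i) //= eqxx big1 // => j /negPf; rewrite eq_sym => ->.
apply: leq_trans (leq_sum _ (fun q _ => leq_sum _ (fun q' _ => le q q'))) _.
rewrite (eq_bigr (fun q : 'I_h * 'I_h => (2 + h * (q.1 == q.2))%N)); last first.
  move=> q _; rewrite !big_split /= -big_distrr /= diag mulnC.
  by rewrite (bigD1 q) //= eqxx big1 => [|i /negPf -> //];
    rewrite (bigD1 (q.2, q.1)) //= eqxx big1 => [|i /negPf -> //]; rewrite addnA.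
rewrite big_split /= sum_nat_const card_prod card_ord -big_distrr /= diag; lia.
Qed.

(** Three kinds of pairs: degenerate ones, bounded trivially by [p A0]; those sharing a root, whose
    sum is nonpositive by cancellation; and generic ones. *)
Lemma sum_moment4 : 0 <= L ->
  \sum_x moment4 c1 C h x <=
  3%:R * h%:R ^+ 2 * (p%:R * A0) + h%:R ^+ 4 * (3%:R * c1 + L * (7 * u + 6)%:R).
Proof.
move=> L0; set G := 3%:R * c1 + _.
have c10 : 0 <= c1 by case: hmaj.
have G0 : 0 <= G by rewrite addr_ge0 // mulr_ge0.
have pA0 : 0 <= p%:R * A0 by rewrite mulr_ge0 ?A0_ge0.
have neq (i j : 'I_h) : i != j -> i%:R != j%:R :> F.
  by rewrite natF_eq ?(leq_trans (ltn_ord _) hp).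
have key (q q' : 'I_h * 'I_h) : \sum_x ker ((x + q.1%:R) * (x + q.2%:R)) ((x + q'.1%:R) * (x + q'.2%:R))
    <= (degenerate q q')%:R * (p%:R * A0) + G.
  have [dq|] := boolP (degenerate q q').
    rewrite mul1r -[X in X <= _]addr0; apply: lerD => //.
    by have := @sum_ker_le F (fun x => (x + q.1%:R) * (x + q.2%:R))
      (fun x => (x + q'.1%:R) * (x + q'.2%:R)); rewrite card_Fp.
  rewrite mul0r add0r; case: q q' => [a b] [c e]; rewrite /degenerate !xpair_eqE /= !negb_or !negb_and.
  case/and3P=> n1 n2 n3.
  have [ac|ac] := eqVneq a c.
    apply: le_trans G0; rewrite ac; apply: sum_ker_cancel; apply: neq.
    by move: n1; rewrite ac eqxx.
  have [ae|ae] := eqVneq a e.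
    apply: le_trans G0; rewrite ae; under eq_bigr => x _ do rewrite [(x + c%:R) * _]mulrC.
    by apply: sum_ker_cancel; apply: neq; move: n2; rewrite ae eqxx.
  have [bc|bc] := eqVneq b c.
    apply: le_trans G0; rewrite bc; under eq_bigr => x _ do rewrite [(x + a%:R) * _]mulrC.
    by apply: sum_ker_cancel; apply: neq; move: n2; rewrite bc eqxx orbF.
  have [be|be] := eqVneq b e.
    apply: le_trans G0; rewrite be.
    under eq_bigr => x _ do rewrite [(x + a%:R) * _]mulrC [(x + c%:R) * _]mulrC.
    by apply: sum_ker_cancel; apply: neq; move: n1; rewrite be eqxx orbF.
  apply: sum_ker_generic; rewrite ?neq //.
  by rewrite !natF_eq ?(leq_trans (ltn_ord _) hp) // negb_and.
rewrite /moment4 exchange_big /=; under eq_bigr => q _ do rewrite exchange_big.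
apply: le_trans (ler_sum _ (fun q _ => ler_sum _ (fun q' _ => key q q'))) _.
under eq_bigr => q _ do rewrite big_split /= -mulr_suml -natr_sum.
rewrite big_split /= -mulr_suml -natr_sum; apply: lerD.
  by rewrite ler_wpM2r // -natrX -natrM ler_nat sum_degenerate.
have -> : h%:R ^+ 4 = (h * h * (h * h))%:R :> rat by rewrite !natrM; ring.
by rewrite !sumr_const card_prod card_ord -mulrnA mulr_natl.
Qed.

End Totals.

(** * The sieve function and its majorant *)

Lemma coprime_prod_primes (r : nat) (s : seq nat) : prime r -> all prime s -> r \notin s ->
  coprime r (\prod_(q <- s) q).
Proof.
move=> rp; elim: s => [|q s IH] /=; first by rewrite big_nil coprimen1.
case/andP=> qp sp; rewrite inE negb_or => /andP[rq rs].
by rewrite big_cons coprimeMr IH // andbT prime_coprime // dvdn_prime2.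
Qed.

Lemma prod_primes_dvd (n : nat) (s : seq nat) : uniq s -> all prime s ->
  (forall q, q \in s -> q %| n)%N -> (\prod_(q <- s) q %| n)%N.
Proof.
elim: s => [|q s IH] /=; first by rewrite big_nil dvd1n.
case/andP=> qs us /andP[qp sp] H; rewrite big_cons Gauss_dvd ?coprime_prod_primes //.
by rewrite H ?mem_head // IH // => x xs; rewrite H // inE xs orbT.
Qed.

Section Sieve.
Variables (p : nat) (p_pr : prime p).
Local Notation F := 'F_p.
Variables (core rest : seq nat).
Hypothesis primesE : primes p.-1 = 2%N :: core ++ rest.

Definition recip_sum : rat := \sum_(q <- rest) q%:R^-1.
Let delta : rat := 1 - recip_sum.
Hypothesis delta0 : 0 <= delta.

(* [core_factor r t] is [r / (r - 1)] times the indicator of [~~ power_residue r t], and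
   [rest_factor t] is [1 - sum_q 1_q(t)], both written with their mean split off. The prime 2
   is always in the core, so that only even [k] occur in [expansion_sieve]. *)
Definition core_factor (r : nat) (t : F) : rat :=
  1 + (r%:R - 1)^-1 * (1 - r%:R * (power_residue r t)%:R).
Definition core_majorant (r : nat) (t : F) : rat :=
  1 + (r%:R - 1)^-1 * (r%:R * (power_residue r t)%:R - 1).
Definition rest_factor (t : F) : rat :=
  delta + \sum_(q <- rest) q%:R^-1 * (1 - q%:R * (power_residue q t)%:R).
Definition rest_majorant (t : F) : rat :=
  delta + \sum_(q <- rest) q%:R^-1 * (q%:R * (power_residue q t)%:R - 1).

Definition sieve_fun (t : F) := (\prod_(r <- 2%N :: core) core_factor r t) * rest_factor t.
Definition sieve_majorant (t : F) := (\prod_(r <- 2%N :: core) core_majorant r t) * rest_majorant t.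

Lemma sieve_prime q : q \in 2%N :: core ++ rest -> prime q /\ (q %| p.-1)%N.
Proof. by rewrite -primesE mem_primes => /and3P[]. Qed.

Lemma sieve_uniq : uniq (2%N :: core ++ rest).
Proof. by rewrite -primesE primes_uniq. Qed.

Lemma delta_le1 : delta <= 1.
Proof. by rewrite /delta gerBl; apply: sumr_ge0 => q _; rewrite invr_ge0. Qed.

Lemma sub1_gt0 (r : nat) : prime r -> 0 < r%:R - 1 :> rat.
Proof. by move=> rp; rewrite subr_gt0 (ltr_nat _ 1) prime_gt1. Qed.

Lemma majorized_eq c1 c1' f f' C C' : c1 = c1' -> f =1 f' -> C =1 C' ->
  @majorized p c1 f C -> majorized c1' f' C'.
Proof.
move=> <- ff CC [h0 [I [c [X [hX hf hC]]]]]; split=> //; exists I, c, X.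
by split=> // t t0; rewrite -?ff -?CC ?hf ?hC.
Qed.

Lemma majorized_prod (s : seq nat) : {subset s <= 2%N :: core ++ rest} ->
  majorized 1 (fun t : F => \prod_(r <- s) core_factor r t)
              (fun t => \prod_(r <- s) core_majorant r t).
Proof.
elim: s => [|r s IH] sub.
  by apply: majorized_eq (majorized_const p ler01) => // t; rewrite big_nil.
have [rp rd] := sieve_prime (sub _ (mem_head _ _)).
have IH' := IH (fun x xs => sub x (mem_behead (s := r :: s) xs)).
have inv0 : 0 <= (r%:R - 1)^-1 :> rat by rewrite invr_ge0 ltW // sub1_gt0.
have hr := majorized_add (majorized_const p ler01) (majorized_power_residue p_pr rd inv0).
apply: majorized_eq (majorized_mul hr IH'); rewrite ?addr0 ?mulr1 // => t; by rewrite big_cons.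
Qed.

Lemma majorized_rest : majorized delta rest_factor rest_majorant.
Proof.
have sub q : q \in rest -> (q %| p.-1)%N.
  by move=> qr; have [] // := @sieve_prime q; rewrite inE mem_cat qr !orbT.
suff : majorized 0 (fun t : F => \sum_(q <- rest) q%:R^-1 * (1 - q%:R * (power_residue q t)%:R))
   (fun t => \sum_(q <- rest) q%:R^-1 * (q%:R * (power_residue q t)%:R - 1)).
  move=> h; have := majorized_add (majorized_const p delta0) h.
  by apply: majorized_eq; rewrite ?addr0.
elim: (rest) sub => [|q s IH] sub.
  by apply: majorized_eq (majorized_const p (lexx 0)) => // t; rewrite big_nil.
have qd := sub _ (mem_head _ _).
have IH' := IH (fun x xs => sub x (mem_behead (s := q :: s) xs)).
have inv0 : 0 <= q%:R^-1 :> rat by rewrite invr_ge0.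
apply: majorized_eq (majorized_add (majorized_power_residue p_pr qd inv0) IH'); rewrite ?addr0 // => t;
  by rewrite big_cons.
Qed.

Lemma majorized_sieve : majorized delta sieve_fun sieve_majorant.
Proof.
have sub : {subset 2%N :: core <= 2%N :: core ++ rest}.
  by move=> q; rewrite !inE mem_cat => /orP[->//|->]; rewrite orbT.
by apply: majorized_eq (majorized_mul (majorized_prod sub) majorized_rest); rewrite ?mul1r.
Qed.

(** A prime [l] of the core makes its own factor vanish; a prime of the rest makes the last factor
    at most [1 - 1], while the core factors are nonnegative. *)
Lemma sieve_fun_le0 (t : F) l : l \in 2%N :: core ++ rest -> power_residue l t -> sieve_fun t <= 0.
Proof.
move=> lin lt; rewrite /sieve_fun.
have fac r : r \in 2%N :: core -> core_factor r t = (r%:R / (r%:R - 1)) * (~~ power_residue r t)%:R.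
  move=> rin; have [rp _] : prime r /\ (r %| p.-1)%N.
    by apply: sieve_prime; move: rin; rewrite !inE mem_cat => /orP[->//|->]; rewrite orbT.
  have r1 := sub1_gt0 rp; have := lt0r_neq0 r1; rewrite /core_factor.
  by case: power_residue => /= r10; field.
have [lc|lnc] := boolP (l \in 2%N :: core).
  by rewrite (big_rem l lc) /= fac // lt mulr0 mul0r mul0r.
have lr : l \in rest by move: lin lnc; rewrite !inE mem_cat; do 2!case: (_ \in _); case: eqP.
apply: mulr_ge0_le0.
  rewrite big_seq; apply: prodr_ge0 => r rin; rewrite fac // mulr_ge0 // divr_ge0 // ltW // sub1_gt0 //.
  have [] // : prime r /\ (r %| p.-1)%N.
  by apply: sieve_prime; move: rin; rewrite !inE mem_cat => /orP[->//|->]; rewrite orbT.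
have -> : rest_factor t = 1 - \sum_(q <- rest) (power_residue q t)%:R.
  have -> : \sum_(q <- rest) (power_residue q t)%:R =
     \sum_(q <- rest) (q%:R^-1 - q%:R^-1 * (1 - q%:R * (power_residue q t)%:R)) :> rat.
    rewrite big_seq [RHS]big_seq; apply: eq_bigr => q qin.
    have [qp _] : prime q /\ (q %| p.-1)%N by apply: sieve_prime; rewrite inE mem_cat qin !orbT.
    by rewrite mulrBr mulr1 opprB addrCA subrr addr0 mulrA mulVf ?mul1r // pnatr_eq0 -lt0n prime_gt0.
  by rewrite sumrB /rest_factor /delta /recip_sum; ring.
rewrite subr_le0 (big_rem l lr) /= lt -[X in X <= _]addr0; apply: lerD => //.
by apply: sumr_ge0.
Qed.

(** Every core factor is 2 at 1, and the last one is [delta + sum_q (1 - 1/q)] with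
    [sum_q 1/q = 1 - delta]. This makes [sum_i |c_i|] explicit. *)
Lemma sieve_majorant1 : sieve_majorant 1 = 2%:R ^+ (size core).+1 * (2%:R * delta + (size rest)%:R - 1).
Proof.
have pr1 k : power_residue k (1 : F) by rewrite /power_residue expr1n.
rewrite /sieve_majorant; congr (_ * _).
  have : all prime (2%N :: core).
    apply/allP => r rin; have [] // := @sieve_prime r.
    by move: rin; rewrite !inE mem_cat => /orP[->//|->]; rewrite orbT.
  rewrite (_ : (size core).+1 = size (2%N :: core)) //; elim: (2%N :: core) => [|r s IH] /=.
    by rewrite big_nil.
  case/andP=> rp sp; rewrite big_cons IH // exprS; congr (_ * _).
  by rewrite /core_majorant pr1 mulr1 mulVf // lt0r_neq0 // sub1_gt0.
rewrite /rest_majorant.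
have -> : \sum_(q <- rest) q%:R^-1 * (q%:R * (power_residue q (1 : F))%:R - 1) =
   \sum_(q <- rest) (1 - q%:R^-1) :> rat.
  rewrite big_seq [RHS]big_seq; apply: eq_bigr => q qin.
  have [qp _] : prime q /\ (q %| p.-1)%N by apply: sieve_prime; rewrite inE mem_cat qin !orbT.
  by rewrite pr1 mulr1 mulrBr mulr1 mulVf // pnatr_eq0 -lt0n prime_gt0.
rewrite sumrB big_const_seq count_predT iter_addr_0 -[in RHS](addrK recip_sum delta).
by rewrite /delta -/recip_sum subrK; ring.
Qed.

(** The factor of [r] is [1 - 1/(r - 1)] plus [r/(r - 1)] times an indicator, so its l1-norm is
    exactly 2. *)
Lemma expansion_core : residue_expansion (\prod_(r <- core) r) 1 (2%:R ^+ size core)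
  (fun t : F => \prod_(r <- core) core_majorant r t).
Proof.
have sub q : q \in core -> prime q /\ (q %| p.-1)%N.
  by move=> qr; apply: sieve_prime; rewrite inE mem_cat qr !orbT.
have uc : uniq core by move: sieve_uniq; rewrite /= cat_uniq => /andP[_ /andP[]].
elim: (core) sub uc => [|r s IH] sub /= => [_|/andP[rs us]].
  rewrite big_nil expr0 -[X in residue_expansion _ _ X]normr1.
  apply: residue_expansion_eq (residue_expansion_const p_pr 1 1) => t _.
  by rewrite big_nil.
have [rp rd] := sub _ (mem_head _ _).
have sub' q : q \in s -> prime q /\ (q %| p.-1)%N by move=> qs; apply: sub; rewrite inE qs orbT.
have sp : all prime s by apply/allP => q /sub' [].
have r1 := sub1_gt0 rp; have r10 := lt0r_neq0 r1.
have rn0 : r%:R != 0 :> rat by rewrite pnatr_eq0 -lt0n prime_gt0.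
have e1 := residue_expansion_add (residue_expansion_const p_pr r (1 - (r%:R - 1)^-1))
  (residue_expansion_residue p r (r%:R / (r%:R - 1))).
have e2 : residue_expansion r 1 2%:R (core_majorant r : F -> rat).
  move: e1; have -> : 1 - (r%:R - 1)^-1 + r%:R / (r%:R - 1) / r%:R = 1 :> rat by field; rewrite rn0 r10.
  have -> : `|1 - (r%:R - 1)^-1| + `|r%:R / (r%:R - 1)| = 2%:R :> rat.
    rewrite ger0_norm; last first.
      by rewrite subr_ge0 invf_le1 // lerBrDr (_ : 1 + 1 = 2%:R) // ler_nat prime_gt1.
    by rewrite ger0_norm ?divr_ge0 // ?ltW //; field.
  by apply: residue_expansion_eq => t _; rewrite /core_majorant; field.
rewrite big_cons exprS -[1]mulr1.
apply: residue_expansion_eq (residue_expansion_mul p_pr _ _ e2 (IH sub' us)).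
- by move=> t _; rewrite big_cons.
- exact: coprime_prod_primes.
by have := @prod_primes_dvd p.-1 (r :: s); rewrite big_cons /= rs us rp; apply => // q /sub [].
Qed.

Lemma expansion_rest : residue_expansion (\prod_(q <- rest) q) delta (1 + (size rest)%:R)
  (rest_majorant : F -> rat).
Proof.
have sub q : q \in rest -> prime q /\ (q %| p.-1)%N.
  by move=> qr; apply: sieve_prime; rewrite inE mem_cat qr !orbT.
have hs (s : seq nat) D : {in s, forall q, prime q /\ (q %| D)%N} ->
   residue_expansion D (\sum_(q <- s) q%:R^-1) (size s)%:R
     (fun t : F => \sum_(q <- s) (power_residue q t)%:R).
  elim: s => [|q s IH] H.
    have e := residue_expansion_const p_pr D 0; rewrite normr0 in e; rewrite big_nil.
    by apply: residue_expansion_eq e => t _; rewrite big_nil.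
  have [qp qD] := H _ (mem_head _ _).
  have IH' := IH (fun x xs => H x (mem_behead (s := q :: s) xs)).
  have := residue_expansion_add (residue_expansion_dvd qD (residue_expansion_residue p q 1)) IH'.
  rewrite div1r normr1 big_cons /= -natr1 [_%:R + 1]addrC.
  by apply: residue_expansion_eq => t _; rewrite big_cons mul1r.
have h1 := hs rest (\prod_(q <- rest) q).
have h2 : {in rest, forall q, prime q /\ (q %| \prod_(q <- rest) q)%N}.
  by move=> q qin; have [qp _] := sub _ qin; split=> //; rewrite (big_rem q qin) dvdn_mulr.
have := residue_expansion_add (residue_expansion_const p_pr (\prod_(q <- rest) q) (delta - recip_sum)) (h1 h2).
rewrite /recip_sum subrK => e; have le : `|delta - recip_sum| <= 1.
  have := delta0; have := delta_le1; have : recip_sum = 1 - delta by rewrite /delta; ring.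
  by move=> ->; rewrite ler_norml; lra.
apply: residue_expansion_eq (residue_expansion_le _ e); last by rewrite lerD2r.
move=> t _; rewrite /rest_majorant.
have -> : \sum_(q <- rest) q%:R^-1 * (q%:R * (power_residue q t)%:R - 1) =
   \sum_(q <- rest) ((power_residue q t)%:R - q%:R^-1) :> rat.
  rewrite big_seq [RHS]big_seq; apply: eq_bigr => q qin; have [qp _] := sub _ qin.
  by rewrite mulrBr mulr1 mulrA mulVf ?mul1r // pnatr_eq0 -lt0n prime_gt0.
by rewrite sumrB; ring.
Qed.

(** For [r = 2] the constant part of the core factor vanishes, leaving twice the indicator of
    squares; multiplication by it makes every [k] even. *)
Lemma expansion_sieve : exists A : seq (rat * nat),
  [/\ all (fun e => (e.2 %| p.-1) && ~~ odd e.2)%N A, \sum_(e <- A) e.1 / e.2%:R = delta,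
      \sum_(e <- A) `|e.1| <= 2%:R ^+ (size core).+1 * (1 + (size rest)%:R) &
      forall t, t != 0 -> sieve_majorant t = \sum_(e <- A) e.1 * (power_residue e.2 t)%:R].
Proof.
have us := sieve_uniq; have sp : all prime (2%N :: core ++ rest).
  by apply/allP => q /sieve_prime [].
have [n2 ucr] : 2%N \notin core ++ rest /\ uniq (core ++ rest).
  by move: us; rewrite cons_uniq => /andP.
have spcr : all prime (core ++ rest) by move: sp => /=.
have Dcr : ((\prod_(q <- core) q) * (\prod_(q <- rest) q) = \prod_(q <- core ++ rest) q)%N.
  by rewrite big_cat.
have dvd2 : (2 * \prod_(q <- core ++ rest) q %| p.-1)%N.
  have := @prod_primes_dvd p.-1 _ us sp; rewrite big_cons; apply => q /sieve_prime [] //.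
have cop2 : coprime 2 (\prod_(q <- core ++ rest) q) by apply: coprime_prod_primes.
have cop : coprime (\prod_(q <- core) q) (\prod_(q <- rest) q).
  move: ucr spcr; rewrite cat_uniq all_cat => /and3P[_ dis _] /andP[cp rp].
  rewrite big_seq; apply: (big_ind (fun x => coprime x _)).
  - exact: coprime1n.
  - by move=> x y hx hy; rewrite coprimeMl hx.
  move=> q qc; apply: coprime_prod_primes => //; first exact: (allP cp).
  by apply: contra dis => qr; apply/hasP; exists q.
have := residue_expansion_mul p_pr cop _ expansion_core expansion_rest.
rewrite Dcr => /(_ (dvdn_trans (dvdn_mull _ (dvdnn _)) dvd2)) [A [hA cA lA eA]].
exists [seq (2%:R * e.1, (2 * e.2)%N) | e <- A]; split.
- apply/allP => _ /mapP[e eA0 ->] /=; rewrite oddM /= andbT.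
  by apply: dvdn_trans dvd2; rewrite dvdn_pmul2l //; exact: (allP hA).
- rewrite big_map /= -[RHS]mul1r -cA; apply: eq_bigr => e _.
  by rewrite natrM invfM mulrACA divff // mul1r.
- rewrite big_map /= exprS -mulrA.
  have -> : \sum_(e <- A) `|2%:R * e.1| = 2%:R * \sum_(e <- A) `|e.1|.
    by rewrite mulr_sumr; apply: eq_bigr => e _; rewrite normrM ger0_norm.
  by rewrite ler_wpM2l.
move=> t t0; rewrite /sieve_majorant big_cons -mulrA eA // big_map mulr_sumr /=.
rewrite big_seq [RHS]big_seq; apply: eq_bigr => e inA.
have eD := allP hA _ inA.
rewrite power_residueM //; last 2 first.
- exact: coprime_dvdr eD cop2.
- by apply: dvdn_trans dvd2; rewrite dvdn_pmul2l.
have -> : core_majorant 2 t = 2%:R * (power_residue 2 t)%:R.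
  by rewrite /core_majorant; case: power_residue => /=; field.
by case: power_residue; case: power_residue => /=; ring.
Qed.

End Sieve.

(** * Counting reduced fractions in a triangle *)

Definition coprime_pairs (H h X : nat) : seq (nat * nat) :=
  [seq z <- [seq (q, n) | q <- index_iota 1 X.+1, n <- index_iota 1 (H - q * h).+1] | coprime z.1 z.2].

Lemma size_coprime_pairs H h X : size (coprime_pairs H h X) =
  (\sum_(1 <= q < X.+1) \sum_(1 <= n < (H - q * h).+1) coprime q n)%N.
Proof.
rewrite /coprime_pairs -sum1_size big_filter big_mkcond big_allpairs_dep /=.
by apply: eq_bigr => q _; apply: eq_bigr => n _; case: coprime.
Qed.

Lemma coprime_pairs_uniq H h X : uniq (coprime_pairs H h X).
Proof.
apply: filter_uniq; apply: allpairs_uniq_dep; rewrite ?iota_uniq //.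
  by move=> q _; exact: iota_uniq.
by move=> [a b] [c d] _ _ [-> ->].
Qed.

Lemma count_multiples l m : (0 < l)%N -> (\sum_(1 <= n < m.+1) (l %| n) = m %/ l)%N.
Proof.
move=> l0; elim: m => [|m IH]; first by rewrite big_geq // div0n.
by rewrite big_nat_recr //= IH divnS // addnC.
Qed.

Lemma sum_multiples l X (G : nat -> nat) : (0 < l)%N ->
  (\sum_(1 <= q < X.+1) (l %| q) * G q = \sum_(1 <= j < (X %/ l).+1) G (j * l))%N.
Proof.
move=> l0; elim: X => [|X IH]; first by rewrite div0n !big_geq.
rewrite big_nat_recr //= IH divnS //; have [d|_] := boolP (l %| X.+1)%N; last by rewrite addn0.
rewrite mul1n add1n [RHS]big_nat_recr //=; congr (_ + G _)%N.
by have := divnK d; rewrite divnS // d add1n => ->.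
Qed.

(** Lattice points with both coordinates divisible by [l] in the triangle [n + q h <= H] of area
    [H^2 / (2 h)]: at most the area divided by [l^2]. *)
Lemma multiples_bound H h X l : (0 < h)%N -> (0 < l)%N -> (X * h <= H)%N ->
  (\sum_(1 <= q < X.+1) (l %| q) * ((H - q * h) %/ l))%N%:R <= H%:R ^+ 2 / (2%:R * h%:R) / l%:R ^+ 2 :> rat.
Proof.
move=> h0 l0 XH; rewrite (sum_multiples _ (fun q => (H - q * h) %/ l)%N) //.
set Y := (X %/ l)%N; have YH : (Y * l * h <= H)%N.
  by apply: leq_trans XH; rewrite leq_mul2r leq_trunc_div orbT.
have key Z : (Z <= Y)%N -> (\sum_(1 <= j < Z.+1) ((H - j * l * h) %/ l))%N%:R * l%:R <=
    Z%:R * H%:R - (l * h)%:R * (Z%:R * (Z%:R + 1)) / 2%:R :> rat.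
  elim: Z => [|Z IH] ZY; first by rewrite big_geq // !mul0r mulr0 mul0r subr0.
  rewrite big_nat_recr //= natrD mulrDl.
  have h1 := IH (ltnW ZY).
  have h2 : ((H - Z.+1 * l * h) %/ l)%:R * l%:R <= H%:R - Z.+1%:R * l%:R * h%:R :> rat.
    have le : (Z.+1 * l * h <= H)%N by apply: leq_trans YH; rewrite !leq_mul2r ZY !orbT.
    by rewrite -natrM -!natrM -natrB // ler_nat leq_trunc_div.
  apply: le_trans (lerD h1 h2) _; rewrite natrM -natr1 le_eqVlt; apply/orP; left; apply/eqP.
  by field.
have l1 : (0 : rat) < l%:R by rewrite ltr0n.
have h1 : (0 : rat) < h%:R by rewrite ltr0n.
rewrite ler_pdivlMr ?exprn_gt0 // ler_pdivlMr ?mulr_gt0 //.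
have := key Y (leqnn _); set S : rat := _%:R; move=> keyY.
have e : S * l%:R ^+ 2 * (2%:R * h%:R) = (S * l%:R) * (2%:R * (l * h)%:R) by rewrite natrM; ring.
rewrite e; set a : rat := (l * h)%:R.
have a0 : 0 <= a by [].
apply: le_trans (ler_wpM2r _ keyY) _; first by rewrite mulr_ge0.
have Y0 : (0 : rat) <= Y%:R by [].
rewrite -subr_ge0.
have -> : H%:R ^+ 2 - (Y%:R * H%:R - (l * h)%:R * (Y%:R * (Y%:R + 1)) / 2%:R) * (2%:R * a)
  = (H%:R - a * Y%:R) ^+ 2 + a ^+ 2 * Y%:R by rewrite /a; field.
by rewrite addr_ge0 ?sqr_ge0 // mulr_ge0 ?sqr_ge0.
Qed.

(** Telescoping, since [(2 i + 3)^2 > 4 (i + 1) (i + 2)]. *)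
Lemma sum_inv_odd_sqr K : \sum_(i < K) ((2 * i + 3)%:R ^+ 2)^-1 <= 1 / 4%:R :> rat.
Proof.
suff : \sum_(i < K) ((2 * i + 3)%:R ^+ 2)^-1 <= 1 / 4%:R - 1 / (4%:R * (K%:R + 1)) :> rat.
  move/le_trans; apply; rewrite gerBl divr_ge0 // mulr_ge0 // addr_ge0 //.
elim: K => [|K IH]; first by rewrite big_ord0 add0r mulr1 subrr.
rewrite big_ord_recr /=; apply: le_trans (lerD IH (lexx _)) _.
rewrite -[K.+1%:R]natr1 natrD natrM; have : (0 : rat) <= K%:R by [].
move: K%:R => x x0.
have -> : 1 / 4%:R - 1 / (4%:R * (x + 1 + 1)) = 1 / 4%:R - 1 / (4%:R * (x + 1))
    + (4%:R * (x + 1) * (x + 2%:R))^-1 by field; lra.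
rewrite lerD2l lef_pV2 ?posrE; nra.
Qed.

(* A common factor is witnessed by 2 or by an odd [l >= 3], primality of [l] being
   irrelevant since [sum 1/l^2 <= 1/4] already over all odd [l >= 3]. *)
Lemma coprime_indicator q n X : (0 < q)%N -> (q <= X)%N ->
  (1 <= coprime q n + ((2 %| q) * (2 %| n) + \sum_(i < X) ((2 * i + 3) %| q) * ((2 * i + 3) %| n)))%N.
Proof.
move=> q0 qX; have [//|ncop] := boolP (coprime q n).
have g1 : (gcdn q n != 1)%N by [].
have g0 : (0 < gcdn q n)%N by rewrite gcdn_gt0 q0.
have pg : prime (pdiv (gcdn q n)) by rewrite pdiv_prime // ltn_neqAle eq_sym g1.
have := pdiv_dvd (gcdn q n); rewrite dvdn_gcd => /andP[lq ln].
rewrite add0n; case: (even_prime pg) => [l2|lodd].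
  by rewrite l2 in lq ln; rewrite lq ln.
apply: leq_trans (leq_addl _ _).
set l := pdiv _ in pg lq ln lodd.
have lX : (l <= X)%N := leq_trans (dvdn_leq q0 lq) qX.
have l3 : (3 <= l)%N by have := prime_gt1 pg; move: lodd; case: (l) => [|[|[|]]].
have iX : ((l - 3)./2 < X)%N by lia.
have e : (2 * (l - 3)./2 + 3 = l)%N by move: lodd; lia.
by rewrite (bigD1 (Ordinal iX)) //= e lq ln.
Qed.

(** From the area [T = H^2 / (2 h)] at most [T / 4] is removed for the factor 2 and [T / 4] for all
    odd [l >= 3]. The remaining half is cruder than the true density [6 / pi^2] but elementary; the
    boundary costs at most [h + H]. *)
Lemma coprime_pairs_lower H h : (0 < h)%N ->
  H%:R ^+ 2 / (4%:R * h%:R) - (h + H)%:R <= (size (coprime_pairs H h (H %/ h)))%:R :> rat.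
Proof.
move=> h0; have pos3 i : (0 < 2 * i + 3)%N by rewrite addn3.
set X := (H %/ h)%N; have XH : (X * h <= H)%N := leq_trunc_div _ _.
have h1 : (0 : rat) < h%:R by rewrite ltr0n.
have tot : (\sum_(1 <= q < X.+1) (H - q * h) <= size (coprime_pairs H h X)
   + (\sum_(1 <= q < X.+1) (2 %| q) * ((H - q * h) %/ 2)
   + \sum_(i < X) \sum_(1 <= q < X.+1) ((2 * i + 3) %| q) * ((H - q * h) %/ (2 * i + 3))))%N.
  rewrite size_coprime_pairs [X in (_ <= _ + (_ + X))%N]exchange_big /= -!big_split /= !big_nat.
  apply: leq_sum => q /andP[q0 qX].
  set m := (H - q * h)%N.
  have em l : (0 < l)%N -> ((l %| q) * (m %/ l) = \sum_(1 <= n < m.+1) (l %| q) * (l %| n))%N.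
    by move=> l0; rewrite -(count_multiples m l0) big_distrr.
  rewrite em // (eq_bigr _ (fun (i : 'I_X) _ => em (2 * i + 3)%N (pos3 i))).
  rewrite exchange_big /= -!big_split /=.
  have {1}-> : m = (\sum_(1 <= n < m.+1) 1)%N by rewrite sum_nat_const_nat muln1 subn1.
  by rewrite !big_nat; apply: leq_sum => n _; apply: coprime_indicator.
have b2 := @multiples_bound H h X 2 h0 isT XH.
have bi (i : 'I_X) := @multiples_bound H h X (2 * i + 3) h0 (pos3 i) XH.
have tot' : (\sum_(1 <= q < X.+1) (H - q * h))%N%:R <= (size (coprime_pairs H h X))%:R
   + (H%:R ^+ 2 / (2%:R * h%:R)) / 2%:R :> rat.
  move: tot; rewrite -(ler_nat rat) natrD natrD => tot; apply: le_trans tot _.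
  rewrite lerD2l; set T : rat := H%:R ^+ 2 / (2%:R * h%:R) in b2 bi *.
  have T0 : 0 <= T by rewrite divr_ge0 ?exprn_ge0 // mulr_ge0.
  have -> : T / 2%:R = T / 2%:R ^+ 2 + T * (1 / 4%:R) by field.
  apply: lerD => //; rewrite natr_sum; apply: le_trans (ler_sum _ (fun i _ => bi i)) _.
  by rewrite -mulr_sumr ler_wpM2l // sum_inv_odd_sqr.
have main : H%:R ^+ 2 / (2%:R * h%:R) - (h + H)%:R / 2%:R <= (\sum_(1 <= q < X.+1) (H - q * h))%N%:R :> rat.
  have E Z : (Z * h <= H)%N -> (\sum_(1 <= q < Z.+1) (H - q * h))%N%:R =
      Z%:R * H%:R - h%:R * (Z%:R * (Z%:R + 1)) / 2%:R :> rat.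
    elim: Z => [|Z IH] ZH; first by rewrite big_geq // !mul0r mulr0 mul0r subr0.
    rewrite big_nat_recr //= natrD IH; last by apply: leq_trans ZH; rewrite leq_mul2r leqnSn orbT.
    by rewrite natrB // natrM -natr1; field.
  rewrite E // natrD; have : H%:R < (X%:R + 1) * h%:R :> rat.
    by rewrite natr1 -natrM ltr_nat ltn_ceil.
  have : X%:R * h%:R <= H%:R :> rat by rewrite -natrM ler_nat.
  move: h1; move: (X%:R : rat) (H%:R : rat) (h%:R : rat) => x y z z0 l1 l2.
  rewrite -(ler_pM2r (_ : 0 < 2%:R * z)) ?mulr_gt0 //.
  have -> : (y ^+ 2 / (2%:R * z) - (z + y) / 2%:R) * (2%:R * z) = y ^+ 2 - z ^+ 2 - y * z by field; lra.
  have -> : (x * y - z * (x * (x + 1)) / 2%:R) * (2%:R * z) = 2%:R * (x * z) * y - (x * z) ^+ 2 - x * z * z by field.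
  move: l1 l2; rewrite mulrDl mul1r; move: (x * z) => w l1 l2.
  (* with r = y - w in [0, z): (y^2 - r^2 - z (y - r)) - (y^2 - z^2 - y z) = z^2 - r^2 + z r *)
  have r0 : 0 <= y - w by lra.
  have r1 : 0 <= z - (y - w) by lra.
  have := mulr_ge0 r0 r1; nra.
have hH : (0 : rat) <= (h + H)%:R by [].
have e4 : H%:R ^+ 2 / (4%:R * h%:R) = H%:R ^+ 2 / (2%:R * h%:R) / 2%:R :> rat by field; lra.
rewrite e4; move: tot' main hH.
set A := _ / (2%:R * _); set B := (size _)%:R; set D := (h + H)%:R; set S := _%:R.
by lra.
Qed.

(** * The windows and the two moment inequalities *)

Section Positions.
Variables (p : nat) (p_pr : prime p) (oddp : odd p).
Local Notation F := 'F_p.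
Variables (core rest : seq nat).
Hypothesis primesE : primes p.-1 = 2%N :: core ++ rest.
Local Notation delta := (1 - recip_sum rest).
Hypothesis delta0 : 0 <= delta.
Variables (H h : nat).
Hypothesis nonprimitive : forall n, (0 < n <= H)%N ->
  exists2 l, l \in primes p.-1 & power_residue l (n%:R : F).
Hypotheses (Hp : (H < p)%N) (h0 : (0 < h)%N) (hp : (h <= p)%N).
Let X := (H %/ h)%N.
Hypothesis HXp : (2 * H * X < p)%N.
Local Notation f := (@sieve_fun p core rest).
Local Notation C := (@sieve_majorant p core rest).

Lemma natF_neq0 n : (0 < n < p)%N -> n%:R != 0 :> F.
Proof.
case/andP=> n0 np; rewrite -(dvdn_pcharf (pchar_Fp p_pr)).
by apply/negP => /(dvdn_leq n0); rewrite leqNgt np.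
Qed.

Lemma pair_bounds z : z \in coprime_pairs H h X ->
  [/\ (0 < z.1 <= X)%N, (0 < z.2)%N, (z.2 + z.1 * h <= H)%N & coprime z.1 z.2].
Proof.
rewrite mem_filter => /andP[cop /allpairsPdep[q [n [qin nin ez]]]].
move: cop qin nin; rewrite ez /= !mem_index_iota => cop /andP[q0 qX] /andP[n0 nH].
split=> //; first by rewrite q0.
have : (q * h <= H)%N.
  by apply: leq_trans (leq_trunc_div H h); rewrite leq_mul2r -ltnS qX orbT.
by move: nH; rewrite ltnS; lia.
Qed.

Lemma X_le_H : (X <= H)%N. Proof. exact: leq_div. Qed.

(** After cross multiplication both sides are integers below [p], so the congruence is an equality
    of reduced fractions. *)
Lemma frac_eq (q n q' n' : nat) : (0 < q <= X)%N -> (0 < q' <= X)%N -> (0 < n <= H)%N ->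
  (0 < n' <= H)%N -> coprime q n -> coprime q' n' ->
  n%:R / q%:R = n'%:R / q'%:R :> F -> q = q' /\ n = n'.
Proof.
move=> /andP[q0 qX] /andP[q0' qX'] /andP[n0 nH] /andP[n0' nH'] cop cop' e.
have HX2 : (H * X < p)%N by apply: leq_ltn_trans HXp; rewrite -mulnA; lia.
have le a b : (a <= H)%N -> (b <= X)%N -> (a * b < p)%N.
  by move=> aH bX; apply: leq_ltn_trans HX2; apply: leq_mul.
have qp : (0 < q < p)%N by rewrite q0 (leq_ltn_trans (leq_trans qX X_le_H)).
have qp' : (0 < q' < p)%N by rewrite q0' (leq_ltn_trans (leq_trans qX' X_le_H)).
have : (n * q')%:R == (n' * q)%:R :> F.
  by rewrite !natrM -eqr_div ?natF_neq0 // e.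
rewrite natF_eq ?le // => /eqP eN.
have qq : (q %| q')%N by rewrite -(Gauss_dvdr _ cop) eN dvdn_mull.
have qq' : (q' %| q)%N by rewrite -(Gauss_dvdr _ cop') -eN dvdn_mull.
have eq : q = q' by apply/eqP; rewrite eqn_dvd qq qq'.
by split=> //; apply/eqP; rewrite -(eqn_pmul2r q0) {1}eq eN.
Qed.

Lemma frac_neq_opp (q n q' n' : nat) : (0 < q <= X)%N -> (0 < q' <= X)%N -> (0 < n <= H)%N ->
  (0 < n' <= H)%N -> n%:R / q%:R != - (n'%:R / q'%:R) :> F.
Proof.
move=> /andP[q0 qX] /andP[q0' qX'] /andP[n0 nH] /andP[n0' nH'].
have qp : (0 < q < p)%N by rewrite q0 (leq_ltn_trans (leq_trans qX X_le_H)).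
have qp' : (0 < q' < p)%N by rewrite q0' (leq_ltn_trans (leq_trans qX' X_le_H)).
rewrite -addr_eq0 addf_div ?natF_neq0 // mulf_neq0 ?invr_eq0 ?mulf_neq0 ?natF_neq0 //.
rewrite -!natrM -natrD natF_neq0 // addn_gt0 muln_gt0 n0 q0' /=.
apply: leq_ltn_trans HXp; rewrite -mulnA mul2n -addnn.
by apply: leq_add; [apply: leq_mul | apply: leq_mul].
Qed.

(* The window of a negative position is traversed backwards, from [n + q (h - 1)] to [n]. *)
Definition neg_start (z : nat * nat) := (z.2 + z.1 * h.-1)%N.

Definition positions : seq F :=
  [seq z.2%:R / z.1%:R | z <- coprime_pairs H h X] ++
  [seq - ((neg_start z)%:R / z.1%:R) | z <- coprime_pairs H h X].

Lemma neg_start_bounds z : z \in coprime_pairs H h X ->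
  (0 < neg_start z <= H)%N /\ coprime z.1 (neg_start z).
Proof.
case/pair_bounds=> /andP[z0 _] n0 nH cop; rewrite /neg_start; split.
  rewrite addn_gt0 n0 /=; apply: leq_trans nH; rewrite leq_add2l leq_mul2l leq_pred orbT //.
by rewrite /coprime addnC mulnC gcdnMDl.
Qed.

Lemma positions_uniq : uniq positions.
Proof.
have up := coprime_pairs_uniq H h X; rewrite cat_uniq; apply/and3P; split.
- rewrite map_inj_in_uniq // => z w zin win.
  have [z1 z2 z3 z4] := pair_bounds zin; have [w1 w2 w3 w4] := pair_bounds win.
  case/frac_eq => //; rewrite ?z2 ?w2 ?(leq_trans (leq_addr _ _) z3) ?(leq_trans (leq_addr _ _) w3) //.
  by move=> e1 e2; rewrite [z]surjective_pairing e1 e2 -surjective_pairing.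
- apply/hasPn => _ /mapP[z zin ->]; apply/mapP => [[w win]] /eqP; apply/negP.
  have [z1 z2 z3 z4] := pair_bounds zin; have [w1 w2 w3 w4] := pair_bounds win.
  have [n1 _] := neg_start_bounds zin.
  rewrite eq_sym; apply: frac_neq_opp => //.
  by rewrite w2 (leq_trans (leq_addr _ _) w3).
rewrite map_inj_in_uniq // => z w zin win /oppr_inj.
have [z1 z2 z3 z4] := pair_bounds zin; have [w1 w2 w3 w4] := pair_bounds win.
have [n1 c1] := neg_start_bounds zin; have [n2 c2] := neg_start_bounds win.
case/frac_eq => // e1; rewrite /neg_start e1 => /addIn e2.
by rewrite [z]surjective_pairing e1 e2 -surjective_pairing.
Qed.

Lemma sieve_at n : (0 < n <= H)%N -> f (n%:R : F) <= 0.
Proof.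
by move=> nH; have [l lin lt] := nonprimitive nH; apply: (sieve_fun_le0 primesE _ lt); rewrite -primesE.
Qed.

Lemma positions_windows x : x \in positions ->
  exists2 a, a != 0 & forall b : 'I_h, x + b%:R != 0 /\ f (a * (x + b%:R)) <= 0.
Proof.
have nz n : (0 < n <= H)%N -> n%:R != 0 :> F.
  by case/andP=> n0 nH; apply: natF_neq0; rewrite n0 (leq_ltn_trans nH).
rewrite mem_cat => /orP[] /mapP[z zin ->].
  have [/andP[z0 z1] z2 z3 _] := pair_bounds zin.
  have q0 : z.1%:R != 0 :> F by apply: nz; rewrite z0 (leq_trans z1 X_le_H).
  exists z.1%:R => // b.
  have nb : (0 < z.2 + z.1 * b <= H)%N.
    rewrite addn_gt0 z2 /=; apply: leq_trans z3; rewrite leq_add2l leq_mul2l (ltnW (ltn_ord b)) orbT //.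
  have e : z.1%:R * (z.2%:R / z.1%:R + b%:R) = (z.2 + z.1 * b)%:R :> F.
    by rewrite natrD natrM mulrDr mulrCA divff // mulr1.
  split; last by rewrite e sieve_at.
  by apply/eqP => e0; move: (nz _ nb); rewrite -e e0 mulr0 eqxx.
have [/andP[z0 z1] z2 z3 _] := pair_bounds zin.
have q0 : z.1%:R != 0 :> F by apply: nz; rewrite z0 (leq_trans z1 X_le_H).
exists (- z.1%:R); rewrite ?oppr_eq0 // => b.
have nb : (0 < z.2 + z.1 * (h.-1 - b) <= H)%N.
  rewrite addn_gt0 z2 /=; apply: leq_trans z3; rewrite leq_add2l leq_mul2l; apply/orP; right.
  by apply: leq_trans (leq_subr _ _) (leq_pred _).
have e : - z.1%:R * (- ((neg_start z)%:R / z.1%:R) + b%:R) = (z.2 + z.1 * (h.-1 - b))%:R :> F.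
  have bh : (b <= h.-1)%N by have := ltn_ord b; lia.
  rewrite mulrDr mulrNN mulrCA divff // mulr1 /neg_start !natrD !natrM natrB //; ring.
split; last by rewrite e sieve_at.
by apply/eqP => e0; move: (nz _ nb); rewrite -e e0 mulr0 eqxx.
Qed.

Lemma size_positions : H%:R ^+ 2 / (2%:R * h%:R) - 2%:R * (h + H)%:R <= (size positions)%:R :> rat.
Proof.
rewrite size_cat !size_map [X in _ <= X]natrD; have := coprime_pairs_lower H h0; rewrite -/X.
have -> : H%:R ^+ 2 / (2%:R * h%:R) = 2%:R * (H%:R ^+ 2 / (4%:R * h%:R)) :> rat.
  by field; rewrite pnatr_eq0 -lt0n.
set a := H%:R ^+ 2 / (4%:R * h%:R); set b := (size _)%:R; set c := (h + H)%:R.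
by move: a b c => a b c; lra.
Qed.

(** Nonnegativity of the moments at every point allows the sum over positions to be completed to all
    residues, where it can be evaluated. *)
Lemma sum_positions (m : F -> rat) (v : rat) : (forall x, 0 <= m x) ->
  (forall x, x \in positions -> v <= m x) -> (size positions)%:R * v <= \sum_x m x.
Proof.
move=> m0 mv; rewrite (bigID (mem positions)) /= -[X in X <= _]addr0.
apply: lerD; last exact: sumr_ge0.
rewrite -(big_uniq _ positions_uniq).
have -> : (size positions)%:R * v = \sum_(x <- positions) v.
  by rewrite big_const_seq count_predT iter_addr_0 mulr_natl.
by rewrite big_seq [X in _ <= X]big_seq; apply: ler_sum => x /mv.
Qed.

Let A0 := C 1 - delta.
Let Npos : rat := H%:R ^+ 2 / (2%:R * h%:R) - 2%:R * (h + H)%:R.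

Lemma sum_sieve : \sum_(t : F | t != 0) (C t - delta) = 0.
Proof.
have [A [hA cA lA eA]] := expansion_sieve p_pr primesE delta0.
apply: (@sum_residue_expansion p p_pr p.-1 _ (\sum_(e <- A) `|e.1|)) => //.
by exists A; split=> //; apply: sub_all hA => e /andP[].
Qed.

Lemma A0_pos : 0 <= A0.
Proof. exact: (A0_ge0 (majorized_sieve p_pr primesE delta0)). Qed.

Lemma second_moment_inequality : Npos * (delta * h%:R) ^+ 2 <= A0 * (h%:R * p%:R * A0).
Proof.
have maj := majorized_sieve p_pr primesE delta0.
have lb := moment_lower_bounds h maj.
have sq0 : 0 <= (delta * h%:R) ^+ 2 by apply: sqr_ge0.
apply: le_trans (ler_wpM2r sq0 size_positions) _.
apply: (@le_trans _ _ (\sum_x A0 * moment2 delta C h x)).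
  apply: sum_positions => x; first by have [m0 _ _] := lb x; rewrite mulr_ge0 // A0_pos.
  by case/positions_windows=> a a0 win; have [_ _ /(_ a a0 win) []] := lb x.
by rewrite -mulr_sumr ler_wpM2l ?A0_pos // (sum_moment2 p_pr maj hp sum_sieve).
Qed.

Lemma fourth_moment_inequality u : (100 <= u)%N -> (p <= u * u)%N ->
  Npos * (delta * h%:R) ^+ 4 <= A0 ^+ 3 *
    (3%:R * h%:R ^+ 2 * (p%:R * A0) + h%:R ^+ 4 *
      (3%:R * delta + 2%:R ^+ (size core).+1 * (1 + (size rest)%:R) * (7 * u + 6)%:R)).
Proof.
move=> u100 pu; have maj := majorized_sieve p_pr primesE delta0.
have lb := moment_lower_bounds h maj.
have q0 : 0 <= (delta * h%:R) ^+ 4 by rewrite exprn_ge0 // mulr_ge0.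
apply: le_trans (ler_wpM2r q0 size_positions) _.
apply: (@le_trans _ _ (\sum_x A0 ^+ 3 * moment4 delta C h x)).
  apply: sum_positions => x.
    by have [_ m0 _] := lb x; rewrite mulr_ge0 // exprn_ge0 // A0_pos.
  by case/positions_windows=> a a0 win; have [_ _ /(_ a a0 win) []] := lb x.
rewrite -mulr_sumr ler_wpM2l ?exprn_ge0 ?A0_pos //.
apply: (sum_moment4 p_pr oddp maj hp u100 pu sum_sieve (expansion_sieve p_pr primesE delta0)).
by rewrite mulr_ge0 // ?exprn_ge0 // addr_ge0.
Qed.

End Positions.

(* Constants are opaque because conversion would otherwise compute with them in unary. *)
Fact search_const_key : {x : rat | x = 385%:R * 10%:R ^+ 3}. Proof. by eexists. Qed.
Definition search_const := sval search_const_key.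
Lemma search_constE : search_const = 385%:R * 10%:R ^+ 3. Proof. exact: svalP search_const_key. Qed.

Fact prime_min_key : {x : rat | x = 10%:R ^+ 23}. Proof. by eexists. Qed.
Definition prime_min := sval prime_min_key.
Lemma prime_minE : prime_min = 10%:R ^+ 23. Proof. exact: svalP prime_min_key. Qed.

Fact search_min_key : {x : rat | x = 10%:R ^+ 14}. Proof. by eexists. Qed.
Definition search_min := sval search_min_key.
Lemma search_minE : search_min = 10%:R ^+ 14. Proof. exact: svalP search_min_key. Qed.

(** Bounds [15 + 120 / delta19], which in turn bounds [A0 / delta] for at most 19 prime factors; the
    second moment requires a value below [sqrt(385000 / 2)], about 438. *)
Fact kappa_small_key : {x : rat | x = 410%:R}. Proof. by eexists. Qed.
Definition kappa_small := sval kappa_small_key.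
Lemma kappa_smallE : kappa_small = 410%:R. Proof. exact: svalP kappa_small_key. Qed.

Fact prime_min20_key : {x : rat | x = 10%:R ^+ 25}. Proof. by eexists. Qed.
Definition prime_min20 := sval prime_min20_key.
Lemma prime_min20E : prime_min20 = 10%:R ^+ 25. Proof. exact: svalP prime_min20_key. Qed.

(** Below the fourth root of [10^25], and above [2 * 385000] as [window_bound] demands. *)
Fact window_min_key : {x : rat | x = 10%:R ^+ 6}. Proof. by eexists. Qed.
Definition window_min := sval window_min_key.
Lemma window_minE : window_min = 10%:R ^+ 6. Proof. exact: svalP window_min_key. Qed.

(** Slightly below [385000 / 20], to absorb lower order terms. *)
Fact window_const_key : {x : rat | x = 189%:R * 100%:R}. Proof. by eexists. Qed.
Definition window_const := sval window_const_key.
Lemma window_constE : window_const = 189%:R * 100%:R. Proof. exact: svalP window_const_key. Qed.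

(** Slightly above [sqrt 385000], bounding [H] by a multiple of the squared window length. *)
Fact search_ratio_key : {x : rat | x = 622%:R}. Proof. by eexists. Qed.
Definition search_ratio := sval search_ratio_key.
Lemma search_ratioE : search_ratio = 622%:R. Proof. exact: svalP search_ratio_key. Qed.

(** The least integer exceeding [2 * 385000], the requirement of [window_bound]. *)
Fact short_window_key : {h : nat | h%:R = 770%:R * 10%:R ^+ 3 + 1 :> rat}.
Proof. by exists (770 * 10 ^ 3).+1; rewrite -natr1 natrM natrX. Qed.
Definition short_window := sval short_window_key.
Lemma short_windowE : short_window%:R = 770%:R * 10%:R ^+ 3 + 1 :> rat. Proof. exact: svalP short_window_key. Qed.

(** * Contradictions from the second and fourth moments, given bounds on the sieve *)

Section Contradiction.
Variables (p H : nat) (p_pr : prime p) (oddp : odd p).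
Local Notation F := 'F_p.
Hypothesis nonprimitive : forall n, (0 < n <= H)%N ->
  exists2 l, l \in primes p.-1 & power_residue l (n%:R : F).
Variables (core rest : seq nat).
Hypothesis primesE : primes p.-1 = 2%N :: core ++ rest.
Local Notation delta := (1 - recip_sum rest).
Hypothesis delta0 : 0 < delta.
Hypotheses (H_le : H%:R ^+ 2 <= search_const * p%:R :> rat) (H_ge : search_const * p%:R < (H%:R + 1) ^+ 2 :> rat).
Hypothesis p_ge : prime_min <= p%:R.

Lemma p_gt0Q : (0 : rat) < p%:R.
Proof. by rewrite ltr0n prime_gt0. Qed.

Lemma H_lt_p : (H < p)%N.
Proof.
rewrite -(ltr_nat rat) ltNge; apply/negP => pH; have p0 := p_gt0Q.
have p_le : p%:R * p%:R <= search_const * p%:R :> rat.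
  by apply: le_trans H_le; rewrite expr2; apply: ler_pM => //; exact: ltW.
rewrite (ler_pM2r p0) in p_le; have := le_trans p_ge p_le; rewrite search_constE prime_minE; lra.
Qed.

(** [2 H (H / h)] is at most [2 H^2 / h], and [H^2 <= 385000 p]. *)
Lemma window_bound h : 2%:R * search_const < h%:R -> (2 * H * (H %/ h) < p)%N.
Proof.
move=> hb; have p0 := p_gt0Q.
have h0 : (0 : rat) < h%:R by apply: lt_trans hb; rewrite search_constE; lra.
have XH : (H %/ h)%N%:R * h%:R <= H%:R :> rat by rewrite -natrM ler_nat leq_trunc_div.
rewrite -(ltr_nat rat) -(ltr_pM2r h0) !natrM.
have H0 : 0 <= H%:R :> rat by [].
have XH2 := ler_wpM2l H0 XH.
have hb2 : 2%:R * search_const * p%:R < h%:R * p%:R by rewrite ltr_pM2r.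
move: H_le XH2 hb2; move: (H %/ h)%N%:R (H%:R : rat) (h%:R : rat) (p%:R : rat) => X y z x; lra.
Qed.

Lemma A0E : @sieve_majorant p core rest 1 - delta =
  2%:R ^+ (size core).+1 * (2%:R * delta + (size rest)%:R - 1) - delta.
Proof. by rewrite (sieve_majorant1 primesE). Qed.

Lemma y_ge : search_min <= H%:R :> rat.
Proof.
rewrite leNgt; apply/negP => lt; have H0 : 0 <= H%:R :> rat by [].
have lt1 : H%:R + 1 <= search_min + 1 by rewrite lerD2r ltW.
have := ler_pM (addr_ge0 H0 ler01) (addr_ge0 H0 ler01) lt1 lt1.
move: H_ge p_ge; rewrite search_constE prime_minE search_minE.
move: (H%:R : rat) (p%:R : rat) => y x; lra.
Qed.

(** After cancelling [h], the inequality reads [delta^2 H^2 / 2 <= A0^2 p] up to small terms, that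
    is, about [192500 <= (A0 / delta)^2], whereas [410^2 = 168100]. *)
Lemma second_moment_contradiction :
  @sieve_majorant p core rest 1 - delta <= kappa_small * delta -> False.
Proof.
set A0 := _ - _ => A0_le.
have A0_ge : 0 <= A0 := A0_pos p_pr primesE (ltW delta0).
have p0 := p_gt0Q.
have h0 : (0 < short_window)%N by rewrite -(ltr_nat rat) short_windowE; lra.
have hp : (short_window <= p)%N by rewrite -(ler_nat rat); apply: le_trans p_ge; rewrite short_windowE prime_minE; lra.
have hb : 2%:R * search_const < short_window%:R by rewrite short_windowE search_constE; lra.
have := second_moment_inequality p_pr oddp primesE (ltW delta0) nonprimitive H_lt_p h0 hp
  (window_bound hb).
rewrite -/A0 natrD; set z : rat := short_window%:R.
have A2 : A0 * A0 <= (kappa_small * delta) * (kappa_small * delta) by apply: ler_pM.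
have d2 : 0 < delta * delta by rewrite mulr_gt0.
have y0 := y_ge; have y2 : search_min * H%:R <= H%:R ^+ 2 :> rat by rewrite expr2 ler_wpM2r.
move: H_le H_ge p_ge p0 A2 d2 y0 y2; set x : rat := p%:R; set y : rat := H%:R.
move: (1 - recip_sum rest) (A0) => d a H1 H2 pge p0 A2 d2 y0 y2 ineq.
have z0 : 0 < z by rewrite /z short_windowE; lra.
have e1 : (y ^+ 2 / (2%:R * z) - 2%:R * (z + y)) * (d * z) ^+ 2 =
   z * ((d * d) * (y ^+ 2 / 2%:R - 2%:R * z * (z + y))) by field; lra.
have e2 : a * (z * x * a) = z * ((a * a) * x) by ring.
rewrite e1 e2 ler_pM2l // in ineq.
have big : kappa_small * kappa_small * x < y ^+ 2 / 2%:R - 2%:R * z * (z + y).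
  by move: H1 H2 pge y0 y2; rewrite /z short_windowE search_constE prime_minE search_minE kappa_smallE; lra.
have := le_trans ineq (ler_wpM2r (ltW p0) A2).
have -> : kappa_small * d * (kappa_small * d) * x = (d * d) * (kappa_small * kappa_small * x) by ring.
by rewrite ler_pM2l // leNgt big.
Qed.

Section Fourth.
Variables (w : nat) (k : rat).
Hypotheses (w_le : (w ^ 4 <= p)%N) (w_gt : (p < (w.+1) ^ 4)%N) (p_ge25 : prime_min20 <= p%:R).
Hypothesis k_ge : 2%:R ^+ (size core).+1 * (1 + (size rest)%:R) <= k * delta.
Hypothesis k_le : k ^+ 16 <= window_const ^+ 4 * p%:R.
Local Notation W := (w%:R : rat).

Lemma w_leQ : W ^+ 4 <= p%:R. Proof. by rewrite -natrX ler_nat. Qed.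
Lemma w_gtQ : p%:R < (W + 1) ^+ 4. Proof. by rewrite natr1 -natrX ltr_nat. Qed.

Lemma w_ge : window_min <= W.
Proof.
rewrite leNgt; apply/negP => lt; have W0 : 0 <= W + 1 by rewrite addr_ge0.
have lt1 : W + 1 <= window_min + 1 by rewrite lerD2r ltW.
have B60 : 0 <= window_min + 1 by rewrite window_minE; lra.
have : (W + 1) ^+ 4 <= (window_min + 1) ^+ 4 by rewrite lerXn2r.
have := w_gtQ; move: p_ge25; rewrite window_minE prime_min20E; move: ((W + 1) ^+ 4) (p%:R : rat) => z x; lra.
Qed.

Lemma k_gt0 : 0 < k.
Proof.
have d1 := delta0; rewrite -(pmulr_lgt0 _ d1); apply: lt_le_trans k_ge.
by rewrite mulr_gt0 ?exprn_gt0 // ltr_wpDr.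
Qed.

Lemma k4_le : k ^+ 4 < window_const * (W + 1).
Proof.
have k0 := ltW k_gt0; have k20 : 0 < window_const by rewrite window_constE; lra.
have W0 : 0 < W + 1 by rewrite ltr_wpDl.
rewrite ltNge; apply/negP => le.
have : (window_const * (W + 1)) ^+ 4 <= (k ^+ 4) ^+ 4.
  by rewrite lerXn2r ?nnegrE ?exprn_ge0 // mulr_ge0 // ltW.
rewrite -exprM exprMn leNgt; apply/negP; rewrite negbK; apply: le_lt_trans k_le _.
by rewrite ltr_pM2l ?exprn_gt0 // w_gtQ.
Qed.

(** The quantities [A0], the l1-norm and [delta] are all at most [k * delta], so [delta ^+ 4]
    cancels. What remains is [N z^2 <= k^4 T], with [N z^2] about [192500 z^5], [T] about [10 z^4]
    and [k^4] below [18900 (z + 1)]. *)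
Lemma fourth_moment_contradiction : False.
Proof.
set A0 := @sieve_majorant p core rest 1 - delta.
have A0_ge : 0 <= A0 := A0_pos p_pr primesE (ltW delta0).
have p0 := p_gt0Q; have wge := w_ge; have W0 : 0 < W by apply: lt_le_trans wge; rewrite window_minE; lra.
have w0 : (0 < w)%N by rewrite -(ltr_nat rat).
have wp : (w <= p)%N by apply: leq_trans w_le; rewrite -[X in (X <= _)%N]expn1 leq_pexp2l.
have hb : 2%:R * search_const < w%:R by apply: lt_le_trans wge; rewrite window_minE search_constE; lra.
(* An integer upper bound for [sqrt p]. *)
pose u := (w.+1 ^ 2)%N.
have u100 : (100 <= u)%N.
  have : (100 <= w.+1)%N.
    by rewrite -(ler_nat rat) -natr1; move: wge; rewrite window_minE; lra.
  by move=> h; apply: leq_trans h _; rewrite -[X in (X <= _)%N]expn1 leq_pexp2l.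
have pu : (p <= u * u)%N by rewrite /u -expnD ltnW.
have uE : u%:R = (W + 1) ^+ 2 by rewrite /u natrX -natr1.
have := fourth_moment_inequality p_pr oddp primesE (ltW delta0) nonprimitive H_lt_p w0 wp
  (window_bound hb) u100 pu.
rewrite -/A0 !natrD natrM uE.
have Lk0 := k_ge; set L := 2%:R ^+ _ * (1 + _) in Lk0 *.
have d1 : delta <= 1 := delta_le1 rest.
have L1 : 1 <= L.
  rewrite /L -[1]mulr1 ler_pM // ?exprn_ege1 ?ler1n //.
  by rewrite lerDl.
have A0L : A0 <= L.
  rewrite /A0 A0E /L; set c := 2%:R ^+ _; have c0 : 0 <= c by rewrite /c exprn_ge0.
  have : 0 <= c * (2%:R - 2%:R * delta) by rewrite mulr_ge0 // subr_ge0 ler_piMr.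
  have := delta0; lra.
have k0 := k_gt0.
move: A0_ge A0L L1 d1 delta0 Lk0 k4_le H_le H_ge w_leQ w_gtQ wge W0 p0 y_ge.
move: (1 - recip_sum rest) A0 (p%:R : rat) (H%:R : rat) L W.
move=> d a x y L' z a0 aL L1 d1 d0 Lk k4 H1 H2 z4 x4 zge z0 x0 y0 ineq.
set q := k * d in Lk; have q0 : 0 <= q by rewrite mulr_ge0 // ltW.
have aq : a <= q := le_trans aL Lk.
have dq : d <= q := le_trans d1 (le_trans L1 Lk).
have z2 : 0 < z ^+ 2 by rewrite exprn_gt0.
have zz4 : 0 < z ^+ 4 by rewrite exprn_gt0.
have s0 : 0 <= 7%:R * (z + 1) ^+ 2 + 6%:R by rewrite addr_ge0 // mulr_ge0 // sqr_ge0.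
have i1 : 3%:R * z ^+ 2 * (x * a) + z ^+ 4 * (3%:R * d + L' * (7%:R * (z + 1) ^+ 2 + 6%:R)) <=
   q * (z ^+ 2 * (3%:R * x + z ^+ 2 * (7%:R * (z + 1) ^+ 2 + 9%:R))).
  have j1 : 3%:R * z ^+ 2 * (x * a) <= 3%:R * z ^+ 2 * (x * q).
    apply: ler_wpM2l; first by apply: mulr_ge0 => //; exact: ltW.
    by apply: ler_wpM2l => //; exact: ltW.
  have j2 : z ^+ 4 * (3%:R * d + L' * (7%:R * (z + 1) ^+ 2 + 6%:R)) <=
     z ^+ 4 * (3%:R * q + q * (7%:R * (z + 1) ^+ 2 + 6%:R)).
    apply: ler_wpM2l; first exact: ltW.
    by apply: lerD; [apply: ler_wpM2l | apply: ler_wpM2r].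
  by apply: le_trans (lerD j1 j2) _; rewrite le_eqVlt; apply/orP; left; apply/eqP; ring.
set N := (y ^+ 2 / (2%:R * z) - 2%:R * (z + y)) in ineq.
set T := 3%:R * x + z ^+ 2 * (7%:R * (z + 1) ^+ 2 + 9%:R) in i1.
have T0 : 0 <= T.
  apply: addr_ge0; first by apply: mulr_ge0 => //; exact: ltW.
  by apply: mulr_ge0 (ltW z2) _; apply: addr_ge0 => //; apply: mulr_ge0 => //; exact: sqr_ge0.
have i2 : N * (d * z) ^+ 4 <= q ^+ 3 * (q * (z ^+ 2 * T)).
  apply: le_trans ineq _; apply: ler_pM => //; first exact: exprn_ge0.
    have b1 : 0 <= 3%:R * z ^+ 2 * (x * a).
      by apply: mulr_ge0; apply: mulr_ge0 => //; exact: ltW.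
    apply: addr_ge0 => //; apply: mulr_ge0 (ltW zz4) _; apply: addr_ge0.
      by apply: mulr_ge0 => //; exact: ltW.
    by apply: mulr_ge0 => //; apply: le_trans L1.
  by rewrite lerXn2r.
have i3 : N * z ^+ 2 <= k ^+ 4 * T.
  have dz : 0 < d ^+ 4 * z ^+ 2 by rewrite mulr_gt0 ?exprn_gt0.
  rewrite -(ler_pM2l dz).
  have -> : d ^+ 4 * z ^+ 2 * (N * z ^+ 2) = N * (d * z) ^+ 4 by ring.
  have -> : d ^+ 4 * z ^+ 2 * (k ^+ 4 * T) = q ^+ 3 * (q * (z ^+ 2 * T)) by rewrite /q; ring.
  exact: i2.
have i4 : N * z ^+ 2 <= window_const * (z + 1) * T := le_trans i3 (ler_wpM2r T0 (ltW k4)).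
have Nz : N * z ^+ 2 = z * y ^+ 2 / 2%:R - 2%:R * z ^+ 2 * (z + y) by rewrite /N; field; rewrite lt0r_neq0.
have yy0 : 0 <= y by apply: le_trans y0; rewrite search_minE; lra.
have zp (i : nat) : window_min * z ^+ i <= z ^+ i.+1 by rewrite exprS ler_wpM2r // exprn_ge0 // ltW.
have zp1 := zp 1%N; have zp2 := zp 2%N; have zp3 := zp 3%N; have zp4 := zp 4%N.
have zp0 : window_min <= z := zge; rewrite expr1 in zp1.
(* An upper bound on [y] is needed as well, for the subtracted boundary term [2 z^2 (z + y)]. *)
have y622 : y <= search_ratio * z ^+ 2.
  rewrite leNgt; apply/negP => lt; have k30 : 0 <= search_ratio * z ^+ 2 by rewrite mulr_ge0 ?(ltW z2) // search_ratioE; lra.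
  have := ler_pM k30 k30 (ltW lt) (ltW lt); move: H1 x4 zp0 zp1 zp2 zp3.
  by rewrite search_ratioE search_constE window_minE; move: zz4; lra.
have Tz : T <= 10%:R * z ^+ 4 + z ^+ 4 / 1000%:R.
  by rewrite /T; move: x4 zp0 zp1 zp2 zp3 zz4; rewrite window_minE; lra.
have z10 : 0 <= window_const * (z + 1) by rewrite mulr_ge0 ?addr_ge0 ?(ltW z0) // window_constE; lra.
have i5 := le_trans i4 (ler_wpM2l z10 Tz).
have zy : z ^+ 2 * y <= z ^+ 2 * (search_ratio * z ^+ 2) by rewrite ler_wpM2l // ltW.
have zH : z * (search_const * x) <= z * (y + 1) ^+ 2 by rewrite ler_wpM2l ?(ltW H2) // ltW.
have zx : z * (search_const * z ^+ 4) <= z * (search_const * x).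
  by rewrite ler_wpM2l ?(ltW z0) // ler_wpM2l // search_constE; lra.
have zy2 : z * y <= z * (search_ratio * z ^+ 2) by rewrite ler_wpM2l // ltW.
have z5 : 0 < z ^+ 5 by rewrite exprn_gt0.
move: i5 zy zH zx zy2 zp0 zp1 zp2 zp3 zp4 z0 zge z5; rewrite Nz window_constE search_ratioE search_constE window_minE; lra.
Qed.
End Fourth.

End Contradiction.

(** * Lower bounds for the prime factors of p - 1 and for their product *)

Definition small_primes : seq nat :=
  [:: 2; 3; 5; 7; 11; 13; 17; 19; 23; 29; 31; 37; 41; 43; 47; 53; 59; 61; 67; 71; 73; 79; 83; 89;
      97; 101; 103; 107; 109; 113; 127; 131]%N.

Lemma small_primes_consecutive : all (fun j => all (fun m => ~~ prime m)
  (iota (nth 0 small_primes j).+1 (nth 0 small_primes j.+1 - (nth 0 small_primes j).+1)))%N (iota 0 31).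
Proof. by vm_compute. Qed.

(** The harmonic block starting at [c = 8] is about 1.43; it decreases towards [log 4]. *)
Fact harmonic_bound_key : {x : rat | x = 29%:R / 20%:R}. Proof. by eexists. Qed.
Definition harmonic_bound := sval harmonic_bound_key.
Lemma harmonic_boundE : harmonic_bound = 29%:R / 20%:R. Proof. exact: svalP harmonic_bound_key. Qed.

(* Passing from [c] to [c.+1] removes [1 / c.+1] and adds four terms, each at most a quarter of it. *)
Lemma harmonic_block c : (8 <= c)%N -> \sum_(c <= j < 4 * c + 3) j.+1%:R^-1 <= harmonic_bound.
Proof.
elim: c => // c IH; rewrite leq_eqVlt => /orP[/eqP <-|c8].
  by rewrite unlock /=; rewrite harmonic_boundE; lra.
apply: le_trans (IH c8).
have -> : (4 * c.+1 + 3 = (4 * c + 3).+4)%N by lia.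
rewrite [X in _ <= X]big_ltn; last by lia.
rewrite !big_nat_recr /=; try lia.
have le j : (4 * c + 3 <= j)%N -> j.+1%:R^-1 <= c.+1%:R^-1 / 4%:R :> rat.
  move=> cj; rewrite -invfM lef_pV2 ?posrE ?mulr_gt0 ?ltr0n // -natrM ler_nat; lia.
have l0 := le (4 * c + 3)%N (leqnn _).
have l1 := le (4 * c + 3).+1 (leqnSn _).
have l2 := le (4 * c + 3).+2 (leq_trans (leqnSn _) (leqnSn _)).
have l3 := le (4 * c + 3).+3 (leq_trans (leq_trans (leqnSn _) (leqnSn _)) (leqnSn _)).
move: l0 l1 l2 l3; set S : rat := \sum_(_ <= _ < _) _.
move: S c.+1%:R^-1 (4 * c + 3).+1%:R^-1 (4 * c + 3).+2%:R^-1 (4 * c + 3).+3%:R^-1.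
by move: (4 * c + 3).+4%:R^-1 => x5 S x x1 x2 x3; lra.
Qed.

Section PrimeSequences.
Variable s : seq nat.
Hypotheses (s_sorted : sorted ltn s) (s_prime : all prime s).
Local Notation sj j := (nth 0%N s j).
Local Notation T j := (nth 0%N small_primes j).

Lemma nth_prime j : (j < size s)%N -> prime (sj j).
Proof. by move=> js; apply: (all_nthP 0%N s_prime). Qed.

Lemma nth_lt j : (j.+1 < size s)%N -> (sj j < sj j.+1)%N.
Proof. by move=> js; apply: (sortedP 0%N s_sorted). Qed.

Lemma small_primes_le j : (j < size s)%N -> (j < 32)%N -> (T j <= sj j)%N.
Proof.
elim: j => [|j IH] js j32; first exact: prime_gt1 (nth_prime js).
have lt := nth_lt js; have le := IH (ltnW js) (ltnW j32).
rewrite leqNgt; apply/negP => lt2; have := nth_prime js; apply/negP.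
have := allP small_primes_consecutive j; rewrite mem_iota => /(_ j32) /allP; apply.
by rewrite mem_iota; move: lt2 lt le; lia.
Qed.

Lemma prime_mod6 q : prime q -> (3 < q)%N -> (q %% 6 == 1)%N || (q %% 6 == 5)%N.
Proof.
move=> qp q3; have n2 : ~~ (2 %| q)%N by rewrite dvdn_prime2 //; lia.
have n3 : ~~ (3 %| q)%N by rewrite dvdn_prime2 //; lia.
by move: n2 n3; lia.
Qed.

(** Primes above 3 are 1 or 5 modulo 6, so two steps in an increasing list of them advance by at
    least 6. *)
Lemma nth_add6 j : (2 <= j)%N -> (j.+2 < size s)%N -> (sj j + 6 <= sj j.+2)%N.
Proof.
move=> j2 js; have l1 := nth_lt js; have l0 := nth_lt (ltnW js).
have j3 : (3 < sj j)%N.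
  have : (T 2 <= sj 2)%N by apply: small_primes_le => //; lia.
  have : (sj 2 <= sj j)%N.
    rewrite leq_eqVlt; case: (ltngtP 2 j) j2 => // [lt _|<- _]; last by rewrite eqxx.
    by rewrite (sorted_ltn_nth ltn_trans 0%N s_sorted) ?orbT // inE; lia.
  by rewrite /=; lia.
have m0 := prime_mod6 (nth_prime (ltnW (ltnW js))) j3.
have m1 := prime_mod6 (nth_prime (ltnW js)) (ltn_trans j3 l0).
have m2 := prime_mod6 (nth_prime js) (ltn_trans j3 (ltn_trans l0 l1)).
by move: l0 l1 m0 m1 m2; move: (sj j) (sj j.+1) (sj j.+2) => a b c; lia.
Qed.

(** Two steps gain at least 6 where 5 would do; the start is 23 and 29 at indices 8 and 9. *)
Lemma nth_linear j : (8 <= j)%N -> (j < size s)%N -> (5 * j.+1 <= 2 * sj j)%N.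
Proof.
elim: j {-2}j (leqnn j) => [|m IH] j jm j8 js; first by lia.
have [j10|j10] := ltnP j 10.
  have : (T j <= sj j)%N by apply: small_primes_le => //; lia.
  have [->|->] : j = 8 \/ j = 9 by lia.
    by rewrite /=; lia.
  by rewrite /=; lia.
case: j j10 jm j8 js => [|[|j]] // j10 jm j8 js.
have := IH j; have := @nth_add6 j; lia.
Qed.

Lemma recip_sum_drop c : recip_sum (drop c s) = \sum_(c <= j < size s) (sj j)%:R^-1.
Proof.
rewrite /recip_sum (big_nth 0%N) size_drop -[in RHS](add0n c) big_addn.
by apply: eq_bigr => j _; rewrite nth_drop addnC.
Qed.

Lemma recip_sum_small c m : (size s <= m)%N -> (m <= 32)%N ->
  recip_sum (drop c s) <= \sum_(c <= j < m) (T j)%:R^-1.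
Proof.
move=> sm m32; rewrite recip_sum_drop.
have [cs|cs] := leqP c (size s); last first.
  by rewrite big_geq ?(ltnW cs) //; apply: sumr_ge0 => j _; rewrite invr_ge0.
rewrite [X in _ <= X](big_cat_nat (n := size s)) //= -[X in X <= _]addr0; apply: lerD; last first.
  by apply: sumr_ge0 => j _; rewrite invr_ge0.
rewrite big_nat [X in _ <= X]big_nat; apply: ler_sum => j /andP[_ js].
have j32 : (j < 32)%N := leq_trans js (leq_trans sm m32).
have T0 : (0 < T j)%N.
  have : all (fun j => 0 < T j)%N (iota 0 32) by [].
  by move/allP; apply; rewrite mem_iota.
have le := small_primes_le js j32.
by rewrite lef_pV2 ?posrE ?ltr0n ?ler_nat // (leq_trans T0).
Qed.

Lemma recip_sum_linear c : (8 <= c)%N -> (size s <= 4 * c + 3)%N ->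
  recip_sum (drop c s) <= 2%:R / 5%:R * \sum_(c <= j < 4 * c + 3) j.+1%:R^-1.
Proof.
move=> c8 sc; rewrite recip_sum_drop mulr_sumr; have c25 : 0 <= 2%:R / 5%:R :> rat by lra.
have [cs|cs] := leqP c (size s); last first.
  by rewrite big_geq ?(ltnW cs) //; apply: sumr_ge0 => j _; apply: mulr_ge0 c25 _; rewrite invr_ge0 ler0n.
rewrite [X in _ <= X](big_cat_nat (n := size s)) //= -[X in X <= _]addr0; apply: lerD; last first.
  by apply: sumr_ge0 => j _; apply: mulr_ge0 c25 _; rewrite invr_ge0 ler0n.
rewrite big_nat [X in _ <= X]big_nat; apply: ler_sum => j /andP[cj js].
have le := nth_linear (leq_trans c8 cj) js.
have s0 : (0 < sj j)%N := prime_gt0 (nth_prime js).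
have leQ : 5%:R * j.+1%:R <= 2%:R * (sj j)%:R :> rat by rewrite -!natrM ler_nat.
have a0 : (0 : rat) < (sj j)%:R by rewrite ltr0n.
have b0 : (0 : rat) < j.+1%:R by rewrite ltr0n.
move: leQ a0 b0; move: (sj j)%:R j.+1%:R => a b leQ a0 b0; rewrite -subr_ge0.
have -> : 2%:R / 5%:R * b^-1 - a^-1 = (2%:R * a - 5%:R * b) / (5%:R * (a * b)) by field; lra.
apply: divr_ge0; first by rewrite subr_ge0.
by apply: mulr_ge0; [lra | exact: ltW (mulr_gt0 a0 b0)].
Qed.

Lemma prod_lower m : (m <= size s)%N -> (m <= 32)%N -> (\prod_(0 <= j < m) T j <= \prod_(q <- s) q)%N.
Proof.
move=> ms m32; rewrite [X in (_ <= X)%N](big_nth 0%N) [X in (_ <= X)%N](big_cat_nat (n := m)) //= -[X in (X <= _)%N]muln1.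
apply: leq_mul.
  rewrite big_nat [X in (_ <= X)%N]big_nat; apply: leq_prod => j /andP[_ jm].
  by apply: small_primes_le; [exact: leq_trans ms | exact: leq_trans m32].
rewrite big_nat_cond; apply: (big_ind (fun x => 1 <= x)%N) => // [x y x0 y0|j /andP[/andP[_ js] _]].
  by rewrite muln_gt0 x0 y0.
exact: prime_gt0 (nth_prime js).
Qed.

Lemma nth_ge131 j : (31 <= j)%N -> (j < size s)%N -> (131 <= sj j)%N.
Proof.
move=> j31 js; have l : (T 31 <= sj 31)%N by apply: small_primes_le => //; apply: leq_ltn_trans js.
apply: leq_trans l _; rewrite leq_eqVlt; case: (ltngtP 31 j) j31 => // [lt _|<- _]; last by rewrite eqxx.
by rewrite (sorted_ltn_nth ltn_trans 0%N s_sorted) ?orbT // inE; lia.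
Qed.

Lemma prod_lower_large i : (32 + i <= size s)%N ->
  ((\prod_(0 <= j < 32) T j) * 131 ^ i <= \prod_(q <- s) q)%N.
Proof.
move=> si; rewrite [X in (_ <= X)%N](big_nth 0%N) [X in (_ <= X)%N](big_cat_nat (n := 32)) //=; last by apply: leq_trans si; exact: leq_addr.
apply: leq_mul.
  rewrite big_nat [X in (_ <= X)%N]big_nat; apply: leq_prod => j /andP[_ jm].
  by apply: small_primes_le => //; apply: leq_trans si; apply: ltn_addr.
rewrite (big_cat_nat (n := 32 + i)) ?leq_addr //= -[X in (X <= _)%N]muln1; apply: leq_mul.
  have -> : (131 ^ i = \prod_(32 <= j < 32 + i) 131)%N by rewrite prod_nat_const_nat addKn.
  rewrite big_nat [X in (_ <= X)%N]big_nat; apply: leq_prod => j /andP[j32 ji].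
  by apply: nth_ge131; [exact: ltnW | exact: leq_trans si].
rewrite big_nat_cond; apply: (big_ind (fun x => 1 <= x)%N) => // [x y x0 y0|j /andP[/andP[_ js] _]].
  by rewrite muln_gt0 x0 y0.
exact: prime_gt0 (nth_prime js).
Qed.

End PrimeSequences.

Lemma exists_root k n : (0 < k)%N -> exists w, (w ^ k <= n)%N && (n < w.+1 ^ k)%N.
Proof.
move=> k0; have ex : exists w, (w ^ k <= n)%N by exists 0%N; rewrite exp0n.
have bnd w : (w ^ k <= n -> w <= n)%N.
  by case: w => // w; apply: leq_trans; rewrite -[X in (X <= _)%N]expn1 leq_pexp2l.
case: (ex_maxnP ex bnd) => w wn wmax; exists w; rewrite wn ltnNge; apply/negP => /wmax.
by rewrite ltnn.
Qed.

(** * Numerical bounds for each range of the number of prime factors *)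

(** The number in [kappa20], [kappa23], [kappa31] is the largest number N of prime factors covered.
    With a core of three primes, kappa is at least [8 (N - 2) / delta], where [delta] is a lower
    bound for 1 minus the sum of reciprocals of the 4th to N-th primes. *)
Fact kappa20_key : {x : rat | x = 496%:R}. Proof. by eexists. Qed.
Definition kappa20 := sval kappa20_key.
Lemma kappa20E : kappa20 = 496%:R. Proof. exact: svalP kappa20_key. Qed.
Fact kappa23_key : {x : rat | x = 667%:R}. Proof. by eexists. Qed.
Definition kappa23 := sval kappa23_key.
Lemma kappa23E : kappa23 = 667%:R. Proof. exact: svalP kappa23_key. Qed.
Fact kappa31_key : {x : rat | x = 1330%:R}. Proof. by eexists. Qed.
Definition kappa31 := sval kappa31_key.
Lemma kappa31E : kappa31 = 1330%:R. Proof. exact: svalP kappa31_key. Qed.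
Fact delta19_key : {x : rat | x = 304%:R / 1000%:R}. Proof. by eexists. Qed.
Definition delta19 := sval delta19_key.
Lemma delta19E : delta19 = 304%:R / 1000%:R. Proof. exact: svalP delta19_key. Qed.
Fact delta20_key : {x : rat | x = 2904%:R / 10000%:R}. Proof. by eexists. Qed.
Definition delta20 := sval delta20_key.
Lemma delta20E : delta20 = 2904%:R / 10000%:R. Proof. exact: svalP delta20_key. Qed.
Fact delta23_key : {x : rat | x = 252%:R / 1000%:R}. Proof. by eexists. Qed.
Definition delta23 := sval delta23_key.
Lemma delta23E : delta23 = 252%:R / 1000%:R. Proof. exact: svalP delta23_key. Qed.
Fact delta31_key : {x : rat | x = 175%:R / 1000%:R}. Proof. by eexists. Qed.
Definition delta31 := sval delta31_key.
Lemma delta31E : delta31 = 175%:R / 1000%:R. Proof. exact: svalP delta31_key. Qed.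
(** Equal to [1 - (2/5) (29/20)], from the linear lower bound on the primes and the harmonic
    block. *)
Fact delta_large_key : {x : rat | x = 42%:R / 100%:R}. Proof. by eexists. Qed.
Definition delta_large := sval delta_large_key.
Lemma delta_largeE : delta_large = 42%:R / 100%:R. Proof. exact: svalP delta_large_key. Qed.

Local Notation T j := (nth 0%N small_primes j).

Lemma recip19 : \sum_(3 <= j < 19) (T j)%:R^-1 <= 1 - delta19.
Proof. rewrite unlock /= delta19E; lra. Qed.
Lemma recip20 : \sum_(3 <= j < 20) (T j)%:R^-1 <= 1 - delta20.
Proof. rewrite unlock /= delta20E; lra. Qed.
Lemma recip23 : \sum_(3 <= j < 23) (T j)%:R^-1 <= 1 - delta23.
Proof. rewrite unlock /= delta23E; lra. Qed.
Lemma recip31 : \sum_(3 <= j < 31) (T j)%:R^-1 <= 1 - delta31.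
Proof. rewrite unlock /= delta31E; lra. Qed.

Definition primorial m : rat := \prod_(0 <= j < m) (T j)%:R.
Lemma primorial20 : prime_min20 <= primorial 20.
Proof. rewrite /primorial unlock /= prime_min20E; lra. Qed.
Lemma kappa20_bound : kappa20 ^+ 16 <= window_const ^+ 4 * primorial 20.
Proof. rewrite /primorial unlock /= kappa20E window_constE; lra. Qed.
Lemma kappa23_bound : kappa23 ^+ 16 <= window_const ^+ 4 * primorial 21.
Proof. rewrite /primorial unlock /= kappa23E window_constE; lra. Qed.
Lemma kappa31_bound : kappa31 ^+ 16 <= window_const ^+ 4 * primorial 24.
Proof. rewrite /primorial unlock /= kappa31E window_constE; lra. Qed.

Fact inv_delta_large_key : {x : rat | x = 50%:R / 21%:R}. Proof. by eexists. Qed.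
Definition inv_delta_large := sval inv_delta_large_key.
Lemma inv_delta_largeE : inv_delta_large = 50%:R / 21%:R. Proof. exact: svalP inv_delta_large_key. Qed.
(** With [c] core primes and at most [4 c + 3] in all, [1 + size rest] is at most [3 c + 4]. *)
Definition kappa_large c : rat := 2%:R ^+ c * (3 * c + 4)%:R * inv_delta_large.
Lemma kappa32_bound : kappa_large 8 ^+ 16 <= window_const ^+ 4 * primorial 32.
Proof. rewrite /kappa_large /primorial unlock /= inv_delta_largeE window_constE; lra. Qed.

(** Raising [c] by 1 multiplies [kappa_large] by at most [31 / 14], the ratio at [c = 8]. It comes
    with four more primes, each at least 131, and [(31/14)^16] is far below [131^4]. *)
Lemma kappa_large_succ c : (8 <= c)%N -> kappa_large c.+1 ^+ 16 <= kappa_large c ^+ 16 * 131%:R ^+ 4.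
Proof.
move=> c8; have f00 : 0 <= inv_delta_large by rewrite inv_delta_largeE; lra.
have b0 : 0 <= kappa_large c by rewrite !mulr_ge0 ?exprn_ge0.
have le : kappa_large c.+1 * 14%:R <= kappa_large c * 31%:R.
  have -> : kappa_large c.+1 * 14%:R = (2%:R ^+ c * inv_delta_large) * (28%:R * (3 * c.+1 + 4)%:R).
    by rewrite /kappa_large exprS; ring.
  have -> : kappa_large c * 31%:R = (2%:R ^+ c * inv_delta_large) * (31%:R * (3 * c + 4)%:R).
    by rewrite /kappa_large; ring.
  apply: ler_wpM2l; first by apply: mulr_ge0 f00; exact: exprn_ge0.
  by rewrite -!natrM ler_nat; lia.
have le2 : kappa_large c.+1 <= kappa_large c * (31%:R / 14%:R) by lra.
have b1 : 0 <= kappa_large c.+1 by rewrite !mulr_ge0 ?exprn_ge0.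
have le3 : kappa_large c.+1 ^+ 16 <= kappa_large c ^+ 16 * (31%:R / 14%:R) ^+ 16.
  by rewrite -exprMn lerXn2r // nnegrE; apply: le_trans b1 le2.
apply: le_trans le3 _; apply: ler_wpM2l; first exact: exprn_ge0.
lra.
Qed.

Lemma kappa_large_le c : (8 <= c)%N ->
  kappa_large c ^+ 16 <= window_const ^+ 4 * (primorial 32 * 131%:R ^+ (4 * (c - 8))).
Proof.
elim: c => [//|c IH]; rewrite leq_eqVlt => /orP[/eqP <-|c8].
  by rewrite subnn muln0 expr0 mulr1 kappa32_bound.
apply: le_trans (kappa_large_succ c8) _.
have -> : (4 * (c.+1 - 8) = 4 * (c - 8) + 4)%N by lia.
have q0 : 0 <= 131%:R ^+ 4 :> rat by apply: exprn_ge0.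
rewrite [131%:R ^+ (_ + 4)]exprD; move: q0 (IH c8); move: (131%:R ^+ 4 : rat) => q q0 le.
by rewrite !mulrA in le *; apply: ler_wpM2r.
Qed.

Lemma small_case_arith (x d y : rat) : x <= 8%:R * (2%:R * d + y - 1) -> delta19 <= d -> y <= 16%:R ->
  x - d <= kappa_small * d.
Proof. by rewrite delta19E kappa_smallE => *; lra. Qed.

(** * Choice of the core according to the number of prime factors *)

Section Assembly.
Variables (p H : nat) (p_pr : prime p) (oddp : odd p).
Local Notation F := 'F_p.
Hypothesis nonprimitive : forall n, (0 < n <= H)%N ->
  exists2 l, l \in primes p.-1 & power_residue l (n%:R : F).
Hypotheses (H_le : H%:R ^+ 2 <= search_const * p%:R :> rat) (H_ge : search_const * p%:R < (H%:R + 1) ^+ 2 :> rat).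
Hypothesis p_ge : prime_min <= p%:R.
Let s := primes p.-1.
Let n := size s.

Lemma s_sorted : sorted ltn s. Proof. exact: sorted_primes. Qed.
Lemma s_prime : all prime s.
Proof. by apply/allP => q; rewrite mem_primes => /and3P[]. Qed.
Lemma s_head : s = 2%N :: behead s.
Proof.
have two : 2%N \in s.
  by rewrite mem_primes (p1_gt0 p_pr) /= dvdn2 -subn1 oddB ?prime_gt0 // oddp.
have := s_sorted; have := s_prime; move: two; case: (s) => // a t /= two /andP[ap _] so.
congr (_ :: _); apply/eqP; rewrite eqn_leq (prime_gt1 ap) andbT.
move: two; rewrite inE => /orP[/eqP -> //|t2].
have /allP := order_path_min ltn_trans so; move=> /(_ 2%N t2); exact: ltnW.
Qed.

Lemma split_primes c : (0 < c)%N -> primes p.-1 = 2%N :: take c.-1 (behead s) ++ drop c s.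
Proof.
case: c => // c _; rewrite -[LHS]/s {1}s_head; congr (_ :: _).
have -> : drop c.+1 s = drop c (behead s) by rewrite {1}s_head.
by rewrite cat_take_drop.
Qed.

Lemma prod_le_p : (\prod_(q <- s) q <= p)%N.
Proof.
apply: leq_trans (leq_pred p); apply: dvdn_leq (p1_gt0 p_pr) _.
apply: prod_primes_dvd; [exact: primes_uniq | exact: s_prime |].
by move=> q; rewrite mem_primes => /and3P[].
Qed.

Lemma primorial_le_p m : (m <= n)%N -> (m <= 32)%N -> primorial m <= p%:R.
Proof.
move=> mn m32; rewrite /primorial -natr_prod ler_nat.
exact: leq_trans (prod_lower s_sorted s_prime mn m32) prod_le_p.
Qed.

Lemma small_case : (n <= 19)%N -> False.
Proof.
move=> n19; have rec : recip_sum (drop 3 s) <= 1 - delta19.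
  exact: le_trans (recip_sum_small s_sorted s_prime 3 n19 isT) recip19.
have e0 : 0 < delta19 by rewrite delta19E; lra.
have d1 : delta19 <= 1 - recip_sum (drop 3 s) by rewrite lerBrDr addrC -lerBrDr.
have d0 : 0 < 1 - recip_sum (drop 3 s) := lt_le_trans e0 d1.
have pE := split_primes (isT : (0 < 3)%N).
apply: (second_moment_contradiction p_pr oddp nonprimitive pE d0 H_le H_ge p_ge).
rewrite (A0E pE); set d := 1 - recip_sum _ in d1 d0 *; set S := size (drop 3 s).
have S16 : (S <= 16)%N by rewrite /S size_drop; move: n19; rewrite /n; lia.
have c3 : ((size (take 3.-1 (behead s))).+1 <= 3)%N by rewrite ltnS size_take_min geq_minl.
(* An empty rest has [d = 1]; otherwise [S >= 1]. *)
have pos : 0 <= 2%:R * d + S%:R - 1.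
  case S0 : S => [|S'].
    have : drop 3 s = [::] by apply: size0nil.
    by move=> nil; rewrite /d nil /recip_sum big_nil subr0; lra.
  by rewrite -natr1; have := ler0n rat S'; lra.
have pw : 2%:R ^+ (size (take 3.-1 (behead s))).+1 <= 8%:R :> rat.
  have -> : 8%:R = 2%:R ^+ 3 :> rat by ring.
  by apply: ler_weXn2l => //; rewrite ler1n.
have le := ler_wpM2r pos pw.
have S16Q : S%:R <= 16%:R :> rat by rewrite ler_nat.
exact: small_case_arith le d1 S16Q.
Qed.

Lemma large_case c (d0 k : rat) : (0 < c <= n)%N -> 0 < d0 -> recip_sum (drop c s) <= 1 - d0 ->
  2%:R ^+ c * (1 + (n - c)%:R) <= k * d0 -> k ^+ 16 <= window_const ^+ 4 * p%:R -> prime_min20 <= p%:R -> False.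
Proof.
case/andP=> c0 cn d00 rec kd kp p25.
have d1 : d0 <= 1 - recip_sum (drop c s) by rewrite lerBrDr addrC -lerBrDr.
have dpos : 0 < 1 - recip_sum (drop c s) := lt_le_trans d00 d1.
have pE := split_primes c0; have [w /andP[w1 w2]] := exists_root p (isT : (0 < 4)%N).
have k0 : 0 < k.
  rewrite -(pmulr_lgt0 _ d00); apply: lt_le_trans kd.
  by rewrite mulr_gt0 ?exprn_gt0 // ltr_wpDr.
apply: (fourth_moment_contradiction p_pr oddp nonprimitive pE dpos H_le H_ge p_ge w1 w2 p25 (k := k)) => //.
have -> : (size (take c.-1 (behead s))).+1 = c.
  by rewrite size_takel ?prednK // size_behead -!subn1 leq_sub2r.
rewrite size_drop; apply: le_trans kd _; apply: ler_wpM2l d1; exact: ltW.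
Qed.

(** The ranges are 20, 21 to 23, 24 to 31, and 32 or more. In each bounded range the largest number
    of prime factors determines kappa, and the smallest one bounds p from below by a primorial. *)
Lemma nonprimitive_contradiction : False.
Proof.
have [n19|n20] := leqP n 19; first exact: small_case n19.
have p25 : prime_min20 <= p%:R := le_trans primorial20 (primorial_le_p n20 isT).
have k20 : 0 <= window_const ^+ 4 by rewrite exprn_ge0 // window_constE; lra.
have scale (k : rat) m : (m <= n)%N -> (m <= 32)%N -> k ^+ 16 <= window_const ^+ 4 * primorial m ->
    k ^+ 16 <= window_const ^+ 4 * p%:R.
  by move=> mn m32 le; apply: le_trans le _; apply: ler_wpM2l => //; apply: primorial_le_p.
have n3 : (0 < 3 <= n)%N by apply: ltn_trans n20.
have eight (m : nat) : (n <= m + 2)%N -> 2%:R ^+ 3 * (1 + (n - 3)%:R) <= 8%:R * m%:R :> rat.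
  move=> nm; have -> : 2%:R ^+ 3 * (1 + (n - 3)%:R) = 8%:R * (n - 2)%:R :> rat.
    have -> : (n - 2 = 1 + (n - 3))%N by lia.
    by rewrite natrD; ring.
  by rewrite ler_wpM2l // ler_nat; lia.
have [nle|n21] := leqP n 20.
  apply: (@large_case 3 delta20 kappa20) => //; first by rewrite delta20E; lra.
  - exact: le_trans (recip_sum_small s_sorted s_prime 3 nle isT) recip20.
  - by apply: le_trans (@eight 18 nle) _; rewrite delta20E kappa20E; lra.
  exact: scale kappa20_bound.
have [nle|n24] := leqP n 23.
  apply: (@large_case 3 delta23 kappa23) => //; first by rewrite delta23E; lra.
  - exact: le_trans (recip_sum_small s_sorted s_prime 3 nle isT) recip23.
  - by apply: le_trans (@eight 21 nle) _; rewrite delta23E kappa23E; lra.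
  exact: scale kappa23_bound.
have [nle|n32] := leqP n 31.
  apply: (@large_case 3 delta31 kappa31) => //; first by rewrite delta31E; lra.
  - exact: le_trans (recip_sum_small s_sorted s_prime 3 nle isT) recip31.
  - by apply: le_trans (@eight 29 nle) _; rewrite delta31E kappa31E; lra.
  exact: scale kappa31_bound.
(* A core of a quarter of the primes leaves a reciprocal sum bounded uniformly by 0.58, while
   [2 ^ c] stays negligible against the primorial. *)
set c := (n %/ 4)%N; have c8 : (8 <= c)%N by rewrite /c; lia.
have nc : (n <= 4 * c + 3)%N by rewrite /c; lia.
apply: (@large_case c delta_large (kappa_large c)) => //; first by rewrite (leq_trans _ c8) //= leq_div.
- by rewrite delta_largeE; lra.
- apply: le_trans (recip_sum_linear s_sorted s_prime c8 nc) _.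
  have h := harmonic_block c8.
  by move: h; rewrite delta_largeE harmonic_boundE; set x : rat := \sum_(_ <= _ < _) _; lra.
- have -> : kappa_large c * delta_large = 2%:R ^+ c * (3 * c + 4)%:R.
    by rewrite /kappa_large inv_delta_largeE delta_largeE; field.
  apply: ler_wpM2l; first exact: exprn_ge0.
  by rewrite (_ : 1 = 1%:R) // -natrD ler_nat; lia.
apply: le_trans (kappa_large_le c8) _; apply: ler_wpM2l => //.
rewrite /primorial -natr_prod -natrX -natrM ler_nat; apply: leq_trans prod_le_p.
by apply: prod_lower_large s_sorted s_prime _ _; rewrite -/n /c; lia.
Qed.

End Assembly.

(** * From power residues back to primitive roots *)

Lemma card_units_Fp p : prime p -> #|[set: {unit 'F_p}]| = p.-1.
Proof. by move=> p_pr; rewrite card_finField_unit card_Fp. Qed.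

(** The unit generates a proper subgroup; any prime [l] dividing its index serves, since the order
    then divides [(p - 1) / l]. *)
Lemma not_primroot_residue p a : prime p -> (0 < a < p)%N -> ~~ is_primroot p a ->
  exists2 l, l \in primes p.-1 & power_residue l (a%:R : 'F_p).
Proof.
move=> p_pr /andP[a0 ap]; rewrite /is_primroot.
have a_neq0 : (a%:R : 'F_p) != 0 by rewrite natF_neq0 // a0.
case: insubP => [u _ uE|nu]; last by rewrite -unitfE in a_neq0; rewrite a_neq0 in nu.
move=> not_gen; pose G := [set: {unit 'F_p}]%G.
have uG : (<[u]> \subset G)%g by apply: subsetT.
have idx : (1 < #|G : <[u]>|%g)%N by rewrite indexg_gt1; apply: contra not_gen; rewrite eqEsubset uG.
have lag := Lagrange uG.
have cG : #|G| = p.-1 := card_units_Fp p_pr.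
have l_pr := pdiv_prime idx; have l_dvd := pdiv_dvd #|G : <[u]>|%g.
set l := pdiv _ in l_pr l_dvd.
exists l.
  rewrite mem_primes l_pr -cG cardG_gt0 -lag.
  exact: dvdn_mull.
rewrite /power_residue -uE -FinRing.val_unitX.
have -> : (u ^+ (p.-1 %/ l) = 1)%g.
  apply/eqP; rewrite -order_dvdn -cG -lag -muln_divA //; exact: dvdn_mulr.
exact: eqxx.
Qed.

Lemma g_le p a : (0 < a <= p)%N -> is_primroot p a -> (g p <= a)%N.
Proof.
move=> a_range prim_a; rewrite /g.
have : a \in [seq a <- iota 1 p | is_primroot p a].
  by rewrite mem_filter prim_a mem_iota add1n ltnS.
have : sorted leq [seq a <- iota 1 p | is_primroot p a].
  by apply: sorted_filter; [exact: leq_trans | exact: iota_sorted].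
case: [seq _ <- _ | _] => //= b s; rewrite (path_sortedE leq_trans) => /andP[/allP le_b _].
by rewrite inE => /predU1P[->|/le_b].
Qed.

Lemma g_square_le p N : N%:R = search_const -> prime p -> prime_min <= p%:R -> (g p ^ 2 <= N * p)%N.
Proof.
move=> NK p_pr p_ge.
have oddp : odd p by have [p2|//] := even_prime p_pr; move: p_ge; rewrite p2 prime_minE; lra.
have [H /andP[H1 H2]] := exists_root (N * p) (isT : (0 < 2)%N).
have H_le : H%:R ^+ 2 <= search_const * p%:R :> rat by rewrite -NK -natrM -natrX ler_nat.
have H_ge : search_const * p%:R < (H%:R + 1) ^+ 2 :> rat.
  by rewrite -NK -natrM natr1 -natrX ltr_nat.
have Hp := H_lt_p p_pr H_le p_ge.
have [/hasP[a]|/hasPn none] := boolP (has (is_primroot p) (iota 1 H)).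
  rewrite mem_iota add1n ltnS => /andP[a0 aH] prim_a.
  apply: leq_trans H1; rewrite leq_exp2r //.
  by apply: (leq_trans _ aH); apply: g_le => //; rewrite a0 (leq_trans aH) // ltnW.
case: (nonprimitive_contradiction p_pr oddp _ H_le H_ge p_ge) => n /andP[n0 nH].
apply: not_primroot_residue => //; first by rewrite n0 (leq_ltn_trans nH).
by apply: none; rewrite mem_iota add1n ltnS n0.
Qed.

Close Scope ring_scope.
Local Open Scope R_scope.

(** * Passage to real exponents and the rows of the table *)

Lemma INR_exp m n : INR (expn m n) = INR m ^ n.
Proof. by elim: n => [|n IHn] //; rewrite expnS -multE mult_INR IHn. Qed.

Lemma K_nat_exists : exists2 N : nat, (N%:R = search_const)%R & INR N = 385000.
Proof.
exists (385 * 10 ^ 3)%N; first by rewrite search_constE natrM natrX.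
rewrite -multE mult_INR INR_exp !INR_IZR_INZ /=; Lra.lra.
Qed.

Lemma B_nat_exists : exists2 M : nat, (M%:R = prime_min)%R & INR M = 10 ^ 23.
Proof.
by exists (10 ^ 23)%N; [rewrite prime_minE natrX | rewrite INR_exp !INR_IZR_INZ].
Qed.

(** Taking 200th powers clears the denominator of [alpha]: [y^200 <= (385000 x)^100], which is below
    [x^(100 + a)] because [385000^100 <= m^a] and [m < x]. Only a comparison of integers remains. *)
Lemma lt_Rpower_of_square (alpha x y : R) (a : nat) (m : Z) :
  alpha = / 2 + INR a / 200 -> Z.lt 0 m -> (0 < a)%N ->
  Z.le (Z.pow 385000 100) (Z.pow m (Z.of_nat a)) ->
  IZR m < x -> 0 <= y -> y ^ 2 <= 385000 * x -> y < Rpower x alpha.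
Proof.
move=> alphaE m0 a0 num mx y0 y2.
have m_pos : 0 < IZR m by apply: IZR_lt.
have x0 : 0 < x by apply: Rlt_trans mx.
have z0 : 0 < Rpower x alpha by apply: exp_pos.
have zE : Rpower x alpha ^ 200 = x ^ a * x ^ 100.
  rewrite -[LHS]Rpower_pow // Rpower_mult -pow_add -Rpower_pow //; congr Rpower.
  rewrite alphaE plus_INR (INR_IZR_INZ 200) (INR_IZR_INZ 100) /=; Lra.lra.
have yz : y ^ 200 < Rpower x alpha ^ 200.
  rewrite zE; apply: (Rle_lt_trans _ ((385000 * x) ^ 100)).
    rewrite (_ : 200%N = (2 * 100)%coq_nat) // pow_mult; apply: pow_incr; split=> //.
    exact: pow2_ge_0.
  rewrite Rpow_mult_distr; apply: Rmult_lt_compat_r; first exact: pow_lt.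
  apply: (Rle_lt_trans _ (IZR m ^ a)).
    by rewrite !pow_IZR; apply: IZR_le.
  by rewrite -!Rpower_pow //; apply: Rlt_Rpower_l; [exact/lt_0_INR/ssrnat.ltP | split].
apply: Rnot_le_lt => zy; apply: (Rlt_not_le _ _ yz); apply: pow_incr; split=> //; exact: Rlt_le.
Qed.

(** Each [palpha] is an integer [c * 10^e], so the numerical side conditions of a row can be decided
    by integer computation. *)
Lemma g_lt_Rpower (a c e p : nat) (alpha palpha : R) :
  prime p -> alpha = / 2 + IZR (Z.of_nat a) / 200 -> palpha = IZR (Z.of_nat c) / 100 * 10 ^ e.+2 ->
  let m := Z.mul (Z.of_nat c) (Z.pow 10 (Z.of_nat e)) in
  [&& (0 < a)%N, Z.leb (Z.pow 10 23) m & Z.leb (Z.pow 385000 100) (Z.pow m (Z.of_nat a))] ->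
  palpha < INR p -> INR (g p) < Rpower (INR p) alpha.
Proof.
rewrite -INR_IZR_INZ => p_pr alphaE palphaE m /and3P[a0 /Z.leb_le m_ge /Z.leb_le num].
have -> : palpha = IZR m by rewrite palphaE mult_IZR -pow_IZR /=; Lra.lra.
move=> mp; have m0 : Z.lt 0 m by apply: (Z.lt_le_trans _ (Z.pow 10 23)).
have [N NK NR] := K_nat_exists; have [M MB MR] := B_nat_exists.
apply: (lt_Rpower_of_square alphaE m0 a0 num mp); first exact: pos_INR.
have Mp : (prime_min <= p%:R)%R.
  rewrite -MB ler_nat; apply/ssrnat.leP/INR_le; rewrite MR; apply: Rle_trans (Rlt_le _ _ mp).
  by rewrite pow_IZR; apply: IZR_le.
have /ssrnat.leP/le_INR := g_square_le NK p_pr Mp.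
by rewrite -multE mult_INR NR INR_exp.
Qed.

Close Scope R_scope.

(* Here [a = 200 (alpha - 1/2)] and [palpha = c * 10 ^ e]. *)
Ltac table_row a c e := case=> [[<- <-]|];
  [by apply: (@g_lt_Rpower a c e); [assumption | rewrite /=; Lra.lra | | vm_compute] |].

Theorem theorem5 :
  forall (alpha palpha : R), List.In (alpha, palpha) table5 ->
  forall p : nat, prime p -> Rlt palpha (INR p) ->
  Rlt (INR (g p)) (Rpower (INR p) alpha).
Proof.
move=> alpha palpha in_table p p_pr; move: in_table; rewrite /table5 /List.In.
table_row 24%N 191%N 21%N.
table_row 23%N 197%N 22%N.
table_row 22%N 247%N 23%N.
table_row 21%N 400%N 24%N.
table_row 20%N 852%N 25%N.
table_row 19%N 253%N 27%N.
table_row 18%N 109%N 29%N.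
table_row 17%N 724%N 30%N.
table_row 16%N 821%N 32%N.
table_row 15%N 177%N 35%N.
table_row 14%N 798%N 37%N.
table_row 13%N 942%N 40%N.
table_row 12%N 357%N 44%N.
table_row 11%N 608%N 48%N.
table_row 10%N 727%N 53%N.
by [].
Qed.
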